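(* Let $\mu$ be a nondegenerate Borel probability measure on the kale $\mathcal K$ that is partly sticky and square-integrable, i.e. $\int_{\mathcal K} d(\mathbf 0,q)^2\,d\mu(q)<\infty$. Let $(p_n)_{n\ge1}$ be independent $\mathcal K$-valued random variables with distribution $\mu$ on a probability space $(\Omega,\mathcal A,\mathbb P)$, let $b_N$ be the barycenter of $p_1,\dots,p_N$, and let $\nu_N(U)=\mathbb P(\sqrt N\,b_N\in U)$ for Borel sets $U\subset\mathcal K$. Then the measures $\nu_N$ converge weakly, as $N\to\infty$, to the measure $h_{\theta^*}$ on $\mathcal K$ defined in the context; that is, for any continuous bounded function $\phi:\mathcal K\to\mathbb R$, $$\lim_{N\to\infty}\int_{\mathcal K}\phi(p)\,d\nu_N(p)=\int_{\mathcal K}\phi(p)\,dh_{\theta^*}(p).$$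
   Context: Fix $\alpha>2\pi$. The kale is $\mathcal K=\big((0,\infty)\times(\mathbb R/\alpha\mathbb Z)\big)\cup\{\mathbf 0\}$; points are written $(r,\theta)$ with $r\ge 0$, $\theta\in\mathbb R/\alpha\mathbb Z$, and $(0,\theta)=\mathbf 0$ for every $\theta$. For angles put $|\theta'-\theta|=\min_{n\in\mathbb Z}|n\alpha+\theta'-\theta|$; when $|\theta'-\theta|\le\pi$, the symbol $\theta'-\theta$ denotes the unique representative in $[-\pi,\pi]$. The metric is $d((r_1,\theta_1),(r_2,\theta_2))^2=(r_1+r_2)^2$ if $|\theta_1-\theta_2|\ge\pi$ and $=r_1^2+r_2^2-2r_1r_2\cos|\theta_1-\theta_2|$ if $|\theta_1-\theta_2|\le\pi$; in particular $d(\mathbf 0,(r,\theta))=r$. Scaling: $\beta(r,\theta)=(\beta r,\theta)$ for $\beta\ge0$. Folding map: $F_\theta:\mathcal K\to\mathbb R^2$ sends $\mathbf 0$ to $0$ and, in polar coordinates on $\mathbb R^2$, $F_\theta(r',\theta')=(r',\theta'-\theta)$ if $r'>0$, $|\theta'-\theta|\le\pi$, and $F_\theta(r',\theta')=(r',\pi)$ if $r'>0$, $|\theta'-\theta|\ge\pi$. Let $\tilde\mu_\theta=\mu\circ F_\theta^{-1}$ be the pushforward of $\mu$ to $\mathbb R^2$. The folded first moment is $m_\theta=\int_{\mathcal K}F_\theta(p)\,d\mu(p)=(m_{\theta,1},m_{\theta,2})\in\mathbb R^2$ (cartesian coordinates). Let $K=\{\theta: m_{\theta,1}\ge 0\}$.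 The measure $\mu$ is partly sticky if $K\neq\emptyset$ and $m_{\theta,1}=0$ for all $\theta\in K$. Nondegenerate means: $\mu(R_{\theta,\theta'})<1$ for all angles $\theta,\theta'$ with $|\theta-\theta'|\ge\pi$, where $R_{\theta,\theta'}=\{(r,\theta):r\ge 0\}\cup\{(r,\theta'):r\ge 0\}$. For nondegenerate partly sticky $\mu$, the set $K$ is a closed interval $[A,B]$ of length $<\pi$ (possibly $A=B$); write $K=[A,B]=[\theta^*-\rho,\theta^*+\rho]$ with midpoint $\theta^*$ and $\rho\in[0,\pi/2)$. Barycenter of points: $b_N=\operatorname{arg\,min}_{p\in\mathcal K}\frac1{2N}\sum_{n=1}^N d(p,p_n)^2$ (the minimizer exists and is unique). Limit measure: let $g$ be the law of the (possibly degenerate) normal random vector in $\mathbb R^2$ with mean zero and covariance matrix $\Sigma=\int_{\mathbb R^2}yy^T\,d\tilde\mu_{\theta^*}(y)$. Let $D_\rho=\{(r\cos\vartheta,r\sin\vartheta): r\ge0,\ -\rho\le\vartheta\le\rho\}\subset\mathbb R^2$ and let $\hat P_\rho:\mathbb R^2\to D_\rho$ be the Euclidean nearest-point projection onto the closed convex set $D_\rho$. The map $F_{\theta^*}$ restricts to a bijection from the sector $C_{[A,B]}=\{(r,\theta): r\ge0,\theta\in[A,B]\}$ onto $D_\rho$. Define $h_{\theta^*}=g\circ\hat P_\rho^{-1}\circ F_{\theta^*}$, i.e. $h_{\theta^*}(V)=g\big(\hat P_\rho^{-1}(F_{\theta^*}(V))\big)=g\big(\hat P_\rho^{-1}(F_{\theta^*}(V\cap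 C_{[A,B]}))\big)$ for Borel $V\subset\mathcal K$; equivalently $h_{\theta^*}$ is the pushforward of $g$ under $\hat P_\rho$ followed by the inverse of $F_{\theta^*}|_{C_{[A,B]}}$. *)

(* Defs.v *)
From HB Require Import structures.
From mathcomp Require Import all_boot all_order all_algebra.
From mathcomp Require Import all_classical all_reals all_analysis.

Set Implicit Arguments.
Unset Strict Implicit.
Unset Printing Implicit Defensive.
Import Order.TTheory GRing.Theory Num.Theory.
Import numFieldNormedType.Exports.

Local Open Scope classical_set_scope.
Local Open Scope ring_scope.

Definition argmin (R : realType) (T : pointedType) (D : set T) (f : T -> R) : T :=
  get [set p | D p /\ forall q, D q -> f p <= f q].

Section Circle.
Context {R : realType}.
Implicit Types alpha : R.

Definition multiples alpha : {pred R} :=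
  fun x => `[< exists n : int, x = n%:~R * alpha >].

Lemma multiples_zmod_closed alpha : zmod_closed (multiples alpha).
Proof.
split=> [|x y /asboolP[m ->] /asboolP[n ->]]; apply/asboolP.
  by exists 0; rewrite mul0r.
by exists (m - n); rewrite rmorphB mulrBl.
Qed.

HB.instance Definition _ alpha :=
  GRing.isZmodClosed.Build R (multiples alpha) (multiples_zmod_closed alpha).

(* R / alpha Z as a quotient of abelian groups *)
Definition circle alpha := Quotient.quot (multiples alpha).

HB.instance Definition _ alpha := GRing.Zmodule.on (circle alpha).

Definition angle alpha (x : R) : circle alpha :=
  \pi_(Quotient.quot (multiples alpha))%qT x.

(* The representatives of [a = theta' - theta] are the numbers
   [n * alpha + theta' - theta]. *)
Definition angle_norm alpha (a : circle alpha) : R :=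
  inf [set `|x| | x in [set x | angle alpha x = a]].

Definition angle_rep alpha (a : circle alpha) : R :=
  get [set x | angle alpha x = a /\ - pi <= x <= pi].

Definition angle_interval alpha (theta : circle alpha) (rho : R) : set (circle alpha) :=
  [set theta + angle alpha x | x in `[- rho, rho]].

End Circle.

Section Kale.
Context {R : realType}.
Variable alpha : R.

Inductive kale := Origin | Point of {posnum R} & circle alpha.

HB.instance Definition _ := gen_eqMixin kale.
HB.instance Definition _ := gen_choiceMixin kale.
HB.instance Definition _ := isPointed.Build kale Origin.

Definition kale_radius (p : kale) : R := if p is Point r _ then r%:num else 0.

(* The value at the origin is a placeholder on which nothing below depends; in
   particular both formulas in [kale_dist] agree when one point is the origin. *)
Definition kale_angle (p : kale) : circle alpha :=
  if p is Point _ a then a else 0.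

(* Meant for r >= 0: a negative r also gives the origin. *)
Definition kale_point (r : R) (theta : circle alpha) : kale :=
  if insub r is Some r' then Point r' theta else Origin.

Definition kale_dist (p q : kale) : R :=
  let a := angle_norm (kale_angle q - kale_angle p) in
  Num.sqrt (if pi <= a then (kale_radius p + kale_radius q) ^+ 2
            else kale_radius p ^+ 2 + kale_radius q ^+ 2
                 - 2 * kale_radius p * kale_radius q * cos a).

Definition kale_open (U : set kale) : Prop :=
  forall p, U p -> exists2 e : R, 0 < e & forall q, kale_dist p q < e -> U q.

Lemma kale_openT : kale_open setT.
Proof. by move=> p _; exists 1. Qed.

Lemma kale_openI : setI_closed kale_open.
Proof.
move=> U V oU oV p [/oU[e e0 eU] /oV[f f0 fV]].
exists (Num.min e f); first by rewrite lt_min e0.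
by move=> q; rewrite lt_min => /andP[/eU ? /fV].
Qed.

Lemma kale_open_bigcup (I : Type) (F : I -> set kale) :
  (forall i, kale_open (F i)) -> kale_open (\bigcup_i F i).
Proof.
move=> oF p [i _ /oF[e e0 eF]]; exists e => // q /eF Fq.
by exists i.
Qed.

HB.instance Definition _ := isOpenTopological.Build kale
  kale_openT kale_openI kale_open_bigcup.

HB.instance Definition _ :=
  Measurable.copy kale (g_sigma_algebraType (@open kale)).

Definition dilate (beta : R) (p : kale) : kale :=
  kale_point (beta * kale_radius p) (kale_angle p).

Definition kale_ray (theta : circle alpha) : set kale :=
  [set kale_point r theta | r in [set r : R | 0 <= r]].

Definition fold_angle (a : circle alpha) : R :=
  if angle_norm a <= pi then angle_rep a else pi.

Definition folding (theta : circle alpha) (p : kale) : R * R :=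
  let x := fold_angle (kale_angle p - theta) in
  (kale_radius p * cos x, kale_radius p * sin x).

Definition barycenter (N : nat) (x : nat -> kale) : kale :=
  argmin setT
    (fun q => (2 * N%:R)^-1 * \sum_(n < N) kale_dist q (x n) ^+ 2).

(* The law of sqrt N * b_N, the points being numbered from 0. *)
Definition scaled_barycenter_law d (Omega : measurableType d)
    (P : probability Omega R) (X : nat -> Omega -> kale) (N : nat) :
    set kale -> \bar R :=
  pushforward P
    (fun w => dilate (Num.sqrt N%:R) (barycenter N (fun n => X n w))).

Section Measure.
Variable mu : probability kale R.

Definition square_integrable : Prop :=
  (\int[mu]_q (kale_dist Origin q ^+ 2)%:E < +oo)%E.

Definition nondegenerate_kale : Prop :=
  forall theta theta' : circle alpha, pi <= angle_norm (theta' - theta) ->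
    (mu (kale_ray theta `|` kale_ray theta') < 1)%E.

Definition folded_moment (theta : circle alpha) : R * R :=
  (\int[mu]_p (folding theta p).1, \int[mu]_p (folding theta p).2).

Definition nonneg_directions : set (circle alpha) :=
  [set theta | 0 <= (folded_moment theta).1].

Definition partly_sticky : Prop :=
  nonneg_directions !=set0 /\
  forall theta, nonneg_directions theta -> (folded_moment theta).1 = 0.

End Measure.

End Kale.

Arguments Origin {R alpha}.

Section Plane.
Context {R : realType}.

Definition plane_coord (y : R * R) (i : 'I_2) : R := if i == 0 then y.1 else y.2.

Definition plane_lin (A : 'M[R]_2) (z : R * R) : R * R :=
  (A 0 0 * z.1 + A 0 1 * z.2, A 1 0 * z.1 + A 1 1 * z.2).

Definition second_moment (m : set (R * R) -> \bar R) : 'M[R]_2 :=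
  \matrix_(i, j) fine (\int[m]_y (plane_coord y i * plane_coord y j)%:E)%E.

(* The law of A Z, with Z standard normal in the plane and A A^T = Sigma *)
Definition centered_normal (Sigma : 'M[R]_2) (g : set (R * R) -> \bar R) :
    Prop :=
  exists2 A : 'M[R]_2, A *m A^T = Sigma &
    forall U, measurable U ->
      g U = (normal_prob 0 1 \x normal_prob 0 1)%E (plane_lin A @^-1` U).

Definition plane_sector (rho : R) : set (R * R) :=
  [set y | exists r x : R, [/\ 0 <= r, - rho <= x <= rho &
                           y = (r * cos x, r * sin x)]].

(* The norm of the library on a product is the maximum norm, hence this
   explicit Euclidean distance. *)
Definition plane_dist (y z : R * R) : R :=
  Num.sqrt ((y.1 - z.1) ^+ 2 + (y.2 - z.2) ^+ 2).

Definition sector_proj (rho : R) (y : R * R) : R * R :=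
  argmin (plane_sector rho) (plane_dist y).

End Plane.

(* For 2 * pi < alpha and 0 <= rho < pi / 2, [folding theta] is a
   bijection between the sector of the kale over [angle_interval theta rho] and
   [plane_sector rho], and it maps no other point of the kale into
   [plane_sector rho]. *)
Definition limit_measure (R : realType) (alpha : R) (g : set (R * R) -> \bar R)
    (theta : circle alpha) (rho : R) : set (kale alpha) -> \bar R :=
  fun V => g (sector_proj rho @^-1` (folding theta @` V)).

Definition mutually_independent d d' (Omega : measurableType d)
    (T : measurableType d') (R : realType) (P : probability Omega R)
    (X : nat -> Omega -> T) : Prop :=
  forall (I : seq nat) (U : nat -> set T), uniq I ->
    (forall n, measurable (U n)) ->
    P (\bigcap_(n in [set` I]) (X n @^-1` U n)) =
    (\prod_(n <- I) P (X n @^-1` U n))%E.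

(* Main.v *)
(* The folding F_t is 1-Lipschitz, and d((r, t), q)^2 = r^2 + |q|^2 - 2 r F_t(q)_1.
   Hence the barycenter minimizes r^2 - 2 r M_1(t), where M(t) is the mean of the
   F_t(p_n), and by the growth of this function around its minimum the barycenter
   is determined by the positive part of M_1.  Under the partly sticky hypothesis
   m_theta = 0, almost surely M_1(theta + x) = M_1(theta) cos x + M_2(theta) sin x
   for |x| <= rho, and by the law of large numbers M_1 < 0 away from K with
   probability tending to one.  So sqrt N b_N is asymptotically at distance 0 from
   the projection onto the sector of sqrt N M(theta), to which the central limit
   theorem applies.

   The central limit theorem is proved by the operator method: the averaging
   operators f |-> E f(. + Y) commute and contract the sup norm, so n-fold
   iterates with the same first two moments differ by n times a one-step error,
   which is o(1/n) on functions with a uniform second order Taylor expansion.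
   Products of such functions approximate indicators of open sets from below. *)
Require Import Defs.
From HB Require Import structures.
From mathcomp Require Import all_boot all_order all_algebra.
From mathcomp Require Import all_classical all_reals all_analysis.
From mathcomp Require Import measurable_realfun zify ring lra.
Import Order.TTheory GRing.Theory Num.Theory.
Import numFieldNormedType.Exports.
Set Implicit Arguments.
Unset Strict Implicit.
Unset Printing Implicit Defensive.
Local Open Scope classical_set_scope.
Local Open Scope ring_scope.

(** * Geometry of the kale *)

(** Everything rests on one inequality, [fcosB_le], that is, on the sign of the curvature at the
    origin: seen from a direction t, the first folded coordinate of a point lies below the sinusoid
    that it would follow in the plane. The notion [folded_pair] isolates this. It passes to sums and
    integrals, so the same lemmas serve a single point, the sample and [mu]. The barycenter is a
    chosen minimizer, known only through the quadratic growth of its potential; existence,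
    measurability and nearness to the sector are all read off that growth.

    Two uncountable families of angles stand in the way. Off K, the empirical moment must be
    negative at all angles at once, so the law of large numbers is used on a finite mesh and carried
    between mesh points by the inequality. On K, the equality case is established almost surely at
    the two endpoints only, and the inequality fills the interval. Since the covariance may be
    singular, the limit law is handled as the image of a standard normal vector under a matrix [A],
    one column at a time. *)

Section Angles.
Context {R : realType}.
Implicit Types (alpha x y : R).

Lemma angleP alpha x y :
  (angle alpha x = angle alpha y) <-> exists n : int, x - y = n%:~R * alpha.
Proof.
split=> [/eqP|H]; last apply/eqP.
  by rewrite -Quotient.idealrBE => /asboolP.
by rewrite -Quotient.idealrBE; apply/asboolP.
Qed.

Lemma angleB alpha x y : angle alpha (x - y) = angle alpha x - angle alpha y.
Proof. exact: (raddfB \pi_(Quotient.quot (multiples alpha))%qT). Qed.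

Lemma angle0 alpha : angle alpha 0 = 0.
Proof. by rewrite -[X in angle _ X](subrr 0) angleB subrr. Qed.

Lemma angleN alpha x : angle alpha (- x) = - angle alpha x.
Proof. by rewrite -sub0r angleB angle0 sub0r. Qed.

Lemma angleD alpha x y : angle alpha (x + y) = angle alpha x + angle alpha y.
Proof. by rewrite -{1}[y]opprK angleB angleN opprK. Qed.

Lemma angle_surj alpha (a : circle alpha) : exists x, a = angle alpha x.
Proof. by exists (generic_quotient.repr a); rewrite /angle generic_quotient.reprK. Qed.

Section CircleNorm.
Variable alpha : R.
Hypothesis halpha : 2 * pi < alpha.

Lemma alpha_gt0 : 0 < alpha.
Proof. by have p0 := @pi_gt0 R; have h := halpha; lra. Qed.

Lemma norm_intM_alpha (n : int) : n != 0 -> alpha <= `|n%:~R * alpha|.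
Proof.
move=> n0; have : 1 <= `|n|%:~R :> R by rewrite ler1z -gtz0_ge1 normr_gt0.
have a0 := alpha_gt0; rewrite intr_norm => hn1.
by rewrite normrM (gtr0_norm a0) ler_peMl// ltW.
Qed.

Lemma angle_rep_half (a : circle alpha) :
  exists2 x, `|x| <= alpha / 2 & a = angle alpha x.
Proof.
have a0 := alpha_gt0; have [x ->] := angle_surj a.
(* [n] is an integer nearest to [x / alpha], obtained by rounding. *)
pose n := Num.floor (x / alpha + 2^-1).
exists (x - n%:~R * alpha); last first.
  by apply/angleP; exists n; ring.
have := floor_itv (x / alpha + 2^-1).
rewrite -/n => /andP[h1 h2].
have e : x = x / alpha * alpha by rewrite divfK ?gt_eqF.
rewrite intrD in h2.
by rewrite ler_norml; move: (x / alpha) e h1 h2 => z -> h1 h2; nra.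
Qed.

Lemma angle_norm_le x : angle_norm (angle alpha x) <= `|x|.
Proof.
apply: ge_inf; last by exists x.
by exists 0 => _ [y _ <-].
Qed.

(** Any other representative differs from [x] by at least [alpha], so its absolute value is at least
    [alpha - alpha / 2]. *)
Lemma angle_norm_half x : `|x| <= alpha / 2 -> angle_norm (angle alpha x) = `|x|.
Proof.
move=> hx; apply/eqP; rewrite eq_le angle_norm_le /=.
apply: lb_le_inf; first by exists `|x|, x.
move=> _ [y /= /angleP[n hn] <-].
have a0 := alpha_gt0.
have -> : y = x + n%:~R * alpha by rewrite -hn; ring.
have [->|n0] := eqVneq n 0; first by rewrite mul0r addr0.
have h1 := norm_intM_alpha n0.
have := ler_normB (x + n%:~R * alpha) x.
rewrite [x + _]addrC addrK => ?; lra.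
Qed.

Lemma angle_norm_ge0 (a : circle alpha) : 0 <= angle_norm a.
Proof. by have [x hx ->] := angle_rep_half a; rewrite angle_norm_half. Qed.

Lemma angle_normN (a : circle alpha) : angle_norm (- a) = angle_norm a.
Proof.
by have [x hx ->] := angle_rep_half a; rewrite -angleN !angle_norm_half ?normrN.
Qed.

Lemma angle_normD (a b : circle alpha) :
  angle_norm (a + b) <= angle_norm a + angle_norm b.
Proof.
have [x hx ->] := angle_rep_half a; have [y hy ->] := angle_rep_half b.
rewrite -angleD (angle_norm_half hx) (angle_norm_half hy).
exact: le_trans (angle_norm_le _) (ler_normD _ _).
Qed.

Lemma angle_rep_pi x : `|x| <= pi -> angle_rep (angle alpha x) = x.
Proof.
move=> hx; rewrite /angle_rep.
have ap : pi < alpha / 2 by have h := halpha; lra.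
have : [set y | angle alpha y = angle alpha x /\ - pi <= y <= pi] x.
  by split => //; rewrite -ler_norml.
move/getI => /= [/esym/angleP[n hn]]; move: hn; set y := get _ => hn hy.
move: hx hy; rewrite ler_norml => /andP[x1 x2] /andP[y1 y2].
have [n0|n0] := eqVneq n 0; first by move: hn; rewrite n0 mul0r; lra.
have := norm_intM_alpha n0.
rewrite -hn => h; have h0 := halpha.
by have : `|x - y| < alpha by [rewrite ltr_norml; lra]; move=> ?; lra.
Qed.

(** Cartesian coordinates of a folded unit vector. Working with them hides the two branches of
    [fold_angle] and the ambiguity of the representative at angle pi. *)
Definition fcos (a : circle alpha) : R := cos (fold_angle a).
Definition fsin (a : circle alpha) : R := sin (fold_angle a).

Lemma fcos_far a : pi <= angle_norm a -> fcos a = -1.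
Proof.
move=> h; rewrite /fcos /fold_angle; case: ifPn => [h'|_]; last exact: cospi.
have [x hx e] := angle_rep_half a; move: h h'; rewrite e angle_norm_half// => h h'.
by rewrite angle_rep_pi// -cos_norm (_ : `|x| = pi) ?cospi//; lra.
Qed.

Lemma fsin_far a : pi <= angle_norm a -> fsin a = 0.
Proof.
move=> h; rewrite /fsin /fold_angle; case: ifPn => [h'|_]; last exact: sinpi.
have [x hx e] := angle_rep_half a; move: h h'; rewrite e angle_norm_half// => h h'.
rewrite angle_rep_pi//; apply: cos1sin0.
by rewrite -cos_norm (_ : `|x| = pi) ?cospi ?normrN1//; lra.
Qed.

Lemma fcos_angle x : `|x| <= pi -> fcos (angle alpha x) = cos x.
Proof.
move=> h; rewrite /fcos /fold_angle ifT ?angle_rep_pi//.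
exact: le_trans (angle_norm_le _) h.
Qed.

Lemma fsin_angle x : `|x| <= pi -> fsin (angle alpha x) = sin x.
Proof.
move=> h; rewrite /fsin /fold_angle ifT ?angle_rep_pi//.
exact: le_trans (angle_norm_le _) h.
Qed.

(** In this form [fcos] is a nonincreasing function of the circle norm, which is how its values are
    compared below. *)
Lemma fcosE a : fcos a = cos (Num.min (angle_norm a) pi).
Proof.
have [h|h] := leP pi (angle_norm a); first by rewrite fcos_far// cospi.
have [x hx e] := angle_rep_half a; rewrite e in h *.
by rewrite angle_norm_half// in h *; rewrite fcos_angle ?cos_norm// ltW.
Qed.

Lemma fold_cos2Dsin2 a : fcos a ^+ 2 + fsin a ^+ 2 = 1.
Proof. exact: cos2Dsin2. Qed.

Lemma fcos_le1 a : fcos a <= 1. Proof. exact: cos_le1. Qed.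
Lemma fcos_geN1 a : -1 <= fcos a. Proof. exact: cos_geN1. Qed.

Lemma fcosN a : fcos (- a) = fcos a.
Proof. by rewrite !fcosE angle_normN. Qed.

Lemma le_cos_pi x y : 0 <= x -> x <= y -> y <= pi -> cos y <= cos x.
Proof.
move=> x0 xy ypi; rewrite leNgt ltr_cos ?in_itv/= ?x0 ?ypi ?(le_trans xy)//.
  by rewrite -leNgt.
by rewrite (le_trans x0 xy).
Qed.

Lemma le_fcos a y : 0 <= y -> y <= angle_norm a -> y <= pi -> fcos a <= cos y.
Proof.
move=> y0 ya ypi; rewrite fcosE; apply: le_cos_pi => //.
  by rewrite le_min ya ypi.
by rewrite ge_min lexx orbT.
Qed.

(** The triangle inequality puts [a] at norm at least pi minus the norm of [b], where the cosine is
    at most [- fcos b]. *)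
Lemma fcosD_far a b : pi <= angle_norm (a - b) -> fcos a <= - fcos b.
Proof.
move=> h.
have [hb|hb] := leP pi (angle_norm b).
  by rewrite (fcos_far hb) opprK; exact: fcos_le1.
have t := angle_normD a (- b); rewrite angle_normN in t.
rewrite [fcos b]fcosE (min_l (ltW hb)).
rewrite -cosN -cosDpi [_ + pi]addrC. apply: le_fcos; have ? := angle_norm_ge0 b; lra.
Qed.

(** Here the excess angle acts: beyond pi the plane returns along the short way [2 * pi - |x|],
    while every representative on the longer circle has at least this absolute value. *)
Lemma fcos_le_cos x : `|x| <= 2 * pi -> fcos (angle alpha x) <= cos x.
Proof.
move=> hx; have [h|h] := leP `|x| pi; first by rewrite fcos_angle.
have -> : cos x = cos (pi *+ 2 - `|x|).
  by rewrite -[RHS]cosN opprB -[RHS]cosD2pi subrK cos_norm.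
have [y hy e] := angle_rep_half (angle alpha x).
rewrite mulr2n; apply: le_fcos; [lra| |lra].
rewrite e angle_norm_half//.
have /angleP[n hn] := e.
have [n0|n0] := eqVneq n 0.
  by move: hn; rewrite n0 mul0r => /eqP; rewrite subr_eq0 => /eqP <-; lra.
have := norm_intM_alpha n0.
rewrite -hn => ?; have h0 := halpha; have ? := ler_normB x y; lra.
Qed.

(* Equality in the law of cosines fails only on the side where the kale carries
   more angle than the plane, and there the folding shortens distances. *)
Lemma fcosB_le a b : fcos (a - b) <= fcos a * fcos b + fsin a * fsin b.
Proof.
have [hb|hb] := leP pi (angle_norm b).
  rewrite (fcos_far hb) (fsin_far hb) mulr0 addr0 mulrN1.
  rewrite -fcosN opprB -[fcos a]fcosN.
  have := @fcosD_far (b - a) (- a); rewrite opprK subrK; exact.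
have [ha|ha] := leP pi (angle_norm a).
  rewrite (fcos_far ha) (fsin_far ha) mul0r addr0 mulN1r.
  rewrite -[fcos b]fcosN; have := @fcosD_far (a - b) (- b); rewrite opprK subrK; exact.
have [x hx e] := angle_rep_half a; have [y hy e'] := angle_rep_half b.
rewrite e e' in ha hb *.
rewrite !angle_norm_half// in ha hb; rewrite -angleB.
rewrite (fcos_angle (ltW ha)) (fcos_angle (ltW hb)) (fsin_angle (ltW ha)) (fsin_angle (ltW hb)).
rewrite -cosB; apply: fcos_le_cos.
have ? := ler_normB x y; lra.
Qed.

End CircleNorm.
End Angles.

Section Plane.
Context {R : realType}.
Implicit Types (x y z : R * R).

Definition dotp x y : R := x.1 * y.1 + x.2 * y.2.
Definition enorm x : R := Num.sqrt (dotp x x).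

Lemma dotp_ge0 x : 0 <= dotp x x.
Proof. by rewrite addr_ge0// -expr2 sqr_ge0. Qed.

Lemma enorm_ge0 x : 0 <= enorm x. Proof. exact: sqrtr_ge0. Qed.

Lemma enorm_sqr x : enorm x ^+ 2 = dotp x x.
Proof. by rewrite sqr_sqrtr ?dotp_ge0. Qed.

Lemma dotp_le x y : dotp x y <= enorm x * enorm y.
Proof.
apply: le_trans (ler_norm _) _; rewrite -ler_sqr ?nnegrE ?mulr_ge0 ?enorm_ge0//.
rewrite exprMn !enorm_sqr real_normK ?num_real// /dotp.
(* By the Lagrange identity this square is the defect in the Cauchy-Schwarz inequality. *)
have := sqr_ge0 (x.1 * y.2 - x.2 * y.1); move=> *; nra.
Qed.

Lemma enormD x y : enorm (x + y) <= enorm x + enorm y.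
Proof.
rewrite -ler_sqr ?nnegrE ?addr_ge0 ?enorm_ge0//.
have := dotp_le x y; rewrite sqrrD !enorm_sqr /dotp /= mulr2n; move=> *; nra.
Qed.

Lemma plane_distE x y : plane_dist x y = enorm (x - y).
Proof. by rewrite /plane_dist /enorm /dotp !expr2. Qed.

End Plane.

(** * Metric of the kale and its foldings *)

Section KaleMetric.
Context {R : realType}.
Variable alpha : R.
Implicit Types (p q : kale alpha) (t : circle alpha).

Lemma kale_radius_ge0 p : 0 <= kale_radius p.
Proof. by case: p => [|r t] /=. Qed.

Lemma kale_point_gt0 (r : R) t (r0 : 0 < r) : kale_point r t = Point (PosNum r0) t.
Proof.
rewrite /kale_point; have -> : insub r = Some (PosNum r0) by exact: (valK (PosNum r0)).
by [].
Qed.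

Lemma kale_point0 t : kale_point 0 t = Origin.
Proof.
rewrite /kale_point; case: insubP => //= u _ u0.
have : 0 < u%:num by [].
by rewrite u0 ltxx.
Qed.

Lemma kale_radius_point (r : R) t : 0 <= r -> kale_radius (kale_point r t) = r.
Proof.
rewrite le_eqVlt => /predU1P[<-|r0]; first by rewrite kale_point0.
by rewrite (kale_point_gt0 _ r0).
Qed.

Lemma kale_angle_point (r : R) t : 0 < r -> kale_angle (kale_point r t) = t.
Proof. by move=> r0; rewrite (kale_point_gt0 _ r0). Qed.

Lemma kale_pointK p : kale_point (kale_radius p) (kale_angle p) = p.
Proof.
case: p => [|r t] /=; first exact: kale_point0.
by rewrite (kale_point_gt0 t (gt0 r)); congr Point; apply/val_inj.
Qed.

Lemma kale_radius0 p : kale_radius p = 0 -> p = Origin.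
Proof.
case: p => //= r t r0; have : 0 < r%:num by [].
by rewrite r0 ltxx.
Qed.

Hypothesis halpha : 2 * pi < alpha.

(** Since [fcos] is -1 on far angles, both branches of the metric become a single law of cosines. *)
Lemma kale_distE p q : kale_dist p q =
  Num.sqrt (kale_radius p ^+ 2 + kale_radius q ^+ 2
    - 2 * kale_radius p * kale_radius q * fcos (kale_angle q - kale_angle p)).
Proof.
rewrite /kale_dist; congr Num.sqrt; case: ifPn => h.
  by rewrite fcos_far//; ring.
by rewrite fcosE// min_l// ltW// ltNge.
Qed.

Lemma kale_dist_sqr p q : kale_dist p q ^+ 2 =
  kale_radius p ^+ 2 + kale_radius q ^+ 2
    - 2 * kale_radius p * kale_radius q * fcos (kale_angle q - kale_angle p).
Proof.
rewrite kale_distE sqr_sqrtr//.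
have := fcos_le1 (kale_angle q - kale_angle p).
have := kale_radius_ge0 p; have := kale_radius_ge0 q.
move: (kale_radius p) (kale_radius q) (fcos _) => r s c s0 r0 c1.
have := sqr_ge0 (r - s); have : 0 <= r * s * (1 - c) by rewrite !mulr_ge0 ?subr_ge0.
by move=> *; nra.
Qed.

Lemma kale_dist_ge0 p q : 0 <= kale_dist p q.
Proof. by rewrite /kale_dist sqrtr_ge0. Qed.

Lemma kale_distC p q : kale_dist p q = kale_dist q p.
Proof.
rewrite !kale_distE; congr Num.sqrt.
by rewrite -(fcosN halpha) opprB; ring.
Qed.

Lemma kale_dist0 q : kale_dist Origin q = kale_radius q.
Proof.
by rewrite kale_distE /= expr0n /= add0r mulr0 !mul0r subr0 sqrtr_sqr ger0_norm ?kale_radius_ge0.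
Qed.

Lemma folding1 t p : (folding t p).1 = kale_radius p * fcos (kale_angle p - t).
Proof. by []. Qed.

Lemma folding2 t p : (folding t p).2 = kale_radius p * fsin (kale_angle p - t).
Proof. by []. Qed.

Lemma dotp_folding t p : dotp (folding t p) (folding t p) = kale_radius p ^+ 2.
Proof.
rewrite /dotp folding1 folding2.
have := fold_cos2Dsin2 (kale_angle p - t); move: (fcos _) (fsin _) => c s e.
by rewrite -[RHS]mulr1 -e; ring.
Qed.

(** Foldings preserve radii, so the two laws of cosines differ only in their cosines, which
    [fcosB_le] compares. *)
Lemma folding_lip t p q :
  enorm (folding t p - folding t q) <= kale_dist p q.
Proof.
rewrite -ler_sqr ?nnegrE ?enorm_ge0 ?kale_dist_ge0// enorm_sqr kale_dist_sqr.
have := fcosB_le halpha (kale_angle q - t) (kale_angle p - t).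
have -> : kale_angle q - t - (kale_angle p - t) = kale_angle q - kale_angle p.
  by rewrite opprB addrA subrK.
have := dotp_folding t p; have := dotp_folding t q.
rewrite /dotp /= -/(folding t p).1 -/(folding t p).2.
have := kale_radius_ge0 p; have := kale_radius_ge0 q.
rewrite -!/(fcos _) -!/(fsin _).
move: (kale_radius p) (kale_radius q) => r s s0 r0.
move: (fcos _) (fcos _) (fcos _) (fsin _) (fsin _) => c1 c2 c3 s1 s2 h1 h2 h.
have : 0 <= r * s * (c3 * c2 + s2 * s1 - c1) by rewrite !mulr_ge0 ?subr_ge0.
by move=> *; nra.
Qed.

Lemma kale_dist_point (r : R) t q : 0 <= r ->
  kale_dist (kale_point r t) q ^+ 2 =
  r ^+ 2 + kale_radius q ^+ 2 - 2 * r * (folding t q).1.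
Proof.
rewrite le_eqVlt => /predU1P[<-|r0].
  by rewrite kale_point0 kale_dist0; ring.
by rewrite kale_dist_sqr kale_radius_point ?ltW// kale_angle_point// folding1; ring.
Qed.

Lemma folding_point (r : R) t t' : 0 <= r ->
  folding t (kale_point r t') = (r * fcos (t' - t), r * fsin (t' - t)).
Proof.
rewrite le_eqVlt => /predU1P[<-|r0].
  by rewrite kale_point0 /folding /= !mul0r.
by rewrite /folding kale_radius_point ?ltW// kale_angle_point.
Qed.

Lemma fcos0 : fcos (0 : circle alpha) = 1.
Proof. by rewrite -(angle0 alpha) fcos_angle ?cos0// normr0 pi_ge0. Qed.

Lemma fsin0 : fsin (0 : circle alpha) = 0.
Proof. by rewrite -(angle0 alpha) fsin_angle ?sin0// normr0 pi_ge0. Qed.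

(** Folding around the direction of [p] preserves distances to [p]. Combined with [folding_lip],
    this reduces the triangle inequality of the kale to that of the plane. *)
Lemma kale_dist_foldingE p q :
  kale_dist p q = enorm (folding (kale_angle p) p - folding (kale_angle p) q).
Proof.
apply/eqP; rewrite -(@eqrXn2 _ 2) ?enorm_ge0 ?kale_dist_ge0//.
rewrite enorm_sqr kale_dist_sqr; apply/eqP.
have := dotp_folding (kale_angle p) q.
rewrite /dotp /= -!/(fcos _) -!/(fsin _) subrr fcos0 fsin0.
by move: (fcos _) (fsin _) (kale_radius p) (kale_radius q) => c s r r' <-; ring.
Qed.

Lemma kale_dist_self (q : kale alpha) : kale_dist q q = 0.
Proof.
rewrite kale_distE// subrr fcos0// mulr1.
by rewrite (_ : _ - _ = 0) ?sqrtr0//; ring.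
Qed.

Lemma kale_dist_triangle p q r : kale_dist p r <= kale_dist p q + kale_dist q r.
Proof.
rewrite (kale_dist_foldingE p r) (kale_dist_foldingE p q).
set F := folding _.
have -> : F p - F r = (F p - F q) + (F q - F r) by rewrite addrA subrK.
apply: le_trans (enormD _ _) _.
by rewrite lerD2l folding_lip.
Qed.

Lemma open_kale_measurable (U : set (kale alpha)) : open U -> measurable U.
Proof. by move=> oU; apply: sub_sigma_algebra. Qed.

Lemma measurable_continuous (phi : kale alpha -> R) :
  continuous phi -> measurable_fun setT phi.
Proof.
move=> cphi mT; apply: (measurability _ (measurable_realfun.RGenOInfty.measurableE R)) => //.
move=> _ [_ [x ->] <-]; rewrite setTI; apply: open_kale_measurable.
apply: open_comp; first by move=> q _; exact: cphi.
by rewrite (_ : `]x, +oo[%classic = [set y | x < y]); [exact: open_gt|rewrite set_itvoy].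
Qed.

Lemma lipschitz_measurable (f : kale alpha -> R) (k : R) :
  (forall p q, `|f p - f q| <= k * kale_dist p q) -> measurable_fun setT f.
Proof.
move=> fk; move=> mD; apply: (measurability _ (measurable_realfun.RGenOInfty.measurableE R)) => //.
move=> _ [_ [x ->] <-]; rewrite setTI; apply: open_kale_measurable.
rewrite (_ : open _ = kale_open (f @^-1` `]x, +oo[%classic))//.
move=> p /=; rewrite in_itv/= andbT => xp.
have k1 : 0 < `|k| + 1 by rewrite ltr_wpDl.
exists ((f p - x) / (`|k| + 1)); first by rewrite divr_gt0// subr_gt0.
move=> q; rewrite ltr_pdivlMr// in_itv/= andbT => h.
have := fk p q; have := kale_dist_ge0 p q; have := ler_norm k.
have := ler_norm (f p - f q); move=> *; nra.
Qed.

Lemma enorm_ge1 (z : R * R) : `|z.1| <= enorm z.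
Proof.
rewrite -ler_sqr ?nnegrE ?enorm_ge0// enorm_sqr real_normK ?num_real// /dotp -!expr2.
by rewrite lerDl sqr_ge0.
Qed.

Lemma enorm_ge2 (z : R * R) : `|z.2| <= enorm z.
Proof.
rewrite -ler_sqr ?nnegrE ?enorm_ge0// enorm_sqr real_normK ?num_real// /dotp -!expr2.
by rewrite lerDr sqr_ge0.
Qed.

Lemma measurable_folding t : measurable_fun setT (folding t : kale alpha -> R * R).
Proof.
apply/measurable_fun_pairP; split; apply: (@lipschitz_measurable _ 1) => p q;
  rewrite mul1r; apply: le_trans (folding_lip t p q).
- exact: (enorm_ge1 (folding t p - folding t q)).
- exact: (enorm_ge2 (folding t p - folding t q)).
Qed.

Lemma measurable_kale_radius : measurable_fun setT (@kale_radius R alpha).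
Proof.
apply: (@lipschitz_measurable _ 1) => p q; rewrite mul1r -!kale_dist0 ler_norml.
have := kale_dist_triangle Origin p q; have := kale_dist_triangle Origin q p.
rewrite (kale_distC q p); move=> *; lra.
Qed.

End KaleMetric.

(** * Sums of random vectors *)

Lemma preimage_measurable d1 d2 (T1 : measurableType d1) (T2 : measurableType d2)
  (f : T1 -> T2) (U : set T2) : measurable_fun setT f -> measurable U -> measurable (f @^-1` U).
Proof. by move=> mf mU; rewrite -[X in measurable X]setTI; exact: mf. Qed.

(** * Averaging operators on bounded functions *)

Section BoundedExpectation.
Context {R : realType}.

(** This class is stable under shifts, averaging and partial integration, and all its members are
    integrable for every probability. *)
Definition bddmeas d (T : measurableType d) (f : T -> R) : Prop :=
  measurable_fun setT f /\ exists M, forall x, `|f x| <= M.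

Section Expectation.
Context d (T : measurableType d) (m : probability T R).
Implicit Types f g : T -> R.

Lemma bddmeas_integrable f : bddmeas f -> m.-integrable setT (EFin \o f).
Proof.
move=> [mf [M fM]]; apply: (@le_integrable _ _ _ m _ measurableT _ (EFin \o cst M)).
- exact/measurable_EFinP.
- by move=> x _ /=; rewrite lee_fin (le_trans (fM x))// ler_norm.
- exact: finite_measure_integrable_cst.
Qed.

Lemma bddmeasB f g : bddmeas f -> bddmeas g -> bddmeas (fun x => f x - g x).
Proof.
move=> [mf [M fM]] [mg [N gN]]; split; first exact: measurable_funB.
exists (M + N) => x; apply: le_trans (ler_normB _ _) _.
by rewrite lerD.
Qed.

Lemma prob_setT1 : fine (m setT) = 1.
Proof. by rewrite probability_setT. Qed.

Lemma Rintegral_cst1 (r : R) : \int[m]_x r = r.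
Proof. by rewrite Rintegral_cst// prob_setT1 mulr1. Qed.

Lemma Rintegral_bound f (s : R) : bddmeas f -> (forall x, `|f x| <= s) ->
  `|\int[m]_x f x| <= s.
Proof.
move=> bf fs; apply: le_trans (le_normr_Rintegral _ _) _ => //.
  exact: bddmeas_integrable.
rewrite -[leRHS]Rintegral_cst1; apply: le_Rintegral => //.
- apply: bddmeas_integrable; have [mf [M fM]] := bf; split; first exact: measurableT_comp.
  by exists M => x; rewrite normr_id.
- exact: finite_measure_integrable_cst.
Qed.

End Expectation.

Section Fubini.
Context d1 d2 (T1 : measurableType d1) (T2 : measurableType d2).
Variables (m1 : probability T1 R) (m2 : probability T2 R).
Variable h : T1 * T2 -> R.
Hypothesis bh : bddmeas h.

Lemma bddmeas_fst y : bddmeas (fun x => h (x, y)).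
Proof.
have [mh [M hM]] := bh; split; last by exists M => x.
exact: (measurableT_comp mh (measurable_pair2 y)).
Qed.

Lemma bddmeas_snd x : bddmeas (fun y => h (x, y)).
Proof.
have [mh [M hM]] := bh; split; last by exists M => y.
exact: (measurableT_comp mh (measurable_pair1 x)).
Qed.

Lemma bdd_fubini1 :
  \int[m1]_x \int[m2]_y h (x, y) = \int[(m1 \x m2)%E]_z h z.
Proof.
rewrite /Rintegral -(integral12_prod_meas1 (bddmeas_integrable _ bh)).
congr fine; apply: eq_integral => x _; rewrite fineK//.
exact: (integrable_fin_num _ (bddmeas_integrable m2 (bddmeas_snd x))).
Qed.

Lemma bdd_fubini2 :
  \int[m2]_y \int[m1]_x h (x, y) = \int[(m1 \x m2)%E]_z h z.
Proof.
rewrite /Rintegral -(integral21_prod_meas1 (bddmeas_integrable _ bh)).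
congr fine; apply: eq_integral => x _; rewrite fineK//.
exact: (integrable_fin_num _ (bddmeas_integrable m1 (bddmeas_fst x))).
Qed.

Lemma bdd_fubini :
  \int[m1]_x \int[m2]_y h (x, y) = \int[m2]_y \int[m1]_x h (x, y).
Proof. by rewrite bdd_fubini1 bdd_fubini2. Qed.

End Fubini.

Lemma bddmeas_Rintegral d1 d2 (T1 : measurableType d1) (T2 : measurableType d2)
  (m2 : probability T2 R) (h : T1 * T2 -> R) : bddmeas h ->
  bddmeas (fun x => \int[m2]_y h (x, y)).
Proof.
move=> bh; split; last first.
  have [_ [M hM]] := bh; exists M => x.
  by apply: Rintegral_bound => //; exact: bddmeas_snd.
(* Measurability of partial integrals is obtained from integrability on a product; the Dirac mass
   merely supplies a measure on the first factor. *)
have i := bddmeas_integrable (dirac point \x m2)%E bh.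
exact: measurableT_comp (fine_measurable measurableT) (measurable_fubini_F i).
Qed.

Section Avg.
Context d (T : measurableType d).

Definition avg (m : {measure set T -> \bar R}) (Y : T -> R * R) (f : R * R -> R) (x : R * R) : R :=
  \int[m]_t f (x + Y t).

Lemma bddmeas_shift (Y : T -> R * R) (f : R * R -> R) :
  measurable_fun setT Y -> bddmeas f ->
  bddmeas (fun z : (R * R) * T => f (z.1 + Y z.2)).
Proof.
move=> /measurable_fun_pairP[mY1 mY2] [mf [M fM]]; split; last by exists M.
apply: (measurableT_comp mf); apply/measurable_fun_pairP; split.
- apply: (@measurable_funD _ _ _ _ (fun z : (R * R) * T => z.1.1) (fun z => (Y z.2).1)).
    exact: measurableT_comp measurable_fst measurable_fst.
  exact: measurableT_comp mY1 measurable_snd.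
- apply: (@measurable_funD _ _ _ _ (fun z : (R * R) * T => z.1.2) (fun z => (Y z.2).2)).
    exact: measurableT_comp measurable_snd measurable_fst.
  exact: measurableT_comp mY2 measurable_snd.
Qed.

Variables (m : probability T R) (Y : T -> R * R).
Hypothesis mY : measurable_fun setT Y.

Lemma bddmeas_avg f : bddmeas f -> bddmeas (avg m Y f).
Proof. by move=> bf; exact: (bddmeas_Rintegral m (bddmeas_shift mY bf)). Qed.

Lemma bddmeas_avg_in f x : bddmeas f -> bddmeas (fun t => f (x + Y t)).
Proof. by move=> bf; exact: (bddmeas_snd (bddmeas_shift mY bf) x). Qed.

Lemma avgB f g x : bddmeas f -> bddmeas g ->
  avg m Y (fun x => f x - g x) x = avg m Y f x - avg m Y g x.
Proof.
move=> bf bg; rewrite /avg RintegralB//;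
  exact/bddmeas_integrable/bddmeas_avg_in.
Qed.

Lemma avg_contract f g s : bddmeas f -> bddmeas g ->
  (forall x, `|f x - g x| <= s) -> forall x, `|avg m Y f x - avg m Y g x| <= s.
Proof.
move=> bf bg fg x; rewrite -avgB//; apply: Rintegral_bound => //.
exact: (bddmeas_avg_in x (bddmeasB bf bg)).
Qed.

Lemma bddmeas_iter_avg n f : bddmeas f -> bddmeas (iter n (avg m Y) f).
Proof. by move=> bf; elim: n => //= n; exact: bddmeas_avg. Qed.

Lemma iter_avg_contract n f g s : bddmeas f -> bddmeas g ->
  (forall x, `|f x - g x| <= s) ->
  forall x, `|iter n (avg m Y) f x - iter n (avg m Y) g x| <= s.
Proof.
move=> bf bg fg; elim: n => //= n IH; apply: avg_contract => //;
  exact: bddmeas_iter_avg.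
Qed.

End Avg.

Section Trotter.
Context d1 d2 (T1 : measurableType d1) (T2 : measurableType d2).
Variables (m1 : probability T1 R) (m2 : probability T2 R).
Variables (Y1 : T1 -> R * R) (Y2 : T2 -> R * R).
Hypotheses (mY1 : measurable_fun setT Y1) (mY2 : measurable_fun setT Y2).

Lemma avgC f : bddmeas f -> avg m1 Y1 (avg m2 Y2 f) = avg m2 Y2 (avg m1 Y1 f).
Proof.
move=> bf; apply/funext => x; rewrite /avg.
pose h (z : T1 * T2) := f (x + Y1 z.1 + Y2 z.2).
have bh : bddmeas h.
  have [mf [M fM]] := bf; split; last by exists M => z; exact: fM.
  have -> : h = (fun z : (R * R) * T2 => f (z.1 + Y2 z.2)) \o
    (fun z : T1 * T2 => (x + Y1 z.1, z.2)) by [].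
  apply: measurableT_comp; first by have [] := bddmeas_shift mY2 bf.
  apply: measurable_fun_pair; last exact: measurable_snd.
  have [m11 m12] := (measurable_fun_pairP _).1 mY1.
  apply/measurable_fun_pairP; split.
    apply: (@measurable_funD _ _ _ _ (cst x.1) (fun z => (Y1 z.1).1)) => //.
    exact: measurableT_comp m11 measurable_fst.
  apply: (@measurable_funD _ _ _ _ (cst x.2) (fun z => (Y1 z.1).2)) => //.
  exact: measurableT_comp m12 measurable_fst.
have := bdd_fubini m1 m2 bh; rewrite /h /= => ->.
by apply: eq_Rintegral => y _; apply: eq_Rintegral => z _; rewrite addrAC.
Qed.

Lemma iter_avgC n f : bddmeas f ->
  avg m1 Y1 (iter n (avg m2 Y2) f) = iter n (avg m2 Y2) (avg m1 Y1 f).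
Proof.
move=> bf; elim: n => //= n IH; rewrite avgC ?IH//.
exact: bddmeas_iter_avg.
Qed.

(** With A and B the two operators, one step splits as A (A^n - B^n) + B^n (A - B). Commutation
    brings A - B next to [f], so the one-step error is needed for the test function alone and not
    for its iterates. *)
Lemma trotter n f s : bddmeas f ->
  (forall x, `|avg m1 Y1 f x - avg m2 Y2 f x| <= s) ->
  forall x, `|iter n (avg m1 Y1) f x - iter n (avg m2 Y2) f x| <= n%:R * s.
Proof.
move=> bf fs; elim: n => [|n IH] x; first by rewrite /= subrr normr0 mul0r.
have b1 := bddmeas_iter_avg m1 mY1 n bf.
have b2 := bddmeas_iter_avg m2 mY2 n bf.
have := avg_contract m1 mY1 b1 b2 IH x.
have := iter_avg_contract m2 mY2 n (bddmeas_avg m1 mY1 bf) (bddmeas_avg m2 mY2 bf) fs x.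
rewrite -iter_avgC// -iterSr [iter n.+1 _ _]/= => h1 h2.
apply: le_trans (ler_distD (avg m1 Y1 (iter n (avg m2 Y2) f) x) _ _) _.
by rewrite -natr1 mulrDl mul1r lerD.
Qed.

End Trotter.

End BoundedExpectation.

(** * Sums of independent variables *)

Section Independence.
Context {R : realType} d (Omega : measurableType d) (P : probability Omega R).

Lemma Rintegral_pushforward d1 (T1 : measurableType d1) (U : Omega -> T1)
  (mU : measurable_fun setT U) (f : T1 -> R) : bddmeas f ->
  fine (\int[pushforward P U]_x (f x)%:E)%E = \int[P]_w f (U w).
Proof.
move=> [mf [M fM]]; congr fine.
have := @integral_pushforward _ _ _ _ R _ mU P setT (EFin \o f).
move=> /(_ _ _ measurableT); rewrite preimage_setT; apply.
  exact/measurable_EFinP.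
by apply: bddmeas_integrable; split; [exact: measurableT_comp|exists M => w; exact: fM].
Qed.

Lemma indep_joint d1 d2 (T1 : measurableType d1) (T2 : measurableType d2)
  (U : Omega -> T1) (V : Omega -> T2) (m1 : probability T1 R) (m2 : probability T2 R)
  (h : T1 * T2 -> R) :
  measurable_fun setT U -> measurable_fun setT V ->
  (forall A B, measurable A -> measurable B ->
    P (U @^-1` A `&` V @^-1` B) = (m1 A * m2 B)%E) ->
  bddmeas h ->
  \int[P]_w h (U w, V w) = \int[m1]_x \int[m2]_y h (x, y).
Proof.
move=> mU mV UV bh; have mUV := measurable_fun_pair mU mV.
rewrite (bdd_fubini1 m1 m2 bh).
rewrite -(Rintegral_pushforward mUV bh); congr fine; apply: eq_measure_integral => A mA _.
pose i := isMeasurableFun.Build _ _ _ _ _ mUV.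
pose UVm : {mfun Omega >-> _} := HB.pack (fun w => (U w, V w)) i.
exact/esym/(product_measure_unique (m' := distribution P UVm)).
Qed.

Variables (d' : measure_display) (T : measurableType d') (X : nat -> Omega -> T).
Hypotheses (mX : forall n, measurable_fun setT (X n)) (indX : mutually_independent P X).

(** Dynkin's argument: for fixed [B], the events independent of [X n] landing in [B] form a
    lambda-system, and it contains the rectangles in the first n variables, which are stable under
    intersection. *)
Lemma indep_past n (A : set Omega) (B : set T) : measurable B ->
  <<s [set \bigcap_(i in [set` iota 0 n]) (X i @^-1` U i) |
        U in [set U | forall i, measurable (U i)] ] >> A ->
  measurable A /\ P (A `&` X n @^-1` B) = (P A * P (X n @^-1` B))%E.
Proof.
move=> mB; set G := [set _ | _ in _].
have mXB : measurable (X n @^-1` B) by exact: preimage_measurable.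
pose H := [set A | measurable A /\
  P (A `&` X n @^-1` B) = (P A * P (X n @^-1` B))%E].
suff : <<s G >> `<=` H by move=> /[apply].
apply: lambda_system_subset => //.
- move=> _ _ [U mU <-] [V mV <-]; exists (fun i => U i `&` V i).
    by move=> i; apply: measurableI.
  by rewrite -bigcapI; apply: eq_bigcapr => i _; rewrite preimage_setI.
- apply/dynkin_lambda_system; split.
  + by split => //; rewrite setTI probability_setT mul1e.
  + move=> C [mC PC]; split; first exact: measurableC.
    have := PC; rewrite probability_setC// => {}PC.
    have fP D : measurable D -> P D \is a fin_num by move=> ?; exact: fin_num_measure.
    rewrite muleBl ?fP// mul1e -PC.
    rewrite setIC -setDE measureD//; last by rewrite ltey_eq fP.
    by rewrite setIC.
  + move=> F tF HF; have mF k : measurable (F k) by have [] := HF k.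
    split; first exact: bigcupT_measurable.
    rewrite setI_bigcupl measure_bigcup//; last 2 first.
      by move=> k _; exact: measurableI.
      apply/trivIsetP => i j _ _ ij; rewrite setIACA.
      by move/trivIsetP : tF => ->//; rewrite set0I.
    rewrite measure_bigcup//.
    rewrite muleC -[P (X n @^-1` B)]fineK ?fin_num_measure//.
    rewrite -nneseriesZl//; apply: eq_eseriesr => k _.
    by have [_ e] := HF k; rewrite muleC fineK ?fin_num_measure//; exact: e.
- move=> _ [U mU <-]; have mXU i : measurable (X i @^-1` U i) by exact: preimage_measurable.
  have e (W : nat -> set T) (s : seq nat) :
    \bigcap_(i in [set` s]) X i @^-1` W i = \big[setI/setT]_(i <- s) X i @^-1` W i.
    by rewrite bigcap_seq.
  split; first by rewrite e; apply: big_ind => //; exact: measurableI.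
  (* Completing the rectangle at index n by [B] lets mutual independence be used for the first n and
     the first n + 1 indices. *)
  pose W i := if i == n then B else U i.
  have mW i : measurable (W i) by rewrite /W; case: ifP.
  have := indX (iota_uniq 0 n) mU; have := indX (iota_uniq 0 n.+1) mW.
  have -> : iota 0 n.+1 = rcons (iota 0 n) n by rewrite -addn1 iotaD cats1.
  have WU i : i \in iota 0 n -> W i = U i.
    by rewrite mem_iota /W add0n => /andP[_]; case: eqP => // ->; rewrite ltnn.
  have Wn : W n = B by rewrite /W eqxx.
  rewrite -cats1 big_cat big_seq1 /= Wn => h ->.
  transitivity (P (\bigcap_(i in [set` iota 0 n ++ [:: n]]) X i @^-1` W i)).
    congr (P _); rewrite !e big_cat big_seq1 /= Wn; congr (_ `&` _).
    by rewrite big_seq [RHS]big_seq; apply: eq_bigr => i /WU ->.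
  rewrite h; congr (_ * _)%E.
  by rewrite big_seq [RHS]big_seq; apply: eq_bigr => i /WU ->.
Qed.

Variables (mu : probability T R) (Y : T -> R * R).
Hypotheses (lawX : forall n A, measurable A -> P (X n @^-1` A) = mu A).
Hypotheses (mY : measurable_fun setT Y).

(** The source space is arbitrary, because this is also used on [Omega] with the sigma-algebra
    generated by the first n variables. *)
Lemma measurable_sum_plane d1 (T1 : measurableType d1) n (Z : nat -> T1 -> R * R) :
  (forall i, (i < n)%N -> measurable_fun setT (Z i)) ->
  measurable_fun setT (fun w => \sum_(i < n) Z i w).
Proof.
elim: n => [|n IH] mZ.
  rewrite (_ : (fun w => _) = cst 0); first exact: measurable_cst.
  by apply/funext => w; rewrite big_ord0.
under eq_fun do rewrite big_ord_recr/=.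
have /measurable_fun_pairP[a1 a2] := IH (fun i h => mZ i (ltnW h)).
have /measurable_fun_pairP[b1 b2] := mZ n (ltnSn n).
by apply/measurable_fun_pairP; split; apply: measurable_funD.
Qed.

Lemma avg_iid_sum n f : bddmeas f ->
  avg P (fun w => \sum_(i < n) Y (X i w)) f = iter n (avg mu Y) f.
Proof.
elim: n f => [|n IH] f bf.
  apply/funext => x; rewrite /avg/=.
  under eq_Rintegral do rewrite big_ord0 addr0.
  exact: Rintegral_cst1.
rewrite iterSr -IH; last exact: bddmeas_avg.
apply/funext => x; rewrite /avg.
under eq_Rintegral do rewrite big_ord_recr/= addrA.
pose S (w : Omega) : R * R := \sum_(i < n) Y (X i w).
have mS : measurable_fun setT S.
  apply: (@measurable_sum_plane _ _ n (fun i w => Y (X i w))) => i _.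
  exact: measurableT_comp.
pose i1 := isMeasurableFun.Build _ _ _ _ _ mS.
pose Sm : {mfun Omega >-> _} := HB.pack S i1.
pose h (z : (R * R) * T) := f (x + z.1 + Y z.2).
have bh : bddmeas h.
  have [mf [M fM]] := bf; split; last by exists M => z; exact: fM.
  have -> : h = (fun z : (R * R) * T => f (z.1 + Y z.2)) \o
    (fun z => (x + z.1, z.2)) by [].
  apply: measurableT_comp; first by have [] := bddmeas_shift mY bf.
  apply: measurable_fun_pair; last exact: measurable_snd.
  apply/measurable_fun_pairP; split.
    apply: (@measurable_funD _ _ _ _ (cst x.1) (fun z => z.1.1)) => //.
    exact: measurableT_comp measurable_fst measurable_fst.
  apply: (@measurable_funD _ _ _ _ (cst x.2) (fun z => z.1.2)) => //.
  exact: measurableT_comp measurable_snd measurable_fst.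
have := @indep_joint _ _ _ _ S (X n) (distribution P Sm) mu h mS (mX n).
move=> /(_ _ bh); rewrite /h /S /= => ->.
  exact: (Rintegral_pushforward mS (bddmeas_Rintegral mu bh)).
move=> A B mA mB; rewrite -(lawX n mB).
(* The partial sum depends only on the past: it is measurable once [Omega] carries the sigma-algebra
   of the first n variables, each of which is measurable for it. *)
suff sG : <<s [set \bigcap_(i in [set` iota 0 n]) (X i @^-1` U i) |
        U in [set U | forall i, measurable (U i)] ] >> (S @^-1` A).
  exact: (indep_past mB sG).2.
set G := [set _ | _ in _].
have mX' i : (i < n)%N -> measurable_fun setT (X i : g_sigma_algebraType G -> T).
  move=> i_n _ U mU; rewrite setTI; apply: sub_sigma_algebra.
  exists (fun j => if j == i then U else setT) => [j|]; first by case: ifP.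
  rewrite bigcap_seq (bigD1_seq i) ?iota_uniq ?mem_iota//= eqxx big1 ?setIT//.
  by move=> j /negPf ->; rewrite preimage_setT.
have := @measurable_sum_plane _ (g_sigma_algebraType G) n (fun i w => Y (X i w)).
move=> /(_ (fun i i_n => measurableT_comp mY (mX' i i_n))) /(_ measurableT A mA).
by rewrite setTI.
Qed.
End Independence.

(** * Functions with a uniform second order expansion *)

Section TestFunctions.
Context {R : realType}.
Implicit Types (x y z : R * R) (f : R * R -> R).

Definition norm1 y : R := `|y.1| + `|y.2|.

Definition quad (a d1 d2 h11 h12 h22 : R) y : R :=
  a + d1 * y.1 + d2 * y.2 + h11 * y.1 ^+ 2 + h12 * y.1 * y.2 + h22 * y.2 ^+ 2.

(** No derivatives are mentioned: some quadratic polynomial, with coefficients bounded by [C],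
    approximates [f] near [x] to third order. This is easily seen to be stable under products, and
    is what the one-step comparison uses. *)
Definition taylor_at f (C : R) x : Prop := exists d1 d2 h11 h12 h22 : R,
  [/\ `|d1| <= C /\ `|d2| <= C, [/\ `|h11| <= C, `|h12| <= C & `|h22| <= C] &
   forall y, norm1 y <= 1 ->
     `|f (x + y) - quad (f x) d1 d2 h11 h12 h22 y| <= C * norm1 y ^+ 3].

Definition taylor_fun f : Prop :=
  measurable_fun setT f /\
  exists C : R, [/\ 0 <= C, forall x, `|f x| <= C & forall x, taylor_at f C x].

Lemma taylor_bddmeas f : taylor_fun f -> bddmeas f.
Proof. by move=> [mf [C [_ fC _]]]; split => //; exists C. Qed.

Lemma norm1_ge0 y : 0 <= norm1 y.
Proof. by rewrite addr_ge0. Qed.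

Lemma enorm_le_norm1 (z : R * R) : enorm z <= norm1 z.
Proof.
rewrite -ler_sqr ?nnegrE ?enorm_ge0 ?norm1_ge0// enorm_sqr.
rewrite /dotp /norm1 -!expr2 sqrrD !real_normK ?num_real//.
by rewrite lerD2r lerDl mulrn_wge0// mulr_ge0.
Qed.

Lemma quad1_bound (C d1 d2 : R) y : `|d1| <= C -> `|d2| <= C ->
  `|d1 * y.1 + d2 * y.2| <= C * norm1 y.
Proof.
move=> h1 h2; apply: le_trans (ler_normD _ _) _.
by rewrite !normrM mulrDr lerD// ler_wpM2r.
Qed.

Lemma quad2_bound (C h11 h12 h22 : R) y : 0 <= C ->
  `|h11| <= C -> `|h12| <= C -> `|h22| <= C ->
  `|h11 * y.1 ^+ 2 + h12 * y.1 * y.2 + h22 * y.2 ^+ 2| <= C * norm1 y ^+ 2.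
Proof.
move=> C0 h1 h2 h3; apply: le_trans (ler_normD _ _) _.
apply: le_trans (lerD (ler_normD _ _) (lexx _)) _.
rewrite !normrM /norm1.
have [a0 b0] : 0 <= `|y.1| /\ 0 <= `|y.2| by [].
move: `|y.1| `|y.2| `|h11| `|h12| `|h22| a0 b0 h1 h2 h3 => a b h k l a0 b0 h1 h2 h3.
have e1 : h * a ^+ 2 <= C * a ^+ 2 by rewrite ler_wpM2r ?sqr_ge0.
have e3 : l * b ^+ 2 <= C * b ^+ 2 by rewrite ler_wpM2r ?sqr_ge0.
have e2 : k * a * b <= C * (a * b) by rewrite -mulrA ler_wpM2r ?mulr_ge0.
have e4 : 0 <= C * (a * b) by rewrite !mulr_ge0.
by rewrite sqrrD mulr2n !mulrDr; lra.
Qed.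

Lemma taylor_cst (r : R) : taylor_fun (cst r).
Proof.
split; first exact: measurable_cst.
exists `|r|; split=> // x; exists 0, 0, 0, 0, 0; split; rewrite ?normr0 //.
move=> y _; rewrite /quad !mul0r !addr0 subrr normr0 mulr_ge0// exprn_ge0//.
exact: norm1_ge0.
Qed.

Lemma taylorM f g : taylor_fun f -> taylor_fun g -> taylor_fun (fun x => f x * g x).
Proof.
move=> [mf [C [C0 fC tf]]] [mg [D [D0 gD tg]]]; split; first exact: measurable_funM.
have CD0 : 0 <= C * D by rewrite mulr_ge0.
(* The remainder of the product is a sum of five terms: [L * S], [Q * M], [Q * S] and [r1 * g] cost
   one unit [C * D * norm1 y ^+ 3] each, and the term with [r2] costs three. *)
exists (7 * (C * D)); split; first by rewrite mulr_ge0.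
  move=> x; rewrite normrM; apply: (@le_trans _ _ (C * D)); first by rewrite ler_pM.
  by rewrite ler_peMl//; lra.
move=> x; have [d1 [d2 [h11 [h12 [h22 [[d1C d2C] [h1C h2C h3C] R1]]]]]] := tf x.
have [e1 [e2 [k11 [k12 [k22 [[e1D e2D] [k1D k2D k3D] R2]]]]]] := tg x.
have pb (s t : R) : `|s| <= C -> `|t| <= D -> `|s * t| <= C * D.
  by move=> *; rewrite normrM ler_pM.
have [aC bD] := (fC x, gD x).
exists (f x * e1 + d1 * g x), (f x * e2 + d2 * g x).
exists (f x * k11 + d1 * e1 + h11 * g x).
exists (f x * k12 + d1 * e2 + d2 * e1 + h12 * g x).
exists (f x * k22 + d2 * e2 + h22 * g x).
split.
- have := pb _ _ aC e1D; have := pb _ _ aC e2D.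
  have := pb _ _ d1C bD; have := pb _ _ d2C bD.
  rewrite !ler_norml; lra.
- have := pb _ _ aC k1D; have := pb _ _ aC k2D; have := pb _ _ aC k3D.
  have := pb _ _ h1C bD; have := pb _ _ h2C bD; have := pb _ _ h3C bD.
  have := pb _ _ d1C e1D; have := pb _ _ d1C e2D; have := pb _ _ d2C e1D.
  have := pb _ _ d2C e2D.
  rewrite !ler_norml => *; split; lra.
move=> y y1.
have n0 := norm1_ge0 y.
pose L := d1 * y.1 + d2 * y.2; pose M := e1 * y.1 + e2 * y.2.
pose Q := h11 * y.1 ^+ 2 + h12 * y.1 * y.2 + h22 * y.2 ^+ 2.
pose S := k11 * y.1 ^+ 2 + k12 * y.1 * y.2 + k22 * y.2 ^+ 2.
have Lb : `|L| <= C * norm1 y by exact: quad1_bound.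
have Mb : `|M| <= D * norm1 y by exact: quad1_bound.
have Qb : `|Q| <= C * norm1 y ^+ 2 by exact: quad2_bound.
have Sb : `|S| <= D * norm1 y ^+ 2 by exact: quad2_bound.
have qf : quad (f x) d1 d2 h11 h12 h22 y = f x + L + Q by rewrite /quad /L /Q; ring.
have qg : quad (g x) e1 e2 k11 k12 k22 y = g x + M + S by rewrite /quad /M /S; ring.
have := R1 y y1; have := R2 y y1; rewrite qf qg.
set r2 := _ - _ => Rb2; set r1 := _ - _ => Rb1.
have -> : f (x + y) * g (x + y) - quad (f x * g x) (f x * e1 + d1 * g x) (f x * e2 + d2 * g x)
  (f x * k11 + d1 * e1 + h11 * g x) (f x * k12 + d1 * e2 + d2 * e1 + h12 * g x)
  (f x * k22 + d2 * e2 + h22 * g x) y =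
  L * S + Q * M + Q * S + r1 * g (x + y) + (f x + L + Q) * r2.
  by rewrite /quad /r1 /r2 /L /Q /M /S; ring.
have P3 : norm1 y ^+ 2 <= norm1 y by rewrite expr2 ler_piMr.
have P4 : norm1 y ^+ 4 <= norm1 y ^+ 3 by rewrite ler_wiXn2l.
have n30 : 0 <= norm1 y ^+ 3 by rewrite exprn_ge0.
have b1 : `|L * S| <= C * D * norm1 y ^+ 3.
  by rewrite normrM; apply: le_trans (ler_pM _ _ Lb Sb) _ => //; rewrite mulrACA -exprS.
have b2 : `|Q * M| <= C * D * norm1 y ^+ 3.
  by rewrite normrM; apply: le_trans (ler_pM _ _ Qb Mb) _ => //; rewrite mulrACA -exprSr.
have b3 : `|Q * S| <= C * D * norm1 y ^+ 3.
  rewrite normrM; apply: le_trans (ler_pM _ _ Qb Sb) _ => //; rewrite mulrACA -exprD.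
  by rewrite ler_wpM2l.
have b4 : `|r1 * g (x + y)| <= C * D * norm1 y ^+ 3.
  by rewrite normrM mulrAC ler_pM.
have b5 : `|(f x + L + Q) * r2| <= 3 * (C * D * norm1 y ^+ 3).
  rewrite normrM; have -> : 3 * (C * D * norm1 y ^+ 3) = 3 * C * (D * norm1 y ^+ 3) by ring.
  apply: ler_pM => //; apply: le_trans (ler_normD _ _) _.
  have := ler_normD (f x) L.
  have : C * norm1 y <= C by rewrite ler_piMr.
  have : C * norm1 y ^+ 2 <= C by rewrite ler_piMr// (le_trans P3).
  move=> *; lra.
apply: le_trans (ler_normD _ _) _; rewrite -mulrA.
have := ler_normD (L * S + Q * M + Q * S) (r1 * g (x + y)).
have := ler_normD (L * S + Q * M) (Q * S); have := ler_normD (L * S) (Q * M).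
move: (C * D * norm1 y ^+ 3) b1 b2 b3 b4 b5 => c *; lra.
Qed.

Lemma taylor_prod (I : Type) (s : seq I) (F : I -> R * R -> R) :
  (forall i, taylor_fun (F i)) -> taylor_fun (fun x => \prod_(i <- s) F i x).
Proof.
move=> tF; elim: s => [|i s IH].
  rewrite (_ : (fun x => _) = cst 1); first exact: taylor_cst.
  by apply/funext => x; rewrite big_nil.
rewrite (_ : (fun x => _) = fun x => F i x * \prod_(j <- s) F j x); first exact: taylorM.
by apply/funext => x; rewrite big_cons.
Qed.

Lemma taylorX f n : taylor_fun f -> taylor_fun (fun x => f x ^+ n).
Proof.
move=> tf; elim: n => [|n IH].
  by rewrite (_ : (fun x => _) = cst 1); [exact: taylor_cst|apply/funext => x; rewrite expr0].
rewrite (_ : (fun x => _) = fun x => f x * f x ^+ n); first exact: taylorM.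
by apply/funext => x; rewrite exprS.
Qed.

Lemma taylor_1B f : taylor_fun f -> taylor_fun (fun x => 1 - f x).
Proof.
move=> [mf [C [C0 fC tf]]]; split; first exact: measurable_funB.
exists (C + 1); split; first by rewrite addr_ge0.
  by move=> x; apply: le_trans (ler_normB _ _) _; rewrite normr1 addrC lerD2r.
move=> x; have [d1 [d2 [h11 [h12 [h22 [[d1C d2C] [h1C h2C h3C] R1]]]]]] := tf x.
exists (- d1), (- d2), (- h11), (- h12), (- h22); split.
- by rewrite !normrN; split; lra.
- by rewrite !normrN; split; lra.
- move=> y y1; rewrite distrC.
  have -> : quad (1 - f x) (- d1) (- d2) (- h11) (- h12) (- h22) y - (1 - f (x + y)) =
    f (x + y) - quad (f x) d1 d2 h11 h12 h22 y by rewrite /quad; ring.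
  apply: le_trans (R1 y y1) _; rewrite ler_wpM2r ?exprn_ge0 ?norm1_ge0//; lra.
Qed.

Definition cube_pos (t : R) : R := Num.max t 0 ^+ 3.

(** The third derivative of the positive cube is 0 or 6 away from the origin, and 6 / 3! = 1 is the
    constant. *)
Lemma cube_pos_taylor t s :
  `|cube_pos (t + s) - (cube_pos t + 3 * Num.max t 0 ^+ 2 * s + 3 * Num.max t 0 * s ^+ 2)|
    <= `|s| ^+ 3.
Proof.
rewrite /cube_pos -normrX.
have [t0|t0] := leP 0 t; have [s0|s0] := leP 0 (t + s).
- rewrite le_eqVlt; apply/orP; left; apply/eqP; congr `|_|; ring.
- rewrite expr0n /= sub0r normrN [leRHS]ler0_norm; last by rewrite exprn_odd_le0//; lra.
  have h1 : 0 <= (- (t + s)) ^+ 3 by rewrite exprn_ge0//; lra.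
  have h2 : (- (t + s)) ^+ 3 <= (- s) ^+ 3 by apply: lerXn2r; rewrite ?nnegrE; lra.
  rewrite ler_norml; move: h1 h2; rewrite !expr2 !exprS !expr0; lra.
- rewrite !expr0n /= !mulr0 !mul0r !addr0 subr0 !ger0_norm ?exprn_ge0//; last lra.
  by apply: lerXn2r; rewrite ?nnegrE; lra.
- by rewrite !expr0n /= !mulr0 !mul0r !addr0 subr0 normr0.
Qed.

(* Up to a factor, the primitive of the quadratic B-spline on [0, 3]: it vanishes
   exactly on the nonpositive reals. *)
Definition step_fun (t : R) : R :=
  (cube_pos t - 3 * cube_pos (t - 1) + 3 * cube_pos (t - 2) - cube_pos (t - 3)) / 8.

Lemma step_fun_le0 t : t <= 0 -> step_fun t = 0.
Proof.
by move=> t0; rewrite /step_fun /cube_pos !max_r; [rewrite expr0n /=; ring|lra..].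
Qed.

Lemma step_fun_bound t : 0 <= step_fun t <= 1 /\ (0 < t -> 0 < step_fun t).
Proof.
have [t0|t0] := leP t 0; first by rewrite step_fun_le0//; split=> //; rewrite lexx ler01.
rewrite /step_fun /cube_pos.
have -> : Num.max t 0 = t by rewrite max_l// ltW.
have [t1|t1] := leP t 1.
  rewrite !(@max_r _ _ _ 0); [|lra..].
  have -> : (t ^+ 3 - 3 * 0 ^+ 3 + 3 * 0 ^+ 3 - 0 ^+ 3) / 8 = t ^+ 3 / 8 by rewrite expr0n /=; ring.
  have : 0 < t ^+ 3 by rewrite exprn_gt0.
  have : t ^+ 3 <= 1 by rewrite exprn_ile1// ltW.
  by move=> *; split; [apply/andP; split|]; lra.
have -> : Num.max (t - 1) 0 = t - 1 by rewrite max_l//; lra.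
have [t2|t2] := leP t 2.
  rewrite !(@max_r _ _ _ 0); [|lra..].
  rewrite expr0n /=.
  have h1 : 0 <= (t - 1) ^+ 3 by rewrite exprn_ge0//; lra.
  have h2 : (t - 1) ^+ 3 <= (t - 1) ^+ 2 by rewrite ler_wiXn2l//; lra.
  have h3 : t ^+ 3 <= 2 ^+ 3 by apply: lerXn2r; rewrite ?nnegrE; lra.
  have h4 : t ^+ 2 <= t ^+ 3 by rewrite ler_weXn2l// ltW.
  have h5 : 3 * (t - 1) ^+ 2 < t ^+ 2 by rewrite !expr2; nra.
  have h6 : (2 ^+ 3 : R) = 8 by ring.
  by split; [apply/andP; split|]; lra.
have -> : Num.max (t - 2) 0 = t - 2 by rewrite max_l//; lra.
have [t3|t3] := leP t 3.
  rewrite !(@max_r _ _ _ 0); [|lra..].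
  have -> : (t ^+ 3 - 3 * (t - 1) ^+ 3 + 3 * (t - 2) ^+ 3 - 0 ^+ 3) = 6 - (3 - t) ^+ 3.
    by rewrite expr0n /=; ring.
  have h1 : 0 <= (3 - t) ^+ 3 by rewrite exprn_ge0//; lra.
  have h2 : (3 - t) ^+ 3 <= 1 by rewrite exprn_ile1//; lra.
  by split; [apply/andP; split|]; lra.
have -> : Num.max (t - 3) 0 = t - 3 by rewrite max_l//; lra.
have -> : (t ^+ 3 - 3 * (t - 1) ^+ 3 + 3 * (t - 2) ^+ 3 - (t - 3) ^+ 3) = 6 by ring.
by split; [apply/andP; split|]; lra.
Qed.

(** The weights 1, 3, 3, 1 have sum 8, the divisor in [step_fun], so the cubic remainders average to
    constant 1. For t at most 3 the truncated arguments lie in [0, 3], whence the bounds 3 * 9 and 3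
    * 3; beyond 3 both coefficients are third differences of polynomials of degree at most two and
    vanish. *)
Lemma step_fun_taylor t : exists d h : R, [/\ `|d| <= 27, `|h| <= 9 &
  forall s, `|step_fun (t + s) - (step_fun t + d * s + h * s ^+ 2)| <= `|s| ^+ 3].
Proof.
pose m u := Num.max u (0 : R).
exists (3 * (m t ^+ 2 - 3 * m (t - 1) ^+ 2 + 3 * m (t - 2) ^+ 2 - m (t - 3) ^+ 2) / 8).
exists (3 * (m t - 3 * m (t - 1) + 3 * m (t - 2) - m (t - 3)) / 8).
have mb (u : R) : t <= 3 -> u <= t -> 0 <= m u <= 3.
  by move=> t3 ut; rewrite /m le_max lexx orbT ge_max; apply/andP; split; lra.
have sb (u : R) : 0 <= u <= 3 -> 0 <= u ^+ 2 <= 9.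
  by move=> /andP[u0 u3]; rewrite sqr_ge0 expr2; nra.
split.
- have [t3|t3] := leP t 3.
    have /sb/andP[a1 a2] := mb t t3 (lexx t).
    have /sb/andP[b1 b2] : 0 <= m (t - 1) <= 3 by apply: mb => //; lra.
    have /sb/andP[c1 c2] : 0 <= m (t - 2) <= 3 by apply: mb => //; lra.
    have /sb/andP[d1 d2] : 0 <= m (t - 3) <= 3 by apply: mb => //; lra.
    by rewrite ler_norml; apply/andP; split; lra.
  rewrite /m !max_l; [|lra..].
  have -> : 3 * (t ^+ 2 - 3 * (t - 1) ^+ 2 + 3 * (t - 2) ^+ 2 - (t - 3) ^+ 2) / 8 = 0 by ring.
  by rewrite normr0.
- have [t3|t3] := leP t 3.
    have /andP[a1 a2] := mb t t3 (lexx t).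
    have /andP[b1 b2] : 0 <= m (t - 1) <= 3 by apply: mb => //; lra.
    have /andP[c1 c2] : 0 <= m (t - 2) <= 3 by apply: mb => //; lra.
    have /andP[d1 d2] : 0 <= m (t - 3) <= 3 by apply: mb => //; lra.
    by rewrite ler_norml; apply/andP; split; lra.
  rewrite /m !max_l; [|lra..].
  have -> : 3 * (t - 3 * (t - 1) + 3 * (t - 2) - (t - 3)) / 8 = 0 by ring.
  by rewrite normr0.
move=> s.
have := cube_pos_taylor t s; have := cube_pos_taylor (t - 1) s.
have := cube_pos_taylor (t - 2) s; have := cube_pos_taylor (t - 3) s.
rewrite -!/(m _) /step_fun.
have -> : t + s - 1 = t - 1 + s by ring.
have -> : t + s - 2 = t - 2 + s by ring.
have -> : t + s - 3 = t - 3 + s by ring.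
rewrite !ler_norml => /andP[a1 a2] /andP[b1 b2] /andP[c1 c2] /andP[d1 d2].
by apply/andP; split; lra.
Qed.

Lemma measurable_step_fun : measurable_fun setT step_fun.
Proof.
have mc (c : R) : measurable_fun setT (fun t : R => cube_pos (t - c)).
  apply: measurable_funX; apply: measurable_maxr => //.
  exact: measurable_funB.
apply: measurable_funM => //; apply: measurable_funB => //; apply: measurable_funD.
  apply: measurable_funB; last exact: measurable_funM.
  by apply: measurable_funX; exact: measurable_maxr.
exact: measurable_funM.
Qed.

Lemma taylor_step (l1 l2 c : R) : `|l1| <= 1 -> `|l2| <= 1 ->
  taylor_fun (fun x => step_fun (l1 * x.1 + l2 * x.2 + c)).
Proof.
move=> L1 L2; split.
  apply: (measurableT_comp measurable_step_fun).
  by apply: measurable_funD => //; apply: measurable_funD; apply: measurable_funM.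
exists 27; split => // x.
  have [/andP[h1 h2] _] := step_fun_bound (l1 * x.1 + l2 * x.2 + c).
  by rewrite ger0_norm//; lra.
have [d [h [dC hC ds]]] := step_fun_taylor (l1 * x.1 + l2 * x.2 + c).
have sm (u v : R) : `|v| <= 1 -> `|u * v| <= `|u|.
  by move=> v1; rewrite normrM ler_piMr.
exists (d * l1), (d * l2), (h * l1 ^+ 2), (2 * h * l1 * l2), (h * l2 ^+ 2).
have q1 : `|l1 ^+ 2| <= 1 by rewrite normrX exprn_ile1.
have q2 : `|l2 ^+ 2| <= 1 by rewrite normrX exprn_ile1.
split.
- by split; apply: le_trans (sm _ _ _) _.
- split; [apply: le_trans (sm _ _ _) _ => //; lra| |apply: le_trans (sm _ _ _) _ => //; lra].
  do 2 apply: le_trans (sm _ _ _) _ => //.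
  rewrite normrM ger0_norm//; lra.
move=> y y1.
have -> : l1 * (x + y).1 + l2 * (x + y).2 + c = l1 * x.1 + l2 * x.2 + c + (l1 * y.1 + l2 * y.2).
  by rewrite /=; ring.
have -> : quad (step_fun (l1 * x.1 + l2 * x.2 + c)) (d * l1) (d * l2) (h * l1 ^+ 2)
  (2 * h * l1 * l2) (h * l2 ^+ 2) y = step_fun (l1 * x.1 + l2 * x.2 + c)
   + d * (l1 * y.1 + l2 * y.2) + h * (l1 * y.1 + l2 * y.2) ^+ 2.
  by rewrite /quad; ring.
apply: le_trans (ds _) _.
have := quad1_bound y L1 L2; rewrite mul1r => b.
apply: (@le_trans _ _ (norm1 y ^+ 3)); first by apply: lerXn2r; rewrite ?nnegrE ?norm1_ge0.
by rewrite ler_peMl ?exprn_ge0 ?norm1_ge0//; lra.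
Qed.

End TestFunctions.

(** * Expansion in the mean and its remainder *)

Section LimitTheorems.
Context {R : realType}.

Lemma cvg_dist_le (u v : nat -> R) (l : R) :
  (forall n, (0 < n)%N -> `|u n - l| <= v n) -> v @ \oo --> 0 -> u @ \oo --> l.
Proof.
move=> uv v0; apply/cvgrPdist_le => e e0.
have /cvgrPdist_le/(_ _ e0) := v0; apply: filterS2; last exact: (nbhs_infty_gt 0).
move=> n n0; rewrite sub0r normrN distrC => vn.
exact: le_trans (uv n n0) (le_trans (ler_norm _) vn).
Qed.

Lemma Rint_dct d (T : measurableType d) (m : probability T R)
  (F : nat -> T -> R) (f G : T -> R) :
  (forall n, measurable_fun setT (F n)) -> measurable_fun setT f ->
  (forall x, F n x @[n --> \oo] --> f x) ->
  m.-integrable setT (EFin \o G) -> (forall n x, `|F n x| <= G x) ->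
  \int[m]_x F n x @[n --> \oo] --> \int[m]_x f x.
Proof.
move=> mF mf Ff iG FG; apply: fine_cvg; rewrite fineK.
- apply: (@dominated_cvg _ _ _ m setT measurableT (fun n x => (F n x)%:E) _ (EFin \o G)) => //.
  + by move=> n; exact/measurable_EFinP.
  + by move=> x _; apply: cvg_EFin; [exact: nearW|exact: Ff].
  + by move=> n x _; rewrite /= lee_fin.
- apply: (integrable_fin_num _ (f := EFin \o f)) => //.
  apply: (@le_integrable _ _ _ m _ measurableT _ (EFin \o G)) => //; first exact/measurable_EFinP.
  move=> x _ /=; rewrite lee_fin (le_trans _ (ler_norm _))//.
  have fx : `|F n x| @[n --> \oo] --> `|f x| by apply: cvg_norm; exact: Ff.
  rewrite -(cvg_lim (@norm_hausdorff _ _) fx)//; apply: limr_le; first by apply/cvg_ex; exists `|f x|.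
  exact: nearW.
Qed.

Definition scale2 (c : R) (y : R * R) : R * R := (c * y.1, c * y.2).

Lemma scale2_sum c n (F : nat -> R * R) :
  \sum_(i < n) scale2 c (F i) = scale2 c (\sum_(i < n) F i).
Proof.
elim: n => [|n IH]; first by rewrite !big_ord0 /scale2 /= mulr0.
by rewrite !big_ord_recr/= IH /scale2 /=; congr pair; rewrite mulrDr.
Qed.

Lemma norm1_scale2 c y : 0 <= c -> norm1 (scale2 c y) = c * norm1 y.
Proof. by move=> c0; rewrite /norm1 /= !normrM ger0_norm// mulrDr. Qed.

Section Moments.
Context d (T : measurableType d) (m : probability T R) (Y : T -> R * R).
Hypothesis mY : measurable_fun setT Y.
Hypothesis iY : m.-integrable setT (fun t => (norm1 (Y t) ^+ 2)%:E).

Lemma measurable_fst_comp : measurable_fun setT (fun t => (Y t).1).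
Proof. by have [] := (measurable_fun_pairP _).1 mY. Qed.

Lemma measurable_snd_comp : measurable_fun setT (fun t => (Y t).2).
Proof. by have [] := (measurable_fun_pairP _).1 mY. Qed.

Lemma measurable_norm1 : measurable_fun setT (fun t => norm1 (Y t)).
Proof.
by apply: measurable_funD; apply: measurableT_comp => //;
  [exact: measurable_fst_comp|exact: measurable_snd_comp].
Qed.

Lemma measurable_scale2 c : measurable_fun setT (scale2 c \o Y).
Proof.
apply/measurable_fun_pairP; split; apply: measurable_funM => //.
  exact: measurable_fst_comp.
exact: measurable_snd_comp.
Qed.

Lemma integrable_dom (g : T -> R) (K : R) : measurable_fun setT g ->
  (forall t, `|g t| <= K * (1 + norm1 (Y t) ^+ 2)) ->
  m.-integrable setT (EFin \o g).
Proof.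
move=> mg gK.
apply: (@le_integrable _ _ _ m _ measurableT _
  (fun t => (K%:E * (1 + (norm1 (Y t) ^+ 2)%:E))%E)).
- exact/measurable_EFinP.
- move=> t _; rewrite /= lee_fin; exact: le_trans (gK t) (ler_norm _).
- apply: integrableZl => //; apply: integrableD => //.
  exact: finite_measure_integrable_cst.
Qed.

Lemma integrable_le_norm1 (g : T -> R) : measurable_fun setT g ->
  (forall t, `|g t| <= norm1 (Y t)) -> m.-integrable setT (EFin \o g).
Proof.
move=> mg gY; apply: (@integrable_dom _ 1) => // t; apply: le_trans (gY t) _.
by rewrite mul1r; have := sqr_ge0 (norm1 (Y t) - 1); rewrite sqrrB1 mulr2n; have := sqr_ge0 (norm1 (Y t)); lra.
Qed.

Lemma integrable_Y1 : m.-integrable setT (fun t => (Y t).1%:E).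
Proof. by apply: integrable_le_norm1 => [|t]; [exact: measurable_fst_comp|rewrite lerDl]. Qed.

Lemma integrable_Y2 : m.-integrable setT (fun t => (Y t).2%:E).
Proof. by apply: integrable_le_norm1 => [|t]; [exact: measurable_snd_comp|rewrite lerDr]. Qed.

Lemma integrable_quad2 (h11 h12 h22 : R) : m.-integrable setT
  (fun t => (h11 * (Y t).1 ^+ 2 + h12 * (Y t).1 * (Y t).2 + h22 * (Y t).2 ^+ 2)%:E).
Proof.
have m1 := measurable_fst_comp; have m2 := measurable_snd_comp.
apply: (@integrable_dom _ (`|h11| + `|h12| + `|h22|)).
  apply: measurable_funD; last by apply: measurable_funM => //; exact: measurable_funX.
  apply: measurable_funD; first by apply: measurable_funM => //; exact: measurable_funX.
  by apply: measurable_funM => //; exact: measurable_funM.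
move=> t; apply: le_trans (@quad2_bound _ (`|h11| + `|h12| + `|h22|) _ _ _ _ _ _ _ _) _.
- by rewrite !addr_ge0.
- by rewrite -addrA lerDl addr_ge0.
- by rewrite addrAC lerDr addr_ge0.
- by rewrite lerDr addr_ge0.
- by rewrite ler_wpM2l ?addr_ge0// lerDr.
Qed.

Lemma integrable_Y11 : m.-integrable setT (fun t => ((Y t).1 ^+ 2)%:E).
Proof.
have := integrable_quad2 1 0 0; apply: eq_integrable => // t _.
by rewrite !mul0r mul1r !addr0.
Qed.

Lemma integrable_Y12 : m.-integrable setT (fun t => ((Y t).1 * (Y t).2)%:E).
Proof.
have := integrable_quad2 0 1 0; apply: eq_integrable => // t _.
by rewrite !mul0r mul1r !addr0 add0r.
Qed.

Lemma integrable_Y22 : m.-integrable setT (fun t => ((Y t).2 ^+ 2)%:E).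
Proof.
have := integrable_quad2 0 0 1; apply: eq_integrable => // t _.
by rewrite !mul0r mul1r !add0r.
Qed.

(** A smooth variant of the truncated second moment in Lindeberg's condition. Up to a constant,
    [c ^+ 2] times it bounds the mean Taylor remainder of a step [c * Y]; it vanishes with [c] by
    dominated convergence, with second moments only. *)
Definition lind (c : R) : R := \int[m]_t (norm1 (Y t) ^+ 2 * Num.min 1 (c * norm1 (Y t))).

Lemma integrable_lind c : 0 <= c ->
  m.-integrable setT (fun t => (norm1 (Y t) ^+ 2 * Num.min 1 (c * norm1 (Y t)))%:E).
Proof.
move=> c0; apply: (@integrable_dom _ 1).
  apply: measurable_funM; first by apply: measurable_funX; exact: measurable_norm1.
  by apply: measurable_minr => //; apply: measurable_funM => //; exact: measurable_norm1.
move=> t; have n0 := norm1_ge0 (Y t).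
have m0 : 0 <= Num.min 1 (c * norm1 (Y t)) by rewrite le_min ler01 mulr_ge0.
rewrite ger0_norm ?mulr_ge0 ?exprn_ge0// mul1r.
apply: (@le_trans _ _ (norm1 (Y t) ^+ 2)); last by rewrite lerDr.
by rewrite ler_piMr ?exprn_ge0// ge_min lexx.
Qed.

Lemma cvg_lind (c : nat -> R) : (forall n, 0 <= c n) -> c @ \oo --> 0 ->
  lind (c n) @[n --> \oo] --> 0.
Proof.
move=> c0 cc; rewrite [X in _ --> X](_ : 0 = \int[m]_t (0 : R)); last first.
  by rewrite Rintegral_cst1.
apply: (@Rint_dct _ _ m _ _ (fun t => norm1 (Y t) ^+ 2)) => //.
- by move=> n; apply/measurable_EFinP; exact: measurable_int (integrable_lind (c0 n)).
- move=> t; apply: (@cvg_dist_le _ (fun n => norm1 (Y t) ^+ 2 * (c n * norm1 (Y t)))).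
    move=> n _; have n0 := norm1_ge0 (Y t).
    have m0 : 0 <= Num.min 1 (c n * norm1 (Y t)) by rewrite le_min ler01 mulr_ge0.
    rewrite subr0 ger0_norm ?mulr_ge0 ?exprn_ge0//.
    by rewrite ler_wpM2l ?exprn_ge0// ge_min lexx orbT.
  rewrite -(mulr0 (norm1 (Y t) ^+ 2)) -[X in _ * X](mul0r (norm1 (Y t))).
  by apply: cvgM; [exact: cvg_cst|apply: cvgM => //; exact: cvg_cst].
move=> n t; have n0 := norm1_ge0 (Y t).
have m0 : 0 <= Num.min 1 (c n * norm1 (Y t)) by rewrite le_min ler01 mulr_ge0.
rewrite ger0_norm ?mulr_ge0 ?exprn_ge0//.
by rewrite ler_piMr ?exprn_ge0// ge_min lexx.
Qed.

(** Outside the unit ball the two values of [f], the linear part and the quadratic part are each at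
    most [C * norm1 y ^+ 2], hence the factor 4. *)
Lemma taylor_global f (C : R) x : 0 <= C -> (forall x, `|f x| <= C) -> taylor_at f C x ->
  exists d1 d2 h11 h12 h22 : R,
   [/\ `|d1| <= C /\ `|d2| <= C, [/\ `|h11| <= C, `|h12| <= C & `|h22| <= C] &
   forall y, `|f (x + y) - quad (f x) d1 d2 h11 h12 h22 y| <=
     4 * C * (norm1 y ^+ 2 * Num.min 1 (norm1 y))].
Proof.
move=> C0 fC [d1 [d2 [h11 [h12 [h22 [[d1C d2C] [h1C h2C h3C] ty]]]]]].
exists d1, d2, h11, h12, h22; split => // y.
have n0 := norm1_ge0 y; have [n1|n1] := leP (norm1 y) 1.
  apply: le_trans (ty y n1) _; rewrite -exprSr -mulrA.
  rewrite ler_peMl ?mulr_ge0 ?exprn_ge0//; lra.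
rewrite mulr1 [quad _ _ _ _ _ _ _](_ : _ =
  f x + (d1 * y.1 + d2 * y.2) + (h11 * y.1 ^+ 2 + h12 * y.1 * y.2 + h22 * y.2 ^+ 2)).
  2: by rewrite /quad; ring.
have := quad1_bound y d1C d2C; have := quad2_bound y C0 h1C h2C h3C.
have := fC x; have := fC (x + y).
have : C * norm1 y <= C * norm1 y ^+ 2.
  by rewrite ler_wpM2l// expr2 ler_peMl// ltW.
have : C <= C * norm1 y ^+ 2 by rewrite ler_peMr// exprn_ege1// ltW.
rewrite !ler_norml => *; apply/andP; split; lra.
Qed.

(** The quadratic polynomial integrates to the first and second moments and the remainder to [lind],
    so two laws with equal moments agree up to the remainders. *)
Lemma avg_quad (f : R * R -> R) (C : R) (x : R * R) (c d1 d2 h11 h12 h22 : R) : bddmeas f -> 0 <= c ->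
  (forall y, `|f (x + y) - quad (f x) d1 d2 h11 h12 h22 y| <=
     4 * C * (norm1 y ^+ 2 * Num.min 1 (norm1 y))) ->
  `|avg m (scale2 c \o Y) f x -
     (f x + c * (d1 * \int[m]_t (Y t).1 + d2 * \int[m]_t (Y t).2) +
      c ^+ 2 * (h11 * \int[m]_t (Y t).1 ^+ 2 + h12 * \int[m]_t ((Y t).1 * (Y t).2)
        + h22 * \int[m]_t (Y t).2 ^+ 2))| <= 4 * C * (c ^+ 2 * lind c).
Proof.
move=> bf c0 R1.
set rhs := (X in avg _ _ _ _ - X).
have i1 := integrable_Y1; have i2 := integrable_Y2; have i11 := integrable_Y11.
have i12 := integrable_Y12; have i22 := integrable_Y22.
pose q t := quad (f x) d1 d2 h11 h12 h22 (scale2 c (Y t)).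
have iq : m.-integrable setT (EFin \o q) /\ \int[m]_t q t = rhs.
  have zl (k : R) g : m.-integrable setT (EFin \o g) ->
      m.-integrable setT (EFin \o (fun t => k * g t)).
    by move=> ig; exact: (integrableZl measurableT k ig).
  have dd g h : m.-integrable setT (EFin \o g) -> m.-integrable setT (EFin \o h) ->
      m.-integrable setT (EFin \o (fun t => g t + h t)).
    by move=> ig ih; exact: (integrableD measurableT ig ih).
  have ic : m.-integrable setT (EFin \o (fun _ : T => f x)).
    exact: finite_measure_integrable_cst.
  have e : q = fun t =>
    f x + c * d1 * (Y t).1 + c * d2 * (Y t).2 + c ^+ 2 * h11 * (Y t).1 ^+ 2
    + c ^+ 2 * h12 * ((Y t).1 * (Y t).2) + c ^+ 2 * h22 * (Y t).2 ^+ 2.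
    by apply/funext => t; rewrite /q /quad /scale2 /=; ring.
  have j1 := zl (c * d1) _ i1; have j2 := zl (c * d2) _ i2.
  have j11 := zl (c ^+ 2 * h11) _ i11; have j12 := zl (c ^+ 2 * h12) _ i12.
  have j22 := zl (c ^+ 2 * h22) _ i22.
  have k1 := dd _ _ ic j1; have k2 := dd _ _ k1 j2; have k3 := dd _ _ k2 j11.
  have k4 := dd _ _ k3 j12; have k5 := dd _ _ k4 j22.
  rewrite e; split; first exact: k5.
  rewrite (RintegralD measurableT k4 j22) (RintegralD measurableT k3 j12).
  rewrite (RintegralD measurableT k2 j11) (RintegralD measurableT k1 j2).
  rewrite (RintegralD measurableT ic j1) Rintegral_cst1.
  rewrite (RintegralZl _ measurableT i1) (RintegralZl _ measurableT i2).
  rewrite (RintegralZl _ measurableT i11) (RintegralZl _ measurableT i12).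
  rewrite (RintegralZl _ measurableT i22) /rhs; ring.
have [iq1 <-] := iq.
have bf' : bddmeas (fun t => f (x + (scale2 c \o Y) t)).
  by apply: bddmeas_avg_in => //; exact: measurable_scale2.
have if' := bddmeas_integrable m bf'.
rewrite /avg -RintegralB//.
apply: le_trans (le_normr_Rintegral measurableT _) _.
  exact: (integrableB measurableT if' iq1).
rewrite [leRHS](_ : _ = \int[m]_t (4 * C * c ^+ 2 *
   (norm1 (Y t) ^+ 2 * Num.min 1 (c * norm1 (Y t))))); last first.
  by rewrite RintegralZl//; [rewrite /lind; ring|exact: integrable_lind].
apply: le_Rintegral => //.
- by apply: integrable_norm; exact: (integrableB measurableT if' iq1).
- exact: (integrableZl measurableT _ (integrable_lind c0)).
move=> t _; apply: le_trans (R1 _) _.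
by rewrite norm1_scale2// exprMn le_eqVlt; apply/orP; left; apply/eqP; ring.
Qed.

End Moments.
End LimitTheorems.

(** * Central limit theorem and weak law on test functions *)

Section TestConvergence.
Context {R : realType}.

Lemma cvg_invn : (n%:R^-1 : R) @[n --> \oo] --> (0 : R).
Proof.
apply/cvgrPdist_lt => e e0; have := nbhs_infty_gtr (e^-1).
apply: filterS => n en; have n0 : (0 : R) < n%:R by rewrite (lt_trans _ en) ?invr_gt0.
by rewrite sub0r normrN ger0_norm ?invr_ge0 ?ltW// invf_plt.
Qed.

Lemma cvg_invsqrtn : ((Num.sqrt n%:R)^-1 : R) @[n --> \oo] --> (0 : R).
Proof.
apply/cvgrPdist_lt => e e0; have := nbhs_infty_gtr (e ^- 2).
apply: filterS => n en.
have e20 : 0 < e ^- 2 by rewrite invr_gt0 exprn_gt0.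
have n0 : (0 : R) < n%:R by rewrite (lt_trans _ en).
rewrite sub0r normrN ger0_norm ?invr_ge0 ?sqrtr_ge0// invf_plt ?posrE ?sqrtr_gt0//.
rewrite -[e^-1]ger0_norm ?invr_ge0 ?ltW// -sqrtr_sqr exprVn.
by rewrite ltr_sqrt.
Qed.

Lemma avg_diff_bound d1 d2 (T1 : measurableType d1) (T2 : measurableType d2)
  (m1 : probability T1 R) (m2 : probability T2 R)
  (Y1 : T1 -> R * R) (Y2 : T2 -> R * R) (f : R * R -> R) (C c : R) :
  measurable_fun setT Y1 -> measurable_fun setT Y2 ->
  m1.-integrable setT (fun t => (norm1 (Y1 t) ^+ 2)%:E) ->
  m2.-integrable setT (fun t => (norm1 (Y2 t) ^+ 2)%:E) ->
  \int[m1]_t (Y1 t).1 = \int[m2]_t (Y2 t).1 ->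
  \int[m1]_t (Y1 t).2 = \int[m2]_t (Y2 t).2 ->
  \int[m1]_t (Y1 t).1 ^+ 2 = \int[m2]_t (Y2 t).1 ^+ 2 ->
  \int[m1]_t ((Y1 t).1 * (Y1 t).2) = \int[m2]_t ((Y2 t).1 * (Y2 t).2) ->
  \int[m1]_t (Y1 t).2 ^+ 2 = \int[m2]_t (Y2 t).2 ^+ 2 ->
  0 <= C -> 0 <= c -> (forall x, `|f x| <= C) -> bddmeas f ->
  (forall x, taylor_at f C x) ->
  forall x, `|avg m1 (scale2 c \o Y1) f x - avg m2 (scale2 c \o Y2) f x| <=
    4 * C * (c ^+ 2 * (lind m1 Y1 c + lind m2 Y2 c)).
Proof.
move=> mY1 mY2 iY1 iY2 E1 E2 E11 E12 E22 C0 c0 fC bf tf x.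
have bs1 := bddmeas_integrable m1 (bddmeas_avg_in (measurable_scale2 mY1 c) x bf).
have bs2 := bddmeas_integrable m2 (bddmeas_avg_in (measurable_scale2 mY2 c) x bf).
have [d [d' [h [h' [h'' [_ _ R1]]]]]] := taylor_global C0 fC (tf x).
have := avg_quad mY1 iY1 bf c0 R1; have := avg_quad mY2 iY2 bf c0 R1.
rewrite E1 E2 E11 E12 E22; set q := f x + _ + _ => A2 A1.
rewrite mulrDr mulrDr.
apply: le_trans (ler_distD q _ _) _; rewrite lerD// distrC; exact: A2.
Qed.

Section Lindeberg.
Context d (Omega : measurableType d) (P : probability Omega R).
Context d' (T : measurableType d') (X : nat -> Omega -> T) (mu : probability T R).
Variable Y : T -> R * R.
Hypotheses (mX : forall n, measurable_fun setT (X n)) (indX : mutually_independent P X).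
Hypothesis lawX : forall n A, measurable A -> P (X n @^-1` A) = mu A.
Hypotheses (mY : measurable_fun setT Y)
  (iY : mu.-integrable setT (fun t => (norm1 (Y t) ^+ 2)%:E)).

Lemma Rint_scaled_sum f (c : R) n : bddmeas f ->
  \int[P]_w f (scale2 c (\sum_(i < n) Y (X i w))) = iter n (avg mu (scale2 c \o Y)) f 0.
Proof.
move=> bf; rewrite -(avg_iid_sum mX indX lawX (measurable_scale2 mY c) n bf) /avg.
by apply: eq_Rintegral => w _; rewrite add0r; congr f; rewrite /= (scale2_sum c n (fun i => Y (X i w))).
Qed.

(** The limit law enters through its first two moments and through invariance under normalized sums,
    the hypothesis on [iter n]; the Gaussian computations are thereby kept apart. *)
Lemma clt_test d2 (T2 : measurableType d2) (m2 : probability T2 R) (Y2 : T2 -> R * R) f :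
  measurable_fun setT Y2 ->
  m2.-integrable setT (fun t => (norm1 (Y2 t) ^+ 2)%:E) ->
  \int[mu]_t (Y t).1 = \int[m2]_t (Y2 t).1 ->
  \int[mu]_t (Y t).2 = \int[m2]_t (Y2 t).2 ->
  \int[mu]_t (Y t).1 ^+ 2 = \int[m2]_t (Y2 t).1 ^+ 2 ->
  \int[mu]_t ((Y t).1 * (Y t).2) = \int[m2]_t ((Y2 t).1 * (Y2 t).2) ->
  \int[mu]_t (Y t).2 ^+ 2 = \int[m2]_t (Y2 t).2 ^+ 2 ->
  (forall n, (0 < n)%N -> iter n (avg m2 (scale2 (Num.sqrt n%:R)^-1 \o Y2)) f 0 =
    \int[m2]_t f (Y2 t)) ->
  taylor_fun f ->
  \int[P]_w f (scale2 (Num.sqrt n%:R)^-1 (\sum_(i < n) Y (X i w))) @[n --> \oo] -->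
    \int[m2]_t f (Y2 t).
Proof.
move=> mY2 iY2 E1 E2 E11 E12 E22 stable tf.
have bf := taylor_bddmeas tf; have [_ [C [C0 fC tC]]] := tf.
pose c (n : nat) : R := (Num.sqrt n%:R)^-1.
have c0 n : 0 <= c n by rewrite invr_ge0 sqrtr_ge0.
apply: (@cvg_dist_le _ _ (fun n => 4 * C * (lind mu Y (c n) + lind m2 Y2 (c n)))).
  move=> n n0; rewrite -(stable n n0) Rint_scaled_sum//.
  apply: le_trans (trotter (measurable_scale2 mY _) (measurable_scale2 mY2 _) n bf
    (avg_diff_bound mY mY2 iY iY2 E1 E2 E11 E12 E22 C0 (c0 n) fC bf tC) 0) _.
  (* The one-step error carries [c n ^+ 2], which cancels the n steps exactly and leaves the
     vanishing factor [lind]. *)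
  have -> : c n ^+ 2 = n%:R^-1 by rewrite exprVn sqr_sqrtr.
  rewrite mulrCA (mulrA n%:R) mulfV ?mul1r// pnatr_eq0; lia.
have cn : c n @[n --> \oo] --> (0 : R) := cvg_invsqrtn.
rewrite -(mulr0 (4 * C)); apply: cvgM; first exact: cvg_cst.
by rewrite -(addr0 0); apply: cvgD; exact: cvg_lind.
Qed.

(** The same comparison, now with the constant vector [e], whose averages are [e]. Only first
    moments match; the second order terms that remain have size n^-2 per step, hence n^-1 in
    total. *)
Lemma weak_law_test f : taylor_fun f ->
  \int[P]_w f (scale2 n%:R^-1 (\sum_(i < n) Y (X i w))) @[n --> \oo] -->
    f (\int[mu]_t (Y t).1, \int[mu]_t (Y t).2).
Proof.
move=> tf; have bf := taylor_bddmeas tf; have [_ [C [C0 fC tC]]] := tf.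
set e := (\int[mu]_t (Y t).1, _).
pose c (n : nat) : R := n%:R^-1.
have c0 n : 0 <= c n by rewrite invr_ge0.
have me : measurable_fun setT (fun _ : T => e) by exact: measurable_cst.
have ie : mu.-integrable setT (fun _ : T => (norm1 e ^+ 2)%:E).
  exact: finite_measure_integrable_cst.
pose M1 (Z : T -> R * R) := `|\int[mu]_t (Z t).1 ^+ 2| + `|\int[mu]_t ((Z t).1 * (Z t).2)|
    + `|\int[mu]_t (Z t).2 ^+ 2|.
pose K := C * (M1 Y + M1 (fun=> e)).
apply: (@cvg_dist_le _ _ (fun n => c n * K +
    4 * C * (c n * (lind mu Y (c n) + lind mu (fun=> e) (c n))))).
  move=> n n0; rewrite Rint_scaled_sum//.
  have nc : n%:R * c n = 1 by rewrite mulfV// pnatr_eq0; lia.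
  have <- : iter n (avg mu (scale2 (c n) \o (fun=> e))) f 0 = f e.
    have it k x : iter k (avg mu (scale2 (c n) \o (fun=> e))) f x =
        f (x + scale2 (k%:R * c n) e).
      elim: k x => [|k IH] x; first by rewrite /scale2 !mul0r addr0.
      rewrite iterS /avg; under eq_Rintegral do rewrite IH.
      rewrite /= Rintegral_cst1; congr f; rewrite -addrA; congr (_ + _).
      by rewrite /scale2 /= -natr1; congr pair; rewrite /=; ring.
    by rewrite it nc add0r /scale2 !mul1r.
  apply: le_trans (trotter (measurable_scale2 mY _) (measurable_scale2 me _) n bf
    (s := c n ^+ 2 * K + 4 * C * (c n ^+ 2 * (lind mu Y (c n) + lind mu (fun=> e) (c n)))) _ 0) _.
    move=> x.
    have [d1 [d2 [h [h' [h'' [_ [b1 b2 b3] R1]]]]]] := taylor_global C0 fC (tC x).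
    have := avg_quad mY iY bf (c0 n) R1; have := avg_quad me ie bf (c0 n) R1.
    have -> : \int[mu]_t e.1 = \int[mu]_t (Y t).1 by rewrite Rintegral_cst1.
    have -> : \int[mu]_t e.2 = \int[mu]_t (Y t).2 by rewrite Rintegral_cst1.
    set q := f x + _.
    set s2 := (h * _ + _ + _) => A2; set s1 := (h * _ + _ + _) => A1.
    have sb (Z : T -> R * R) : `|h * \int[mu]_t (Z t).1 ^+ 2 + h' * \int[mu]_t ((Z t).1 * (Z t).2)
        + h'' * \int[mu]_t (Z t).2 ^+ 2| <= C * M1 Z.
      rewrite /M1 !mulrDr; apply: le_trans (ler_normD _ _) _.
      apply: lerD; last by rewrite normrM ler_wpM2r.
      apply: le_trans (ler_normD _ _) _; apply: lerD; by rewrite normrM ler_wpM2r.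
    have B1 : `|s1| <= C * M1 Y := sb Y.
    have B2 : `|s2| <= C * M1 (fun=> e) := sb (fun=> e).
    have : `|c n ^+ 2 * (s1 - s2)| <= c n ^+ 2 * (C * M1 Y + C * M1 (fun=> e)).
      rewrite normrM ger0_norm ?sqr_ge0// ler_wpM2l ?sqr_ge0//.
      by apply: le_trans (ler_normB _ _) _; rewrite lerD.
    rewrite -(mulrDr C (M1 Y)) -/K; move: A1 A2; clearbody s1 s2 K.
    move: (avg mu _ f x) (avg mu _ f x) => u1 u2.
    rewrite !ler_norml => /andP[a1 a2] /andP[a3 a4] /andP[a5 a6].
    by apply/andP; split; lra.
  rewrite le_eqVlt; apply/orP; left; apply/eqP.
  transitivity (n%:R * c n * (c n * K + 4 * C * (c n * (lind mu Y (c n) + lind mu (fun=> e) (c n))))).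
    by ring.
  by rewrite nc mul1r.
have cn : c n @[n --> \oo] --> (0 : R) := cvg_invn.
rewrite [X in _ --> X](_ : 0 = 0 * K + 4 * C * (0 * (0 + 0))); last by ring.
apply: cvgD; first by apply: cvgM => //; exact: cvg_cst.
apply: cvgM; first exact: cvg_cst.
by apply: cvgM => //; apply: cvgD; exact: cvg_lind.
Qed.

End Lindeberg.
End TestConvergence.

(** * Approximation of open sets from below *)

Section OpenSets.
Context {R : realType}.

Definition plane_open (U : set (R * R)) : Prop := forall x, U x ->
  exists2 e : R, 0 < e & forall y, `|y.1 - x.1| < e -> `|y.2 - x.2| < e -> U y.

Definition rbox := (rat * rat * rat * rat)%type.

Definition in_box (q : rbox) (x : R * R) : Prop :=
  [/\ ratr q.1.1.1 < x.1, x.1 < ratr q.1.1.2, ratr q.1.2 < x.2 & x.2 < ratr q.2].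

(** A product of four one-sided steps, positive exactly inside the box. The coefficients 0 and 1
    give each factor the shape of [taylor_step]. *)
Definition bump (q : rbox) (x : R * R) : R :=
  step_fun (1 * x.1 + 0 * x.2 + - ratr q.1.1.1) *
  step_fun (-1 * x.1 + 0 * x.2 + ratr q.1.1.2) *
  (step_fun (0 * x.1 + 1 * x.2 + - ratr q.1.2) *
  step_fun (0 * x.1 + -1 * x.2 + ratr q.2)).

Lemma taylor_bump q : taylor_fun (bump q).
Proof.
by apply: taylorM; apply: taylorM; apply: taylor_step; rewrite ?normrN1 ?normr1 ?normr0.
Qed.

Lemma bump01 q x : 0 <= bump q x <= 1.
Proof.
have h t : 0 <= step_fun t /\ step_fun t <= 1 :> R.
  by have [/andP[]] := @step_fun_bound R t.
have m01 (a b : R) : 0 <= a /\ a <= 1 -> 0 <= b /\ b <= 1 -> 0 <= a * b /\ a * b <= 1.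
  by move=> [? ?] [? ?]; split; [rewrite mulr_ge0|rewrite mulr_ile1].
by apply/andP; apply: (m01 _ _ (m01 _ _ _ _) (m01 _ _ _ _)).
Qed.

Lemma step_fun_gt0 (t : R) : 0 < t -> 0 < step_fun t.
Proof. by have [_] := step_fun_bound t; apply. Qed.

Lemma bump_gt0 q x : in_box q x -> 0 < bump q x.
Proof.
move=> [a b c d]; apply: mulr_gt0; apply: mulr_gt0; apply: step_fun_gt0;
  rewrite !(mul0r, mul1r, mulN1r, add0r, addr0) ?subr_gt0// addrC subr_gt0//.
Qed.

Lemma bump_out q x : ~ in_box q x -> bump q x = 0.
Proof.
move=> nb; rewrite /bump !(mul0r, mul1r, mulN1r, add0r, addr0).
have [a|a] := leP x.1 (ratr q.1.1.1); first by rewrite step_fun_le0 ?subr_le0// !mul0r.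
have [b|b] := leP (ratr q.1.1.2) x.1.
  by rewrite [X in _ * X * _]step_fun_le0 ?mulr0 ?mul0r// addrC subr_le0.
have [c|c] := leP x.2 (ratr q.1.2).
  by rewrite [X in _ * (X * _)]step_fun_le0 ?subr_le0// mul0r mulr0.
have [d|d] := leP (ratr q.2) x.2; last by exfalso; apply: nb.
by rewrite [X in _ * (_ * X)]step_fun_le0 ?mulr0 ?mul0r// addrC subr_le0.
Qed.

Variable U : set (R * R).
Hypothesis oU : plane_open U.

(** Rational boxes are enumerated by their codes; a code of no box, or of a box not contained in
    [U], gives the zero function. *)
Definition open_bump (i : nat) (x : R * R) : R :=
  if unpickle i is Some q then if `[< in_box q `<=` U >] then bump q x else 0 else 0.

Lemma taylor_open_bump i : taylor_fun (open_bump i).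
Proof.
rewrite /open_bump; case: unpickle => [q|]; last exact: taylor_cst.
by case: asboolP => _; [exact: taylor_bump|exact: taylor_cst].
Qed.

Lemma open_bump01 i x : 0 <= open_bump i x <= 1.
Proof.
rewrite /open_bump; case: unpickle => [q|]; last by rewrite lexx ler01.
by case: asboolP => _; [exact: bump01|rewrite lexx ler01].
Qed.

Lemma open_bump_out i x : ~ U x -> open_bump i x = 0.
Proof.
move=> Ux; rewrite /open_bump; case: unpickle => [q|//].
by case: asboolP => // qU; apply: bump_out; apply: contra_not Ux; exact: qU.
Qed.

Lemma open_bump_in x : U x -> exists i, 0 < open_bump i x.
Proof.
move=> /oU[e e0 eU].
have lt1 : x.1 - e < x.1 by rewrite gtrBl.
have lt2 : x.1 < x.1 + e by rewrite ltrDl.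
have lt3 : x.2 - e < x.2 by rewrite gtrBl.
have lt4 : x.2 < x.2 + e by rewrite ltrDl.
have [a] := rat_in_itvoo lt1; rewrite in_itv/= => /andP[a1 a2].
have [b] := rat_in_itvoo lt2; rewrite in_itv/= => /andP[b1 b2].
have [c] := rat_in_itvoo lt3; rewrite in_itv/= => /andP[c1 c2].
have [d] := rat_in_itvoo lt4; rewrite in_itv/= => /andP[d1 d2].
exists (pickle (a, b, c, d)); rewrite /open_bump pickleK.
rewrite (asboolT (P := in_box (a, b, c, d) `<=` U)); first exact: bump_gt0.
by move=> y [/= h1 h2 h3 h4]; apply: eU; rewrite ltr_norml; lra.
Qed.

Lemma plane_open_measurable : measurable U.
Proof.
have -> : U = \bigcup_i (open_bump i @^-1` `]0, +oo[).
  apply/seteqP; split=> [x /open_bump_in[i i0]|x [i _]] /=.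
    by exists i => //=; rewrite in_itv/= andbT.
  rewrite in_itv/= andbT => i0; apply: contrapT => /open_bump_out e.
  by rewrite e ltxx in i0.
apply: bigcupT_measurable => i; have [mi _] := taylor_open_bump i.
by rewrite -[X in measurable X]setTI; apply: mi.
Qed.

(** A single positive bump makes its factor tend to 0 as the exponent grows, and with it the whole
    product. The product form keeps the values in [0, 1] and stays within the test functions. *)
Definition open_approx (n : nat) (x : R * R) : R :=
  1 - \prod_(i <- iota 0 n) (1 - open_bump i x) ^+ n.

Lemma taylor_open_approx n : taylor_fun (open_approx n).
Proof.
apply: taylor_1B; apply: taylor_prod => i; apply: taylorX; apply: taylor_1B.
exact: taylor_open_bump.
Qed.

Lemma open_factor01 i n x : 0 <= (1 - open_bump i x) ^+ n <= 1.
Proof.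
have /andP[b0 b1] := open_bump01 i x.
by rewrite exprn_ge0 ?subr_ge0//= exprn_ile1 ?subr_ge0// gerBl.
Qed.

Lemma open_prod01 n s x : 0 <= \prod_(i <- s) (1 - open_bump i x) ^+ n <= 1.
Proof.
elim: s => [|i s /andP[h0 h1]]; first by rewrite big_nil ler01 lexx.
have /andP[k0 k1] := open_factor01 i n x.
by rewrite big_cons mulr_ge0//= mulr_ile1.
Qed.

Lemma open_approx01 n x : 0 <= open_approx n x <= 1.
Proof.
by have /andP[h0 h1] := open_prod01 n (iota 0 n) x; rewrite /open_approx subr_ge0 h1 gerBl.
Qed.

Lemma open_approx_le n x : open_approx n x <= \1_U x.
Proof.
rewrite indicE; case: (boolP (x \in U)) => [_|]; first by have /andP[] := open_approx01 n x.
rewrite notin_setE => xU; rewrite /open_approx big1 ?subrr// => i _.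
by rewrite (open_bump_out _ xU) subr0 expr1n.
Qed.

Lemma cvg_open_approx x : open_approx n x @[n --> \oo] --> (\1_U x : R).
Proof.
rewrite indicE; case: (boolP (x \in U)) => [|]; last first.
  rewrite notin_setE => xU; rewrite (_ : (fun n => _) = cst 0); first exact: cvg_cst.
  apply/funext => n; rewrite /open_approx big1 ?subrr// => i _.
  by rewrite (open_bump_out _ xU) subr0 expr1n.
rewrite inE => /open_bump_in[k k0].
have /andP[b0 b1] := open_bump01 k x.
have c1 : (1 - open_bump k x) ^+ n @[n --> \oo] --> (0 : R).
  by apply: cvg_expr; rewrite ger0_norm ?subr_ge0// ltrBlDr ltrDl.
apply/cvgrPdist_le => e e0; have /cvgrPdist_le/(_ _ e0) := c1.
apply: filterS2 (nbhs_infty_gt k) => n kn; rewrite sub0r normrN.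
have /andP[f0 f1] := open_factor01 k n x.
rewrite ger0_norm// => h; rewrite /open_approx opprB addrC subrK.
have /andP[p0 p1] := open_prod01 n (iota 0 n) x; rewrite ger0_norm//.
apply: le_trans h; rewrite (bigD1_seq k) ?iota_uniq ?mem_iota//=.
rewrite ler_piMr// -big_filter; by have /andP[] := open_prod01 n [seq i <- iota 0 n | i != k] x.
Qed.

Lemma Rint_indic d (T : measurableType d) (m : probability T R) (A : set T) :
  measurable A -> \int[m]_t (\1_A t : R) = fine (m A).
Proof. by move=> mA; rewrite /Rintegral integral_indic// setIT. Qed.

Lemma bddmeas_indic d (T : measurableType d) (A : set T) :
  measurable A -> bddmeas (\1_A : T -> R).
Proof.
move=> mA; split; first exact: measurable_indic.
by exists 1 => x; rewrite indicE ger0_norm; case: (_ \in _).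
Qed.

(** One [open_approx k], below the indicator and close to it in mean for the limit law, is fixed
    first; convergence is then used for this single test function. *)
Lemma open_liminf d (Omega : measurableType d) (P : probability Omega R)
  (Z : nat -> Omega -> R * R) d2 (T2 : measurableType d2) (m2 : probability T2 R)
  (Y2 : T2 -> R * R) (e : R) :
  (forall n, measurable_fun setT (Z n)) -> measurable_fun setT Y2 ->
  (forall f, taylor_fun f ->
    \int[P]_w f (Z n w) @[n --> \oo] --> \int[m2]_t f (Y2 t)) -> 0 < e ->
  \forall n \near \oo, fine (m2 (Y2 @^-1` U)) - e <= fine (P (Z n @^-1` U)).
Proof.
move=> mZ mY2 ZY e0; have mU := plane_open_measurable.
have e2 : 0 < e / 2 by rewrite divr_gt0.
have c : \int[m2]_t open_approx n (Y2 t) @[n --> \oo] --> \int[m2]_t (\1_(Y2 @^-1` U) t : R).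
  apply: (@Rint_dct _ _ _ m2 _ _ (cst 1)).
  - by move=> n; apply: measurableT_comp mY2; have [] := taylor_open_approx n.
  - exact: measurable_indic (preimage_measurable mY2 mU).
  - move=> t; exact: cvg_open_approx.
  - exact: finite_measure_integrable_cst.
  - by move=> n t; have /andP[h0 h1] := open_approx01 n (Y2 t); rewrite ger0_norm.
rewrite Rint_indic in c; last exact: preimage_measurable.
have [k hk] : exists k, fine (m2 (Y2 @^-1` U)) - e / 2 <= \int[m2]_t open_approx k (Y2 t).
  have /cvgrPdist_le/(_ _ e2)[k _ /(_ k (leqnn k))] := c.
  by rewrite ler_norml => /andP[h1 h2]; exists k; lra.
have /cvgrPdist_le/(_ _ e2) := ZY _ (taylor_open_approx k).
apply: filterS => n; rewrite ler_norml => /andP[h1 h2].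
apply: (@le_trans _ _ (\int[P]_w open_approx k (Z n w))); first lra.
rewrite -Rint_indic; last exact: preimage_measurable.
apply: le_Rintegral => //.
- apply: bddmeas_integrable; have [mf [M fM]] := taylor_bddmeas (taylor_open_approx k).
  by split; [exact: measurableT_comp|exists M => w; exact: fM].
- by apply: bddmeas_integrable; apply: bddmeas_indic; exact: preimage_measurable.
- move=> w _; exact: open_approx_le.
Qed.

End OpenSets.

(** * From open sets to bounded functions *)

Section Portmanteau.
Context {R : realType}.

(** Discrete layer cake: [c] counts the integer levels among 1, ..., m strictly below [y]. The first
    clause serves the induction. *)
Lemma staircase (y : R) (m : nat) : 0 <= y ->
  let c := \sum_(k < m) (nat_of_bool (k.+1%:R < y))%:R in
  [/\ m%:R < y -> c = m%:R, c <= y & Num.min y m%:R <= c + 1].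
Proof.
move=> y0; elim: m => [|m [IH1 IH2 IH3]] /=.
  by rewrite big_ord0; split => //; rewrite add0r ge_min ler01 orbT.
rewrite big_ord_recr /=; set c := \sum_(k < m) _ in IH1 IH2 IH3 *.
have mm : m.+1%:R = m%:R + 1 :> R by rewrite -natr1.
have [h|h] := ltP m.+1%:R y.
  have cm : c = m%:R by apply: IH1; rewrite mm in h; lra.
  by rewrite cm -mm; split => //; [exact: ltW|lra].
rewrite addr0; split=> //.
have [h'|h'] := ltP m%:R y; first by rewrite (IH1 h'); rewrite mm in h; lra.
by move: IH3; rewrite min_l.
Qed.

Lemma Rint_sum_indic d (T : measurableType d) (m : probability T R) (A : nat -> set T) n :
  (forall k, measurable (A k)) ->
  bddmeas (fun t => \sum_(k < n) (\1_(A k) t : R)) /\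
  \int[m]_t (\sum_(k < n) (\1_(A k) t : R)) = \sum_(k < n) fine (m (A k)).
Proof.
move=> mA; elim: n => [|n [[m1 [M hM]] IH2]].
  split; last by under eq_Rintegral do rewrite big_ord0; rewrite big_ord0 Rintegral_cst1.
  rewrite (_ : (fun t => _) = cst 0); first by split; [exact: measurable_cst|exists 0 => t; rewrite normr0].
  by apply/funext => t; rewrite big_ord0.
have b : bddmeas (fun t => \sum_(k < n) (\1_(A k) t : R)) by split => //; exists M.
have b' := bddmeas_indic (R := R) (mA n).
rewrite big_ord_recr/= -IH2 -Rint_indic//.
have -> : (fun t => \sum_(k < n.+1) (\1_(A k) t : R)) =
  (fun t => \sum_(k < n) (\1_(A k) t : R) + \1_(A n) t).
  by apply/funext => t; rewrite big_ord_recr.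
split; last by rewrite RintegralD//; exact: bddmeas_integrable.
split; first by apply: measurable_funD => //; exact: measurable_indic.
exists (M + 1) => t; apply: le_trans (ler_normD _ _) _; apply: lerD => //.
by rewrite indicE; case: (_ \in _); rewrite ?normr1 ?normr0.
Qed.

Context d (Omega : measurableType d) (P : probability Omega R).
Context d2 (T2 : measurableType d2) (m2 : probability T2 R).

(** A function with values in [0, 1] is within 1 / N of the mean of the indicators of N superlevel
    sets. With finitely many levels, one threshold for n serves them all. *)
Lemma portmanteau_low (f : nat -> Omega -> R) (g : T2 -> R) (e : R) :
  (forall n, measurable_fun setT (f n)) -> measurable_fun setT g ->
  (forall n w, 0 <= f n w <= 1) -> (forall t, 0 <= g t <= 1) ->
  (forall s e, 0 < e -> \forall n \near \oo,
     fine (m2 [set t | s < g t]) - e <= fine (P [set w | s < f n w])) ->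
  0 < e -> \forall n \near \oo, \int[m2]_t g t - e <= \int[P]_w f n w.
Proof.
move=> mf mg f01 g01 lim e0; have e2 : 0 < e / 2 by rewrite divr_gt0.
have [N [N0 Ne]] : exists N : nat, (0 < N)%N /\ (N%:R^-1 : R) <= e / 2.
  have /cvgrPdist_le/(_ _ e2)[N _ h] := @cvg_invn R.
  exists N.+1; split => //; have := h N.+1 (leqnSn N).
  by rewrite sub0r normrN ger0_norm// invr_ge0.
have NR : (0 : R) < N%:R by rewrite ltr0n.
have bd d3 (T3 : measurableType d3) (h : T3 -> R) : measurable_fun setT h ->
    (forall t, 0 <= h t <= 1) -> bddmeas h.
  by move=> mh h01; split => //; exists 1 => t; have /andP[? ?] := h01 t; rewrite ger0_norm.
have mS d3 (T3 : measurableType d3) (h : T3 -> R) s : measurable_fun setT h ->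
    measurable [set t | s < h t].
  move=> mh; rewrite -[X in measurable X]setTI.
  rewrite (_ : [set t | s < h t] = h @^-1` `]s, +oo[); first exact: mh.
  by apply/seteqP; split => t /=; rewrite in_itv/= andbT.
have st d3 (T3 : measurableType d3) (m3 : probability T3 R) (h : T3 -> R) :
    measurable_fun setT h -> (forall t, 0 <= h t <= 1) ->
    let s := N%:R^-1 * \sum_(k < N) fine (m3 [set t | k.+1%:R / N%:R < h t]) in
    s <= \int[m3]_t h t <= s + N%:R^-1.
  move=> mh h01 /=; have bh := bd _ _ _ mh h01.
  have [bs <-] := @Rint_sum_indic _ _ m3 (fun k => [set t | k.+1%:R / N%:R < h t]) N
    (fun k => mS _ _ _ _ mh).
  set S := fun t => \sum_(k < N) _ in bs *.
  have SE t : S t = \sum_(k < N) (nat_of_bool (k.+1%:R < N%:R * h t))%:R.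
    apply: eq_bigr => k _; rewrite indicE; congr (_%:R); congr nat_of_bool.
    apply/idP/idP => [/set_mem/=|h1]; first by rewrite ltr_pdivrMr// mulrC.
    by apply/mem_set; rewrite /= ltr_pdivrMr// mulrC.
  have S1 t : N%:R^-1 * S t <= h t.
    have /andP[h0 h1] := h01 t.
    have [_ + _] := @staircase (N%:R * h t) N (mulr_ge0 (ltW NR) h0).
    by rewrite -SE [N%:R^-1 * _]mulrC ler_pdivrMr// [h t * _]mulrC.
  have S2 t : h t <= N%:R^-1 * S t + N%:R^-1.
    have /andP[h0 h1] := h01 t.
    have [_ _] := @staircase (N%:R * h t) N (mulr_ge0 (ltW NR) h0).
    rewrite -SE min_l ?ger_pMr// => k.
    by rewrite -[X in _ + X]mulr1 -mulrDr [N%:R^-1 * _]mulrC ler_pdivlMr// [h t * _]mulrC.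
  have iS := bddmeas_integrable m3 bs; have ih := bddmeas_integrable m3 bh.
  have iNS : m3.-integrable setT (EFin \o (fun t => N%:R^-1 * S t)).
    exact: (integrableZl measurableT (N%:R^-1) iS).
  rewrite -RintegralZl//; apply/andP; split.
    by apply: le_Rintegral => // t _; exact: S1.
  rewrite -[X in _ + X](Rintegral_cst1 m3) -RintegralD//; last exact: finite_measure_integrable_cst.
  have iS1 := integrableD measurableT iNS
    (@finite_measure_integrable_cst _ _ _ m3 setT N%:R^-1 measurableT).
  by apply: (le_Rintegral measurableT ih iS1) => t _; exact: S2.
have all_k m : \forall n \near \oo, forall k, (k < m)%N ->
    fine (m2 [set t | k.+1%:R / N%:R < g t]) - e / 2 <= fine (P [set w | k.+1%:R / N%:R < f n w]).
  elim: m => [|m IH]; first exact: nearW.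
  have h := lim (m.+1%:R / N%:R) _ e2; apply: filterS2 IH h => n h1 h2 k.
  by rewrite ltnS leq_eqVlt => /predU1P[->//|]; exact: h1.
apply: filterS (all_k N) => n hn.
have /andP[_ h1] := st _ _ m2 g mg g01; have /andP[h2 _] := st _ _ P (f n) (mf n) (f01 n).
have h3 : N%:R^-1 * \sum_(k < N) fine (m2 [set t | k.+1%:R / N%:R < g t]) - e / 2 <=
     N%:R^-1 * \sum_(k < N) fine (P [set w | k.+1%:R / N%:R < f n w]).
  rewrite lerBlDr.
  have -> : e / 2 = N%:R^-1 * \sum_(k < N) (e / 2).
    by rewrite sumr_const card_ord -[(e / 2) *+ N]mulr_natl mulKf// gt_eqF.
  rewrite -mulrDr; apply: ler_wpM2l; first by rewrite invr_ge0 ltW.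
  rewrite -big_split /=; apply: ler_sum => k _.
  by rewrite -lerBlDr; exact: hn.
lra.
Qed.

Lemma portmanteau (f : nat -> Omega -> R) (g : T2 -> R) (M : R) :
  (forall n, measurable_fun setT (f n)) -> measurable_fun setT g ->
  (forall n w, `|f n w| <= M) -> (forall t, `|g t| <= M) ->
  (forall s e, 0 < e -> \forall n \near \oo,
     fine (m2 [set t | s < g t]) - e <= fine (P [set w | s < f n w])) ->
  (forall s e, 0 < e -> \forall n \near \oo,
     fine (m2 [set t | g t < s]) - e <= fine (P [set w | f n w < s])) ->
  \int[P]_w f n w @[n --> \oo] --> \int[m2]_t g t.
Proof.
move=> mf mg fM gM lo hi.
pose K := `|M| + 1; have K0 : 0 < K by rewrite ltr_wpDl.
have MK : M <= K by rewrite /K (le_trans (ler_norm M))// lerDl.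
(* An affine map of [-M, M] into [0, 1], increasing for s = 1 and decreasing for s = -1. The lower
   bound applied to both gives the two sides of the limit. *)
pose a (s x : R) := (s * x + K) / (2 * K).
have K2 : 0 < 2 * K by rewrite mulr_gt0.
have a01 s x : `|s| = 1 -> `|x| <= M -> 0 <= a s x <= 1.
  move=> s1 xM; have := ler_norm (s * x); have := ler_norm (- (s * x)).
  rewrite normrN normrM s1 mul1r => h1 h2.
  rewrite /a ler_pdivlMr// ler_pdivrMr//; apply/andP; split; lra.
have ma d3 (T3 : measurableType d3) (h : T3 -> R) s : measurable_fun setT h ->
    measurable_fun setT (fun t => a s (h t)).
  by move=> mh; apply: measurable_funM => //; apply: measurable_funD => //; exact: measurable_funM.
have Ia d3 (T3 : measurableType d3) (m3 : probability T3 R) (h : T3 -> R) s :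
    measurable_fun setT h -> (forall t, `|h t| <= M) ->
    \int[m3]_t a s (h t) = (s * \int[m3]_t h t + K) / (2 * K).
  move=> mh hM; have ih : m3.-integrable setT (EFin \o h).
    by apply: bddmeas_integrable; split => //; exists M.
  have ic : m3.-integrable setT (EFin \o (fun=> K)) by exact: finite_measure_integrable_cst.
  have ish : m3.-integrable setT (EFin \o (fun t => s * h t)).
    exact: (integrableZl measurableT s ih).
  rewrite RintegralZr//; last exact: (integrableD measurableT ish ic).
  by rewrite RintegralD// RintegralZl// Rintegral_cst1.
apply/cvgrPdist_le => e e0.
have e' : 0 < e / (2 * K) by rewrite divr_gt0.
have p1 : \forall n \near \oo, \int[m2]_t a 1 (g t) - e / (2 * K) <= \int[P]_w a 1 (f n w).
  apply: portmanteau_low => //; [by move=> n; exact: ma|exact: ma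
    |by move=> n w; apply: a01; rewrite ?normr1|by move=> t; apply: a01; rewrite ?normr1|].
  move=> s e1 e10; have := lo (s * (2 * K) - K) e1 e10.
  have E d3 (T3 : measurableType d3) (h : T3 -> R) :
      [set t | s < a 1 (h t)] = [set t | s * (2 * K) - K < h t].
    by apply/seteqP; split=> t /=; rewrite /a ltr_pdivlMr// mul1r ltrBlDr.
  by apply: filterS => n; rewrite !E.
have p2 : \forall n \near \oo, \int[m2]_t a (-1) (g t) - e / (2 * K) <= \int[P]_w a (-1) (f n w).
  apply: portmanteau_low => //; [by move=> n; exact: ma|exact: ma
    |by move=> n w; apply: a01; rewrite ?normrN1|by move=> t; apply: a01; rewrite ?normrN1|].
  move=> s e1 e10; have := hi (K - s * (2 * K)) e1 e10.
  have E d3 (T3 : measurableType d3) (h : T3 -> R) :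
      [set t | s < a (-1) (h t)] = [set t | h t < K - s * (2 * K)].
    apply/seteqP; split=> t /=; rewrite /a ltr_pdivlMr// mulN1r => ?; lra.
  by apply: filterS => n; rewrite !E.
apply: filterS2 p1 p2 => n; rewrite !Ia// -!mulrBl.
rewrite !ler_pM2r ?invr_gt0// ler_norml => h1 h2; apply/andP; split; lra.
Qed.

End Portmanteau.

(** * The Gaussian law *)

Section GaussianDensity.
Context {R : realType}.
Local Notation lam := (@lebesgue_measure R).
Local Notation N01 := (normal_prob (0 : R) 1).
Local Notation pdf := (normal_pdf (0 : R) 1).

(** The Radon-Nikodym derivative of the normal law agrees almost everywhere with [pdf], since both
    have the same integral over every measurable set. *)
Lemma ge0_integral_normal (f : R -> \bar R) : measurable_fun setT f ->
  (forall x, (0 <= f x)%E) ->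
  (\int[N01]_x f x = \int[lam]_x (f x * (pdf x)%:E))%E.
Proof.
move=> mf f0; have dom := normal_prob_dominates (0 : R) 1.
rewrite -(Radon_Nikodym_SigmaFinite.change_of_variables dom f0 measurableT mf).
have mp : measurable_fun setT (fun x => (pdf x)%:E).
  by apply/measurable_EFinP; exact: measurable_normal_pdf.
apply: ae_eq_integral => //.
- apply: emeasurable_funM => //.
  exact: measurable_int (Radon_Nikodym_SigmaFinite.f_integrable dom).
- exact: emeasurable_funM.
apply: ae_eqe_mul2l; apply: integral_ae_eq => //.
  exact: Radon_Nikodym_SigmaFinite.f_integrable.
by move=> E _ mE; rewrite -Radon_Nikodym_SigmaFinite.f_integral.
Qed.

Lemma measurable_affine (a b : R) : measurable_fun setT (fun x : R => a * x + b).
Proof. by apply: measurable_funD => //; exact: measurable_funM. Qed.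

(** The image of Lebesgue measure under the affine map, scaled by [a], gives half-open intervals
    their length, and so is Lebesgue measure. *)
Lemma ge0_integral_affine (a b : R) (f : R -> \bar R) : 0 < a ->
  measurable_fun setT f -> (forall x, (0 <= f x)%E) ->
  (\int[lam]_x f x = a%:E * \int[lam]_x f (a * x + b)%R)%E.
Proof.
move=> a0 mf f0; pose T (x : measurableTypeR R) : measurableTypeR R := a * x + b.
have mT : measurable_fun setT T by exact: measurable_affine.
have := @ge0_integral_pushforward _ _ _ _ R T mT lam setT f measurableT mf.
move=> /(_ (fun y _ => f0 y)); rewrite preimage_setT /= => <-.
have a0' : (0 <= a%:E)%E by rewrite lee_fin ltW.
pose i := isMeasurableFun.Build _ _ _ _ _ mT.
pose Tm : {mfun _ >-> _} := HB.pack T i.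
rewrite -(@ge0_integral_mscale _ _ _ (pushforward lam Tm) setT measurableT (NngNum (ltW a0)))//.
apply: eq_measure_integral => A mA _.
apply: lebesgue_measure_unique => // _ [[u v] _ <-] /=.
rewrite /mscale /=.
have TE : T @^-1` `]u, v] = `](u - b) / a, (v - b) / a]%classic.
  apply/seteqP; split => x; rewrite /= !in_itv/= /T ltr_pdivrMr// ler_pdivlMr//
    ltrBlDr lerBrDr (mulrC x) => //.
rewrite -[pushforward lam T _]/(lam (T @^-1` `]u, v])) TE.
rewrite !lebesgue_measure_itv/= !lte_fin ltr_pM2r ?invr_gt0// ltrD2r.
case: ifPn => uv; last by rewrite mule0.
by rewrite -!EFinB -EFinM; congr EFin; field; rewrite gt_eqF.
Qed.

Lemma ge0_integral_oppr (f : R -> \bar R) :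
  measurable_fun setT f -> (forall x, (0 <= f x)%E) ->
  (\int[lam]_x f x = \int[lam]_x f (- x)%R)%E.
Proof.
move=> mf f0.
have mT : measurable_fun setT (-%R : measurableTypeR R -> measurableTypeR R).
  exact: oppr_measurable.
have := @ge0_integral_pushforward _ _ _ _ R _ mT lam setT f measurableT mf.
move=> /(_ (fun y _ => f0 y)); rewrite preimage_setT /= => <-.
by apply: eq_measure_integral => A mA _; exact/esym/lebesgue_measureN.
Qed.

Lemma pdfE x : pdf x = normal_peak 1 * expR (- (x ^+ 2 / 2)).
Proof.
rewrite normal_pdfE ?oner_neq0//; congr (_ * _).
by rewrite /normal_fun subr0 expr1n mulNr.
Qed.

Lemma pdf_mul (a b u y : R) : 0 < a -> 0 < b ->
  let s := Num.sqrt (a ^+ 2 + b ^+ 2) in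
  pdf (a^-1 * u + - (b / a * y)) * pdf y =
  pdf (s^-1 * u) * pdf (s / a * y + - (b / (s * a) * u)).
Proof.
move=> a0 b0 s.
have s0 : 0 < s by rewrite sqrtr_gt0 addr_gt0// exprn_gt0.
have s2 : s ^+ 2 = a ^+ 2 + b ^+ 2 by rewrite sqr_sqrtr// addr_ge0// sqr_ge0.
rewrite !pdfE mulrACA [RHS]mulrACA -!expRD; congr (_ * expR _).
rewrite -!opprD -!mulrDl; congr (- (_ / _)).
have -> : (a^-1 * u + - (b / a * y)) ^+ 2 + y ^+ 2 =
   (u ^+ 2 - 2 * b * u * y + (a ^+ 2 + b ^+ 2) * y ^+ 2) / a ^+ 2.
  by field; rewrite gt_eqF.
have -> : (s^-1 * u) ^+ 2 + (s / a * y + - (b / (s * a) * u)) ^+ 2 =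
   (u ^+ 2 * ((a ^+ 2 + b ^+ 2) / s ^+ 2) - 2 * b * u * y + s ^+ 2 * y ^+ 2) / a ^+ 2.
  by field; rewrite !gt_eqF.
by rewrite -s2 divff ?mulr1// gt_eqF// exprn_gt0.
Qed.

End GaussianDensity.

(** * Sums of independent normal variables *)

Section GaussianStability.
Context {R : realType}.
Local Notation lam := (@lebesgue_measure R).
Local Notation N01 := (normal_prob (0 : R) 1).
Local Notation pdf := (normal_pdf (0 : R) 1).

Lemma measurable_lin2 (a b : R) :
  measurable_fun setT (fun z : R * R => a * z.1 + b * z.2).
Proof. by apply: measurable_funD; exact: measurable_funM. Qed.

(* Substitute u = a x + b y for x, then complete the square in y by [pdf_mul]. *)
Lemma ge0_normal_stable (a b : R) (f : R -> \bar R) : 0 < a -> 0 < b ->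
  measurable_fun setT f -> (forall x, (0 <= f x)%E) ->
  (\int[N01 \x N01]_z f (a * z.1 + b * z.2)%R =
   \int[N01]_z f (Num.sqrt (a ^+ 2 + b ^+ 2) * z)%R)%E.
Proof.
move=> a0 b0 mf f0; set s := Num.sqrt _.
have s0 : 0 < s by rewrite sqrtr_gt0 addr_gt0// exprn_gt0.
have mp : measurable_fun setT (fun x => (pdf x)%:E).
  by apply/measurable_EFinP; exact: measurable_normal_pdf.
have p0 x : (0 <= (pdf x)%:E)%E by rewrite lee_fin normal_pdf_ge0.
have mpa (c e : R) : measurable_fun setT (fun x : R => (pdf (c * x + e))%:E).
  exact: measurableT_comp mp (measurable_affine c e).
have mfab : measurable_fun setT (fun z : R * R => f (a * z.1 + b * z.2)%R).
  exact: measurableT_comp mf (measurable_lin2 a b).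
have fab0 (z : R * R) : (0 <= f (a * z.1 + b * z.2)%R)%E by exact: f0.
have mG := @measurable_fun_fubini_tonelli_G _ _ _ _ _ N01 _ mfab fab0.
rewrite (@fubini_tonelli2 _ _ _ _ _ N01 N01 _ mfab fab0) /fubini_G /=.
rewrite ge0_integral_normal//; last by move=> y; exact: integral_ge0.
have inner y : (\int[N01]_x f (a * x + b * y)%R =
    a^-1%:E * \int[lam]_u (f u * (pdf (a^-1 * u + - (b / a * y)))%:E))%E.
  rewrite ge0_integral_normal//; last exact: measurableT_comp mf (measurable_affine a _).
  rewrite (@ge0_integral_affine _ a^-1 (- (b / a * y))) ?invr_gt0//; last 2 first.
  - by apply: emeasurable_funM => //; exact: measurableT_comp mf (measurable_affine a _).
  - by move=> x; exact: mule_ge0.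
  congr (_ * _)%E; apply: eq_integral => u _; congr (f _ * _)%E.
  by field; rewrite gt_eqF.
have mk y : measurable_fun setT (fun u => (f u * (pdf (a^-1 * u + - (b / a * y)))%:E)%E).
  exact: emeasurable_funM mf (mpa _ _).
have K0 y u : (0 <= f u * (pdf (a^-1 * u + - (b / a * y)))%:E)%E by exact: mule_ge0.
have mk2 : measurable_fun setT (fun z : R * R =>
    (f z.2 * ((pdf (s^-1 * z.2 + 0))%:E * (pdf (s / a * z.1 + - (b / (s * a) * z.2)))%:E))%E).
  apply: emeasurable_funM; first exact: measurableT_comp mf measurable_snd.
  apply: emeasurable_funM; first exact: measurableT_comp (mpa _ _) measurable_snd.
  apply: (measurableT_comp mp (_ : measurable_fun setT
    (fun z : R * R => s / a * z.1 + - (b / (s * a) * z.2)))).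
  have -> : (fun z : R * R => s / a * z.1 + - (b / (s * a) * z.2)) =
    (fun z => s / a * z.1 + (- (b / (s * a))) * z.2) by apply/funext => z; rewrite mulNr.
  exact: measurable_lin2.
have mk20 (z : R * R) :
  (0 <= f z.2 * ((pdf (s^-1 * z.2 + 0))%:E * (pdf (s / a * z.1 + - (b / (s * a) * z.2)))%:E))%E.
  by rewrite !mule_ge0.
transitivity (a^-1%:E * \int[lam]_y \int[lam]_u
    (f u * ((pdf (s^-1 * u + 0))%:E * (pdf (s / a * y + - (b / (s * a) * u)))%:E)))%E.
  rewrite -ge0_integralZl//; last 3 first.
  - exact: (@measurable_fun_fubini_tonelli_F _ _ _ _ _ lam _ mk2 mk20).
  - by move=> y _; apply: integral_ge0 => u _; rewrite !mule_ge0.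
  - by rewrite lee_fin invr_ge0 ltW.
  apply: eq_integral => y _; rewrite inner -muleA; congr (_ * _)%E.
  rewrite -ge0_integralZr//; last exact: mk.
  apply: eq_integral => u _; rewrite -muleA -!EFinM; congr (_ * _%:E)%E.
  by rewrite addr0 pdf_mul.
have := @fubini_tonelli _ _ _ _ _ lam lam _ mk2 mk20; rewrite /= => ->.
have tot u : (\int[lam]_y (pdf (s / a * y + - (b / (s * a) * u)))%:E = (a / s)%:E)%E.
  have sa0 : 0 < s / a by rewrite divr_gt0.
  have := @ge0_integral_affine _ (s / a) (- (b / (s * a) * u)) _ sa0 mp p0.
  rewrite integral_normal_pdf => e.
  have : ((a / s)%:E * 1 = (a / s)%:E * ((s / a)%:E *
     \int[lam]_y (pdf (s / a * y + - (b / (s * a) * u)))%:E))%E by rewrite -e.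
  rewrite mule1 muleA -EFinM => ->.
  by rewrite (_ : a / s * (s / a) = 1) ?mul1e//; field; rewrite !gt_eqF.
transitivity (s^-1%:E * \int[lam]_u (f u * (pdf (s^-1 * u + 0))%:E))%E.
  rewrite -!ge0_integralZl//; last 6 first.
  - exact: emeasurable_funM mf (mpa _ _).
  - by move=> u _; rewrite mule_ge0.
  - by rewrite lee_fin invr_ge0 ltW.
  - exact: (@measurable_fun_fubini_tonelli_G _ _ _ _ _ lam _ mk2 mk20).
  - by move=> u _; apply: integral_ge0 => y _; rewrite !mule_ge0.
  - by rewrite lee_fin invr_ge0 ltW.
  apply: eq_integral => u _.
  under eq_integral do rewrite muleA.
  rewrite ge0_integralZl ?mule_ge0//; last exact: mpa.
  rewrite tot muleCA -EFinM (_ : a^-1 * (a / s) = s^-1) 1?muleC//.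
  by field; rewrite !gt_eqF.
have mfs : measurable_fun setT (fun z => f (s * z)).
  exact: measurableT_comp mf (mulrl_measurable s).
rewrite ge0_integral_normal//.
rewrite [RHS](@ge0_integral_affine _ s^-1 0) ?invr_gt0//; last 2 first.
- exact: emeasurable_funM.
- by move=> x; rewrite mule_ge0.
congr (_ * _)%E; apply: eq_integral => u _; congr (f _ * _)%E.
by rewrite addr0 mulrA divff ?mul1r// gt_eqF.
Qed.

Lemma bdd_same_law d1 d2 (T1 : measurableType d1) (T2 : measurableType d2)
  (m1 : probability T1 R) (m2 : probability T2 R) (U : T1 -> R) (V : T2 -> R) :
  measurable_fun setT U -> measurable_fun setT V ->
  (forall f : R -> \bar R, measurable_fun setT f -> (forall x, (0 <= f x)%E) ->
     (\int[m1]_t f (U t) = \int[m2]_t f (V t))%E) ->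
  forall h, bddmeas h -> \int[m1]_t h (U t) = \int[m2]_t h (V t).
Proof.
move=> mU mV UV h [mh [M hM]].
(* Adding the bound [M] makes the integrand nonnegative, so that the hypothesis applies. *)
have shift d3 (T3 : measurableType d3) (m3 : probability T3 R) (W : T3 -> R) :
    measurable_fun setT W ->
    \int[m3]_t h (W t) = \int[m3]_t (h (W t) + M) - M.
  move=> mW; rewrite RintegralD//; first by rewrite Rintegral_cst1 addrK.
    apply: bddmeas_integrable; split; first exact: measurableT_comp.
    by exists M => t; exact: hM.
  exact: finite_measure_integrable_cst.
rewrite !shift//; congr (_ - _); rewrite /Rintegral.
congr fine; apply: (UV (fun x => (h x + M)%:E)).
  by apply/measurable_EFinP; exact: measurable_funD.
by move=> x; rewrite lee_fin -lerBlDr sub0r; have := hM x; rewrite ler_norml => /andP[].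
Qed.

Lemma normal_stable (a b : R) h : 0 < a -> 0 < b -> bddmeas h ->
  \int[N01]_y \int[N01]_x h (a * x + b * y) =
  \int[N01]_z h (Num.sqrt (a ^+ 2 + b ^+ 2) * z).
Proof.
move=> a0 b0 bh.
have bh2 : bddmeas (fun z : R * R => h (a * z.1 + b * z.2)).
  have [mh [M hM]] := bh; split; last by exists M => z; exact: hM.
  exact: measurableT_comp mh (measurable_lin2 a b).
have := bdd_fubini2 N01 N01 bh2; rewrite /= => ->.
apply: (bdd_same_law (m1 := (N01 \x N01)%E) (m2 := N01)) bh.
- exact: measurable_lin2.
- exact: measurable_funM.
- by move=> f mf f0; exact: ge0_normal_stable.
Qed.

End GaussianStability.

(** * Moments of the standard normal law *)

Section GaussianMoments.
Context {R : realType}.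
Local Notation lam := (@lebesgue_measure R).
Local Notation N01 := (normal_prob (0 : R) 1).
Local Notation pdf := (normal_pdf (0 : R) 1).

Definition gexp (x : R) : R := expR (- (x ^+ 2 / 2)).

Lemma is_derive_gexp (x : R) : is_derive x (1 : R) (fun x : R => - (x * gexp x)) ((x ^+ 2 - 1) * gexp x).
Proof.
rewrite /gexp; apply: is_derive_eq.
by rewrite -![_ *: _]/(_ * _); field.
Qed.

Lemma continuous_gexp : continuous gexp.
Proof.
move=> x; apply: (cvg_comp _ expR); last exact: continuous_expR.
apply: (@cvgN _ R^o); apply: cvgM; last exact: cvg_cst.
exact: sqr_continuous.
Qed.

Lemma cvg_gexp : - (x * gexp x) @[x --> +oo] --> (0 : R).
Proof.
apply/cvgrPdist_le => e e0; near=> x.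
have x0 : 0 < x by near: x; exact: nbhs_pinfty_gt.
have g0 : 0 <= gexp x by exact: expR_ge0.
rewrite sub0r opprK ger0_norm; last by rewrite mulr_ge0// ltW.
rewrite /gexp expRN -[leLHS]/(x / expR (x ^+ 2 / 2)) ler_pdivrMr ?expR_gt0//.
have h := expR_ge1Dx (x ^+ 2 / 2).
(* From here on [x] is at most [e * (x ^+ 2 / 2)], and the exponential dominates [x ^+ 2 / 2]. *)
have xe : 2 / e <= x by near: x; apply: nbhs_pinfty_ge; rewrite num_real.
rewrite ler_pdivrMr// in xe.
have h3 : e * (x ^+ 2 / 2) <= e * expR (x ^+ 2 / 2) by rewrite ler_pM2l//; lra.
apply: le_trans h3; rewrite expr2; nra.
Unshelve. all: by end_near. Qed.

Lemma integral_gexp_tail :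
  (\int[lam]_(x in `[1%R, +oo[) ((x ^+ 2 - 1) * gexp x)%:E = (gexp 1)%:E)%E.
Proof.
have der := is_derive_gexp.
rewrite (@ge0_continuous_FTC2y _ _ (fun x => - (x * gexp x)) 1 0).
- by rewrite mul1r -EFinB sub0r opprK.
- by move=> x x1; rewrite mulr_ge0 ?subr_ge0 ?exprn_ege1//; exact: expR_ge0.
- apply: continuous_subspaceT => x; apply: cvgM; last exact: continuous_gexp.
  by apply: (@cvgB _ R^o); [exact: sqr_continuous|exact: cvg_cst].
- exact: cvg_gexp.
- by move=> x _; have [] := der x.
- apply: cvg_at_right_filter; apply: (@cvgN _ R^o); apply: cvgM; [exact: cvg_id|exact: continuous_gexp].
- by move=> x _; rewrite derive1E; exact: (@derive_val _ _ _ _ _ _ _ (der x)).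
Qed.

Lemma integral_gexp_head :
  (\int[lam]_(x in `[0%R, 1%R]) ((1 - x ^+ 2) * gexp x)%:E = (gexp 1)%:E)%E.
Proof.
have der (x : R) : is_derive x (1 : R) (fun x : R => x * gexp x) ((1 - x ^+ 2) * gexp x).
  rewrite /gexp; apply: is_derive_eq.
  by rewrite -![_ *: _]/(_ * _); field.
have cx : continuous (fun x : R => x * gexp x).
  by move=> x; apply: cvgM; [exact: cvg_id|exact: continuous_gexp].
rewrite (@continuous_FTC2 _ _ (fun x => x * gexp x) 0 1)//.
- by rewrite mul1r mul0r -EFinB subr0.
- apply: continuous_subspaceT => x; apply: cvgM; last exact: continuous_gexp.
  by apply: (@cvgB _ R^o); [exact: cvg_cst|exact: sqr_continuous].
- split; first by move=> x _; have [] := der x.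
  + exact/cvg_at_right_filter/cx.
  + exact/cvg_at_left_filter/cx.
- by move=> x _; rewrite derive1E; exact: (@derive_val _ _ _ _ _ _ _ (der x)).
Qed.

(* [(x ^+ 2 - 1) * gexp x] has the primitive [- x * gexp x]; splitting the
   half-line at 1, where it changes sign, keeps all the integrals nonnegative. *)
Lemma integral_sqr_gexp :
  (\int[lam]_x (x ^+ 2 * gexp x)%:E = \int[lam]_x (gexp x)%:E)%E.
Proof.
have mg : measurable_fun setT gexp by exact: continuous_measurable_fun continuous_gexp.
have mx2g : measurable_fun setT (fun x : R => x ^+ 2 * gexp x).
  by apply: measurable_funM => //; exact: measurable_funX.
have cx2g : continuous (fun x : R => x ^+ 2 * gexp x).
  by move=> x; apply: cvgM; [exact: sqr_continuous|exact: continuous_gexp].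
have g0 x : 0 <= gexp x by exact: expR_ge0.
have x2g0 x : 0 <= x ^+ 2 * gexp x by rewrite mulr_ge0// sqr_ge0.
rewrite !ge0_symfun_integralT//; last 3 first.
- by move=> x; rewrite /gexp /= sqrrN.
- exact: continuous_gexp.
- by move=> x; rewrite /gexp /= sqrrN.
congr (_ * _)%E; rewrite -set_itvcy.
have -> : `[(0 : R), +oo[%classic = `[0, 1[ `|` `[1, +oo[.
  by rewrite -itv_bndbnd_setU// bnd_simp.
have dis : [disjoint `[(0 : R), 1[ & `[1, +oo[].
  by apply/disj_set2P/seteqP; split => x //= []; rewrite !in_itv/= andbT => /andP[_ h1] h2; lra.
rewrite !ge0_integral_setU//; last 4 first.
- by apply/measurable_EFinP; apply: measurable_funTS.
- by move=> x _; rewrite lee_fin.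
- by apply/measurable_EFinP; apply: measurable_funTS.
- by move=> x _; rewrite lee_fin.
have bc (f : R -> R) : measurable_fun setT f ->
   (\int[lam]_(x in `[0%R, 1%R[) (f x)%:E = \int[lam]_(x in `[0%R, 1%R]) (f x)%:E)%E.
  by move=> mf; rewrite integral_itv_bndo_bndc//; apply/measurable_EFinP; exact: measurable_funTS.
rewrite !bc//.
have h1 : (\int[lam]_(x in `[0%R, 1%R]) (gexp x)%:E =
   \int[lam]_(x in `[0%R, 1%R]) (x ^+ 2 * gexp x)%:E + (gexp 1)%:E)%E.
  rewrite -integral_gexp_head -ge0_integralD//.
  - by apply: eq_integral => x _; rewrite -EFinD; congr EFin; ring.
  - by move=> x _; rewrite lee_fin.
  - by apply/measurable_EFinP; apply: measurable_funTS.
  - move=> x /=; rewrite in_itv/= => /andP[x0 x1].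
    by rewrite lee_fin mulr_ge0// subr_ge0 exprn_ile1.
  - apply/measurable_EFinP; apply: measurable_funTS; apply: measurable_funM => //.
    by apply: measurable_funB => //; exact: measurable_funX.
have h2 : (\int[lam]_(x in `[1%R, +oo[) (x ^+ 2 * gexp x)%:E =
   \int[lam]_(x in `[1%R, +oo[) (gexp x)%:E + (gexp 1)%:E)%E.
  rewrite -integral_gexp_tail -ge0_integralD//.
  - by apply: eq_integral => x _; rewrite -EFinD; congr EFin; ring.
  - by move=> x _; rewrite lee_fin.
  - by apply/measurable_EFinP; apply: measurable_funTS.
  - move=> x /=; rewrite in_itv/= andbT => x1.
    by rewrite lee_fin mulr_ge0// subr_ge0 exprn_ege1.
  - apply/measurable_EFinP; apply: measurable_funTS; apply: measurable_funM => //.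
    by apply: measurable_funB => //; exact: measurable_funX.
by rewrite h1 h2 addeA addeAC -addeA.
Qed.

Lemma integral_sqr_normal : (\int[N01]_x (x ^+ 2)%:E = 1)%E.
Proof.
rewrite ge0_integral_normal; last 2 first.
- by apply/measurable_EFinP; exact: measurable_funX.
- by move=> x; rewrite lee_fin sqr_ge0.
have mg : measurable_fun setT gexp by exact: continuous_measurable_fun continuous_gexp.
rewrite -(integral_normal_pdf (0 : R) 1).
transitivity ((normal_peak (1 : R))%:E * \int[lam]_x (x ^+ 2 * gexp x)%:E)%E.
  rewrite -ge0_integralZl//; last 3 first.
  - by apply/measurable_EFinP; apply: measurable_funM => //; exact: measurable_funX.
  - by move=> x _; rewrite lee_fin mulr_ge0 ?sqr_ge0//; exact: expR_ge0.
  - by rewrite lee_fin normal_peak_ge0.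
  by apply: eq_integral => x _; rewrite -!EFinM pdfE mulrCA.
rewrite integral_sqr_gexp -ge0_integralZl//; last 3 first.
- by apply/measurable_EFinP.
- by move=> x _; rewrite lee_fin; exact: expR_ge0.
- by rewrite lee_fin normal_peak_ge0.
by apply: eq_integral => x _; rewrite -EFinM pdfE.
Qed.

Lemma integrable_sqr_normal : N01.-integrable setT (fun x => (x ^+ 2)%:E).
Proof.
apply/integrableP; split; first by apply/measurable_EFinP; exact: measurable_funX.
under eq_integral do rewrite gee0_abs ?lee_fin ?sqr_ge0//.
by rewrite integral_sqr_normal ltry.
Qed.

Lemma integrable_id_normal : N01.-integrable setT (fun x => x%:E).
Proof.
apply: (@le_integrable _ _ _ N01 setT measurableT _ (fun x => 1 + (x ^+ 2)%:E)%E).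
- exact/measurable_EFinP.
- move=> x _; rewrite /= lee_fin [leRHS]ger0_norm ?addr_ge0 ?sqr_ge0//.
  rewrite ler_norml expr2; apply/andP; split; nra.
- apply: integrableD => //; last exact: integrable_sqr_normal.
  exact: finite_measure_integrable_cst.
Qed.

Lemma Rint_sqr_normal : \int[N01]_x (x ^+ 2) = 1.
Proof. by rewrite /Rintegral integral_sqr_normal. Qed.

(** The density is even, so the positive and negative parts of the identity have the same finite
    integral. *)
Lemma Rint_id_normal : \int[N01]_x x = 0.
Proof.
have e (f : R -> \bar R) : measurable_fun setT f -> (forall x, (0 <= f x)%E) ->
    (\int[N01]_x f x = \int[N01]_x f (- x)%R)%E.
  move=> mf f0; have mfo : measurable_fun setT (fun x : R => f (- x)).
    by apply: (measurableT_comp mf); exact: oppr_measurable.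
  have mp : measurable_fun setT (fun x => (pdf x)%:E).
    by apply/measurable_EFinP; exact: measurable_normal_pdf.
  rewrite !ge0_integral_normal// ge0_integral_oppr.
  - by apply: eq_integral => x _; rewrite !pdfE sqrrN.
  - exact: emeasurable_funM.
  - by move=> x; rewrite mule_ge0// lee_fin normal_pdf_ge0.
rewrite /Rintegral integralE (e (fun x => (EFin \o id)^\+ x)%E)//.
  rewrite [X in (X - _)%E](_ : _ = (\int[N01]_x (fun x : R => x%:E)^\- x)%E).
    rewrite subee//.
    exact: integrable_fin_num (integrable_funeneg measurableT integrable_id_normal).
  by apply: eq_integral => x _; rewrite funeposE funenegE /= EFinN.
by apply: measurable_funepos; exact/measurable_EFinP.
Qed.

End GaussianMoments.

(** * Normal vectors in the plane *)

Section PlaneGaussian.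
Context {R : realType}.
Local Notation N01 := (normal_prob (0 : R) 1).
Local Notation N2 := (N01 \x N01)%E.

Lemma Rint_prod2 (f g : R -> R) :
  N01.-integrable setT (EFin \o f) -> N01.-integrable setT (EFin \o g) ->
  N2.-integrable setT (fun z => (f z.1 * g z.2)%:E) /\
  \int[N2]_z (f z.1 * g z.2) = \int[N01]_x f x * \int[N01]_x g x.
Proof.
move=> if_ ig.
have mf : measurable_fun setT f by apply/measurable_EFinP; exact: measurable_int if_.
have mg : measurable_fun setT g by apply/measurable_EFinP; exact: measurable_int ig.
have mfg : measurable_fun setT (fun z : R * R => (f z.1 * g z.2)%:E).
  apply/measurable_EFinP; apply: measurable_funM.
    exact: measurableT_comp mf measurable_fst.
  exact: measurableT_comp mg measurable_snd.
have i2 : N2.-integrable setT (fun z => (f z.1 * g z.2)%:E).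
  apply/(integrable12ltyP N01 N01 mfg) => /=.
  have [_ fg1] := integrableP _ _ _ if_; have [_ fg2] := integrableP _ _ _ ig.
  rewrite (_ : (\int[_]_x _)%E = \int[N01]_x (`|f x|%:E * \int[N01]_y `|g y|%:E))%E; last first.
    apply: eq_integral => x _; rewrite -ge0_integralZl//; last first.
      by apply/measurable_EFinP; exact: measurableT_comp.
    by apply: eq_integral => y _; rewrite normrM EFinM.
  rewrite ge0_integralZr//; last 2 first.
    by apply/measurable_EFinP; exact: measurableT_comp.
    by apply: integral_ge0 => y _; rewrite lee_fin.
  by rewrite lte_mul_pinfty// ?integral_ge0// ge0_fin_numE ?integral_ge0.
split => //; rewrite /Rintegral -(integral12_prod_meas1 i2) /fubini_F /=.
rewrite (_ : (\int[_]_x _)%E = \int[N01]_x (f x * \int[N01]_y g y)%:E)%E; last first.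
  apply: eq_integral => x _; rewrite EFinM.
  rewrite /Rintegral fineK; last exact: integrable_fin_num ig.
  rewrite -(integralZl measurableT ig).
  by apply: eq_integral => y _; rewrite EFinM.
exact: (RintegralZr _ measurableT if_).
Qed.

Let i1 : N01.-integrable setT (EFin \o cst (1 : R)) := finite_measure_integrable_cst _ _ measurableT.

Lemma integrable_norm1_plane :
  N2.-integrable setT (fun z => (norm1 z ^+ 2)%:E).
Proof.
have [j1 _] := Rint_prod2 (@integrable_sqr_normal R) i1.
have [j2 _] := Rint_prod2 i1 (@integrable_sqr_normal R).
have j := integrableZl measurableT 2 (integrableD measurableT j1 j2).
apply: (le_integrable measurableT _ _ j).
  apply/measurable_EFinP; apply: measurable_funX.
  by apply: measurable_funD; exact: measurableT_comp.
move=> z _; rewrite /= lee_fin mulr1 mul1r !ger0_norm; last 2 first.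
- by rewrite mulr_ge0// addr_ge0// sqr_ge0.
- by rewrite exprn_ge0// norm1_ge0.
rewrite /norm1 sqrrD !real_normK ?num_real// -[X in _ + X *+ 2 + _]normrM mulr2n.
have : `|z.1 * z.2| <= (z.1 ^+ 2 + z.2 ^+ 2) / 2.
  rewrite ler_norml; have := sqr_ge0 (z.1 + z.2); have := sqr_ge0 (z.1 - z.2).
  by rewrite !sqrrD sqrrN !mulrN !mulNrn => *; apply/andP; split; lra.
by move=> ?; lra.
Qed.

Lemma Rint_plane_lin1 (p q : R) : \int[N2]_z (p * z.1 + q * z.2) = 0.
Proof.
have [j1 e1] := Rint_prod2 (@integrable_id_normal R) i1.
have [j2 e2] := Rint_prod2 i1 (@integrable_id_normal R).
have k1 := integrableZl measurableT p j1; have k2 := integrableZl measurableT q j2.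
rewrite Rint_id_normal mul0r in e1; rewrite Rint_id_normal mulr0 in e2.
transitivity (\int[N2]_z (p * (z.1 * 1) + q * (1 * z.2))).
  by apply: eq_Rintegral => z _; rewrite mulr1 mul1r.
rewrite (RintegralD measurableT k1 k2) (RintegralZl p measurableT j1).
by rewrite (RintegralZl q measurableT j2) e1 e2 !mulr0 addr0.
Qed.

Lemma Rint_plane_quad (p q r : R) :
  \int[N2]_z (p * z.1 ^+ 2 + q * (z.1 * z.2) + r * z.2 ^+ 2) = p + r.
Proof.
have [j1 e1] := Rint_prod2 (@integrable_sqr_normal R) i1.
have [j2 e2] := Rint_prod2 i1 (@integrable_sqr_normal R).
have [j3 e3] := Rint_prod2 (@integrable_id_normal R) (@integrable_id_normal R).
have k1 := integrableZl measurableT p j1; have k2 := integrableZl measurableT r j2.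
have k3 := integrableZl measurableT q j3.
have c1 : \int[N01]_x (1 : R) = 1 by rewrite Rintegral_cst1.
rewrite Rint_sqr_normal /= c1 mul1r in e1; rewrite Rint_sqr_normal /= c1 mulr1 in e2.
rewrite Rint_id_normal mulr0 in e3.
transitivity (\int[N2]_z (p * (z.1 ^+ 2 * 1) + q * (z.1 * z.2) + r * (1 * z.2 ^+ 2))).
  by apply: eq_Rintegral => z _; rewrite mulr1 mul1r.
rewrite (RintegralD measurableT (integrableD measurableT k1 k3) k2).
rewrite (RintegralD measurableT k1 k3) (RintegralZl p measurableT j1).
by rewrite (RintegralZl r measurableT j2) (RintegralZl q measurableT j3) e1 e2 e3 mulr0 addr0 !mulr1.
Qed.

Variable A : 'M[R]_2.

Lemma measurable_plane_lin : measurable_fun setT (plane_lin A).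
Proof. by apply/measurable_fun_pairP; split; exact: measurable_lin2. Qed.

Lemma integrable_plane_lin :
  N2.-integrable setT (fun z => (norm1 (plane_lin A z) ^+ 2)%:E).
Proof.
pose K := `|A 0 0| + `|A 0 1| + `|A 1 0| + `|A 1 1|.
apply: (@integrable_dom _ _ _ N2 id integrable_norm1_plane _ (K ^+ 2)).
  apply: measurable_funX; exact: measurable_norm1 measurable_plane_lin.
move=> z; rewrite ger0_norm ?exprn_ge0 ?norm1_ge0//.
apply: (@le_trans _ _ ((K * norm1 z) ^+ 2)); last first.
  by rewrite exprMn ler_wpM2l ?sqr_ge0// lerDr.
apply: lerXn2r; rewrite ?nnegrE ?mulr_ge0 ?norm1_ge0 ?addr_ge0//.
rewrite /norm1 /=; apply: le_trans (lerD (ler_normD _ _) (ler_normD _ _)) _.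
rewrite !normrM /K.
have [a0 b0] : 0 <= `|z.1| /\ 0 <= `|z.2| by [].
have [c0 [d0 [e0 f0]]] : [/\ 0 <= `|A 0 0|, 0 <= `|A 0 1| & 0 <= `|A 1 0| /\ 0 <= `|A 1 1|] by [].
move: `|z.1| `|z.2| `|A 0 0| `|A 0 1| `|A 1 0| `|A 1 1| a0 b0 c0 d0 e0 f0 => a b c d e f *.
have := mulr_ge0 (ltac:(eassumption) : 0 <= c) (ltac:(eassumption) : 0 <= b).
nra.
Qed.

(** For a standard normal t this is a normal vector on the line through [v]. A vector A Z is the sum
    of two such, along the columns of [A], which brings stability back to the real line even for
    singular [A]. *)
Definition shift_line (v : R * R) (c t : R) : R * R := (c * t * v.1, c * t * v.2).

Lemma measurable_shift_line v c : measurable_fun setT (shift_line v c).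
Proof.
by apply/measurable_fun_pairP; split; apply: measurable_funM => //; exact: measurable_funM.
Qed.

Lemma avg_line_stable v (a b : R) f : 0 < a -> 0 < b -> bddmeas f ->
  avg N01 (shift_line v b) (avg N01 (shift_line v a) f) =
  avg N01 (shift_line v (Num.sqrt (a ^+ 2 + b ^+ 2))) f.
Proof.
move=> a0 b0 bf; apply/funext => x; rewrite /avg.
pose h t := f (x + shift_line v 1 t).
have bh : bddmeas h := bddmeas_avg_in (measurable_shift_line v 1) x bf.
rewrite -[RHS]/(\int[N01]_t f (x + shift_line v _ t)).
transitivity (\int[N01]_y \int[N01]_z h (a * z + b * y)).
  apply: eq_Rintegral => y _; apply: eq_Rintegral => z _; rewrite /h -addrA; congr (f (x + _)).
  by rewrite /shift_line /=; congr pair; rewrite /=; ring.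
rewrite normal_stable//; apply: eq_Rintegral => z _; rewrite /h /shift_line.
by rewrite !mul1r.
Qed.

Lemma iter_avg_line v (c : R) n f : 0 < c -> bddmeas f ->
  iter n.+1 (avg N01 (shift_line v c)) f = avg N01 (shift_line v (Num.sqrt n.+1%:R * c)) f.
Proof.
move=> c0 bf; elim: n => [|n IH]; first by rewrite /= sqrtr1 mul1r.
rewrite iterS IH avg_line_stable//; last by rewrite mulr_gt0// sqrtr_gt0.
rewrite (_ : Num.sqrt ((Num.sqrt n.+1%:R * c) ^+ 2 + c ^+ 2) = Num.sqrt n.+2%:R * c)//.
rewrite exprMn sqr_sqrtr// -[X in _ + X]mul1r -mulrDl natr1.
by rewrite sqrtrM// sqrtr_sqr ger0_norm// ltW.
Qed.

Let col1 : R * R := (A 0 0, A 1 0).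
Let col2 : R * R := (A 0 1, A 1 1).

Lemma avg_plane_lin c f : bddmeas f ->
  avg N2 (scale2 c \o plane_lin A) f =
  avg N01 (shift_line col1 c) (avg N01 (shift_line col2 c) f).
Proof.
move=> bf; apply/funext => x; rewrite /avg.
have b := bddmeas_avg_in (measurable_scale2 measurable_plane_lin c) x bf.
rewrite -(bdd_fubini1 N01 N01 b).
apply: eq_Rintegral => y _; apply: eq_Rintegral => z _; rewrite -addrA; congr (f (x + _)).
by rewrite /shift_line /scale2 /plane_lin /=; congr pair; rewrite /=; ring.
Qed.

(** Averages along the two columns commute, so the n steps can be sorted by column; along each
    column, n steps of size n^(-1/2) compose to one of size 1. *)
Lemma plane_lin_stable n f : (0 < n)%N -> bddmeas f ->
  iter n (avg N2 (scale2 (Num.sqrt n%:R)^-1 \o plane_lin A)) f 0 =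
  \int[N2]_z f (plane_lin A z).
Proof.
case: n => // n _ bf; set c := _^-1.
have c0 : 0 < c by rewrite invr_gt0 sqrtr_gt0.
have m1 := measurable_shift_line col1 c; have m2 := measurable_shift_line col2 c.
have it k : iter k (avg N2 (scale2 c \o plane_lin A)) f =
  iter k (avg N01 (shift_line col1 c)) (iter k (avg N01 (shift_line col2 c)) f).
  elim: k => // k IH; rewrite iterS IH avg_plane_lin; last first.
    by apply: bddmeas_iter_avg => //; exact: bddmeas_iter_avg.
  rewrite !iterS; congr (avg _ _ _).
  exact: (@iter_avgC _ _ _ _ _ N01 N01 _ _ m2 m1 k _ (bddmeas_iter_avg N01 m2 k bf)).
rewrite it (iter_avg_line _ _ c0 bf).
rewrite (iter_avg_line _ _ c0 (bddmeas_avg N01 (measurable_shift_line _ _) bf)).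
rewrite divff ?gt_eqF ?sqrtr_gt0// -avg_plane_lin// /avg.
apply: eq_Rintegral => z _; congr f.
by rewrite add0r /scale2 /= !mul1r.
Qed.

End PlaneGaussian.

(** * Barycenters *)

Section FoldedPairs.
Context {R : realType}.

Lemma sin_le_norm (x : R) : `|sin x| <= `|x|.
Proof.
wlog x0 : x / 0 <= x.
  move=> h; have [/h//|x0] := leP 0 x.
  by rewrite -normrN -sinN -[leRHS]normrN; apply: h; rewrite oppr_ge0 ltW.
have [c _] := @MVT_segment R sin cos 0 x x0 (fun t _ => is_derive_sin t)
  (continuous_subspaceT (@continuous_sin R)).
rewrite sin0 !subr0 => ->; rewrite normrM ler_piMl// cos_max //.
Qed.

Lemma one_sub_cos (x : R) : 2 - 2 * cos x <= x ^+ 2.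
Proof.
have := cos_mulr2n (x / 2); have -> : x / 2 *+ 2 = x by [rewrite mulr2n; lra].
move=> ->.
have := sin_le_norm (x / 2).
rewrite -ler_sqr ?nnegrE// !real_normK ?num_real// sin2cos2 => h.
have -> : x ^+ 2 = 4 * (x / 2) ^+ 2 by field.
by rewrite [cos _ ^+ 2 *+ 2]mulr2n; lra.
Qed.

Variable alpha : R.
Hypothesis halpha : 2 * pi < alpha.
Implicit Types (t b : circle alpha) (M : circle alpha -> R).

Lemma fcos_angle_near (x : R) : 2 - 2 * fcos (angle alpha x) <= x ^+ 2.
Proof.
have [h|h] := leP `|x| pi; first by rewrite fcos_angle// one_sub_cos.
apply: (@le_trans _ _ (2 ^+ 2)).
  have := fcos_geN1 (angle alpha x); rewrite expr2; lra.
rewrite -[leRHS]real_normK ?num_real// lerXn2r ?nnegrE//.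
have := @pi_ge2 R; lra.
Qed.

(** [M2] plays the part of the derivative of [M1]: the graph of [M1] lies below the folded sinusoid
    with the same value and slope at t. The Lipschitz clause replaces differentiability in
    limits. *)
Definition folded_pair M1 M2 : Prop :=
  (forall t b, M1 (t + b) <= fcos b * M1 t + fsin b * M2 t) /\
  exists k : R, forall t x, `|M1 (t + angle alpha x) - M1 t| <= k * `|x| /\
                            `|M2 (t + angle alpha x) - M2 t| <= k * `|x|.

Lemma le_eps_lin (u k : R) : (forall x, 0 < x < 1 -> u <= k * x) -> u <= 0.
Proof.
move=> h; rewrite leNgt; apply/negP => u0.
have k0 : 0 < `|k| + 1 by rewrite ltr_wpDl.
pose x := Num.min (2^-1) (u / (2 * (`|k| + 1))).
have x0 : 0 < x by rewrite lt_min invr_gt0 ltr0n /= divr_gt0// mulr_gt0.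
have x1 : x < 1 by rewrite gt_min invf_lt1 ?ltr1n.
have x2 : x <= u / (2 * (`|k| + 1)) by rewrite ge_min lexx orbT.
have := h x; rewrite x0 x1 => /(_ isT) ukx.
have : k * x <= (`|k| + 1) * x by rewrite ler_wpM2r ?(ltW x0)//; have := ler_norm k; lra.
rewrite ler_pdivlMr ?mulr_gt0// in x2; lra.
Qed.

(** The derivative vanishes at a maximum. Using the inequality from the base point t + x back to t,
    maximality gives [M2 (t + x) <= 0] for small x > 0; the Lipschitz bound lets x tend to 0, and
    the base point t - x gives the other sign. *)
Lemma folded_pair_max0 M1 M2 t : folded_pair M1 M2 -> 0 <= M1 t ->
  (forall t', M1 t' <= M1 t) -> M2 t = 0.
Proof.
move=> [K [k L]] M0 Mt.
have near (x : R) : 0 < x < 1 -> [/\ `|x| <= pi, 0 < sin x & 0 <= cos x <= 1].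
  move=> /andP[x0 x1]; have p2 := @pi_ge2 R.
  split; first by rewrite ger0_norm ?ltW//; lra.
    by apply: sin_gt0_pi; lra.
  by rewrite cos_le1 andbT; apply: cos_ge0_pihalf; lra.
apply/eqP; rewrite eq_le; apply/andP; split.
- apply: (@le_eps_lin _ k) => x x01; have [xp s0 /andP[c0 c1]] := near x x01.
  have := K (t + angle alpha x) (angle alpha (- x)).
  rewrite -addrA -angleD subrr angle0 addr0 (fcos_angle halpha) ?normrN//.
  rewrite (fsin_angle halpha) ?normrN// cosN sinN.
  have [_] := L t x; rewrite ler_norml => /andP[l1 l2].
  move: l1 l2; have := Mt (t + angle alpha x).
  move: (M1 _) (M2 (t + _)) => m m2 mt l1 l2 h.
  have : cos x * m <= M1 t.
    by apply: (@le_trans _ _ (cos x * M1 t)); [rewrite ler_wpM2l|rewrite ler_piMl].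
  move=> h'; have : sin x * m2 <= 0 by lra.
  by rewrite pmulr_rle0// => m20; move: l1; rewrite gtr0_norm; [lra|case/andP: x01].
- rewrite -oppr_le0; apply: (@le_eps_lin _ k) => x x01; have [xp s0 /andP[c0 c1]] := near x x01.
  have := K (t + angle alpha (- x)) (angle alpha x).
  rewrite -addrA -angleD addNr angle0 addr0 (fcos_angle halpha)// (fsin_angle halpha)//.
  have [_] := L t (- x); rewrite ler_norml normrN => /andP[l1 l2].
  move: l1 l2; have := Mt (t + angle alpha (- x)).
  move: (M1 _) (M2 (t + _)) => m m2 mt l1 l2 h.
  have : cos x * m <= M1 t.
    by apply: (@le_trans _ _ (cos x * M1 t)); [rewrite ler_wpM2l|rewrite ler_piMl].
  move=> h'; have : 0 <= sin x * m2 by lra.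
  by rewrite pmulr_rge0// => m20; move: l2; rewrite gtr0_norm; [lra|case/andP: x01].
Qed.

Lemma folded_pair_le_max M1 M2 t : folded_pair M1 M2 -> 0 <= M1 t ->
  (forall t', M1 t' <= M1 t) -> forall t', M1 t' <= M1 t * fcos (t' - t).
Proof.
move=> fp M0 Mt t'; have [K _] := fp.
have := K t (t' - t); rewrite (folded_pair_max0 fp M0 Mt) mulr0 addr0 mulrC.
by rewrite addrC subrK.
Qed.

Lemma continuous_lip (f : R -> R) (k : R) :
  (forall x y, `|f (x + y) - f x| <= k * `|y|) -> continuous f.
Proof.
move=> fk x; apply/cvgrPdist_le => e e0.
have k0 : 0 < `|k| + 1 by rewrite ltr_wpDl.
near=> y.
have -> : y = x + (y - x) by rewrite addrC subrK.
rewrite distrC; apply: le_trans (fk _ _) _.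
have h : `|y - x| <= e / (`|k| + 1).
  rewrite distrC; near: y; apply: (@cvgr_dist_le _ _ _ _ _ id) => //; rewrite divr_gt0//.
rewrite ler_pdivlMr// in h.
have : k * `|y - x| <= (`|k| + 1) * `|y - x|.
  by rewrite ler_wpM2r//; have := ler_norm k; lra.
by move: (`|y - x|) h => *; lra.
Unshelve. all: by end_near. Qed.

Lemma folded_pair_continuous M1 M2 t : folded_pair M1 M2 ->
  continuous (fun x : R => M1 (t + angle alpha x)).
Proof.
move=> [_ [k L]]; apply: (@continuous_lip _ k) => x y.
by rewrite angleD addrA; have [] := L (t + angle alpha x) y.
Qed.

Lemma folded_pair_argmax M1 M2 : folded_pair M1 M2 -> exists t, forall t', M1 t' <= M1 t.
Proof.
move=> fp; have a0 := alpha_gt0 halpha.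
have c := continuous_subspaceT (folded_pair_continuous (t := 0) fp).
have a2 : - (alpha / 2) <= alpha / 2 by lra.
have [x _ hx] := EVT_max a2 (c _).
exists (0 + angle alpha x) => t'; have [y hy ->] := angle_rep_half halpha t'.
by have := hx y; rewrite !add0r in_itv/= -ler_norml hy; apply.
Qed.

(** The upper bound is the inequality based at t. For the lower one, the inequality is based at t +
    x and aimed at the two endpoints, where the values are known. *)
Lemma folded_pair_between M1 M2 t (rho : R) : folded_pair M1 M2 -> 0 <= rho < pi / 2 ->
  M1 (t + angle alpha rho) = cos rho * M1 t + sin rho * M2 t ->
  M1 (t + angle alpha (- rho)) = cos rho * M1 t - sin rho * M2 t ->
  forall x, - rho <= x <= rho ->
    M1 (t + angle alpha x) = cos x * M1 t + sin x * M2 t.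
Proof.
move=> [K _] /andP[r0 rpi] e1 e2 x /andP[x1 x2].
have p2 := @pi_ge2 R.
have [rho0|rho0] := eqVneq rho 0.
  have -> : x = 0 by apply/eqP; rewrite eq_le; lra.
  by rewrite angle0 addr0 cos0 sin0 mul1r mul0r addr0.
have rp : 0 < rho by rewrite lt_neqAle eq_sym rho0.
apply/eqP; rewrite eq_le; apply/andP; split.
  have := K t (angle alpha x); rewrite (fcos_angle halpha) ?(fsin_angle halpha)//;
    by rewrite ler_norml; lra.
have h1 := K (t + angle alpha x) (angle alpha (rho - x)).
have h2 := K (t + angle alpha x) (angle alpha (- (rho + x))).
rewrite -!addrA -!angleD in h1 h2.
have d1 : x + (rho - x) = rho by ring.
have d2 : x + - (rho + x) = - rho by ring.
rewrite d1 e1 in h1; rewrite d2 e2 in h2.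
have n1 : `|rho - x| <= pi by rewrite ler_norml; lra.
have n2 : `|- (rho + x)| <= pi by rewrite ler_norml; lra.
rewrite (fcos_angle halpha n1) (fsin_angle halpha n1) in h1.
rewrite (fcos_angle halpha n2) (fsin_angle halpha n2) cosN sinN in h2.
have s1 : 0 <= sin (rho - x) by apply: sin_ge0_pi; lra.
have s2 : 0 <= sin (rho + x) by apply: sin_ge0_pi; lra.
have sr : 0 < sin rho by apply: sin_gt0_pi; lra.
have cr : 0 < cos rho by apply: cos_gt0_pihalf; lra.
(* The weights sin (rho + x) and sin (rho - x) cancel the unknown [M2 (t + x)]; the coefficient left
   in front of [M1 (t + x)] is sin (2 rho), positive as 0 < rho < pi / 2. *)
have k1 := ler_wpM2l s2 h1; have k2 := ler_wpM2l s1 h2.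
have c1 := cos2Dsin2 x; have c2 := cos2Dsin2 rho.
move: k1 k2; rewrite sinB cosB sinD cosD.
move: (M1 (t + _)) (M1 t) (M2 t) (M2 _) => m u v m2 k1 k2.
move: (cos x) (sin x) (cos rho) (sin rho) c1 c2 sr cr k1 k2 => cx sx cr sr c1 c2 sr0 cr0 k1 k2.
have p0 : 0 < 2 * sr * cr by rewrite !mulr_gt0.
rewrite -(ler_pM2l p0).
have E : 2 * sr * cr * m = (sr * cx + cr * sx) * ((cr * cx + sr * sx) * m)
   + (sr * cx - cr * sx) * ((cr * cx - sr * sx) * m).
  by transitivity (2 * sr * cr * m * (cx ^+ 2 + sx ^+ 2)); [rewrite c1 mulr1|ring].
rewrite E; lra.
Qed.

Lemma folding_subcos (p : kale alpha) t b :
  (folding (t + b) p).1 <= fcos b * (folding t p).1 + fsin b * (folding t p).2.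
Proof.
have r0 := kale_radius_ge0 p; rewrite !folding1 folding2.
have := fcosB_le halpha (kale_angle p - t) b.
rewrite opprD addrA => h; have := ler_wpM2l r0 h.
move: (fcos _) (fcos _) (fcos _) (fsin _) (fsin _) => *; lra.
Qed.

(** By [fcosB_le] the squared displacement is at most that of a chord,
    [r ^+ 2 * (2 - 2 * fcos (angle alpha x))]. *)
Lemma folding_rotate (p : kale alpha) t (x : R) :
  enorm (folding (t + angle alpha x) p - folding t p) <= kale_radius p * `|x|.
Proof.
have r0 := kale_radius_ge0 p.
rewrite -ler_sqr ?nnegrE ?enorm_ge0 ?mulr_ge0// enorm_sqr exprMn real_normK ?num_real//.
have := fcosB_le halpha (kale_angle p - t) (kale_angle p - (t + angle alpha x)).
have -> : kale_angle p - t - (kale_angle p - (t + angle alpha x)) = angle alpha x.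
  by rewrite opprB addrC addrA subrK [t + _]addrC addrK.
have := fcos_angle_near x.
have := dotp_folding t p; have := dotp_folding (t + angle alpha x) p.
have := fold_cos2Dsin2 (kale_angle p - t); have := fold_cos2Dsin2 (kale_angle p - (t + angle alpha x)).
rewrite /dotp /= -!/(fcos _) -!/(fsin _).
move: (kale_radius p) r0 (fcos _) (fcos _) (fcos _) (fsin _) (fsin _) => r r0 c1 c2 c3 s1 s2 a1 a2 _ _ h1 h2.
have -> : (r * c3 - r * c2) * (r * c3 - r * c2) + (r * s2 - r * s1) * (r * s2 - r * s1) =
  r ^+ 2 * ((c3 ^+ 2 + s2 ^+ 2) + (c2 ^+ 2 + s1 ^+ 2) - 2 * (c3 * c2 + s2 * s1)) by ring.
by rewrite ler_wpM2l ?sqr_ge0//; lra.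
Qed.

Lemma folding_rotate1 (p : kale alpha) t (x : R) :
  `|(folding (t + angle alpha x) p).1 - (folding t p).1| <= kale_radius p * `|x|.
Proof. exact: le_trans (enorm_ge1 (folding _ p - folding t p)) (folding_rotate p t x). Qed.

Lemma folding_rotate2 (p : kale alpha) t (x : R) :
  `|(folding (t + angle alpha x) p).2 - (folding t p).2| <= kale_radius p * `|x|.
Proof. exact: le_trans (enorm_ge2 (folding _ p - folding t p)) (folding_rotate p t x). Qed.

Lemma folded_pair_point (p : kale alpha) :
  folded_pair (fun t => (folding t p).1) (fun t => (folding t p).2).
Proof.
split; first exact: folding_subcos.
by exists (kale_radius p) => t x; split; [exact: folding_rotate1|exact: folding_rotate2].
Qed.

Lemma folded_pair_sum (s : R) (n : nat) (x : nat -> kale alpha) : 0 <= s ->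
  folded_pair (fun t => (scale2 s (\sum_(i < n) folding t (x i))).1)
              (fun t => (scale2 s (\sum_(i < n) folding t (x i))).2).
Proof.
move=> s0; elim: n => [|n [IHK [k IHL]]].
  split => [t b|]; first by rewrite !big_ord0 /= !mulr0 addr0.
  by exists 0 => t y; rewrite !big_ord0 /= !mulr0 subrr normr0 mul0r.
have [K [l L]] := folded_pair_point (x n).
have E1 t : (scale2 s (\sum_(i < n.+1) folding t (x i))).1 =
    (scale2 s (\sum_(i < n) folding t (x i))).1 + s * (folding t (x n)).1.
  by rewrite /scale2 /= big_ord_recr /= mulrDr.
have E2 t : (scale2 s (\sum_(i < n.+1) folding t (x i))).2 =
    (scale2 s (\sum_(i < n) folding t (x i))).2 + s * (folding t (x n)).2.
  by rewrite /scale2 /= big_ord_recr /= mulrDr.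
split.
  move=> t b; have h1 := IHK t b; have h2 := ler_wpM2l s0 (K t b).
  rewrite !E1 E2; move: h1 h2.
  move: (scale2 _ _).1 (scale2 _ _).1 (scale2 _ _).2 (folding _ _).1 (folding _ _).1 => *; lra.
exists (k + s * l) => t y; have [h1 h2] := IHL t y; have [h3 h4] := L t y.
rewrite !E1 !E2 mulrDl.
have dist (a b c d : R) : b + s * a - (d + s * c) = (b - d) + s * (a - c) by ring.
split; rewrite dist; apply: le_trans (ler_normD _ _) _;
  by apply: lerD => //; rewrite normrM (ger0_norm s0) -mulrA ler_wpM2l.
Qed.

End FoldedPairs.

(** * Growth and measurability of the barycenter *)

Section Barycenters.
Context {R : realType}.
Variable alpha : R.
Hypothesis halpha : 2 * pi < alpha.
Implicit Types (p q : kale alpha) (t : circle alpha).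

(** For [M] the first coordinate of the folded mean, this is the mean squared distance to [q] up to
    a term independent of [q]. *)
Definition potential (M : circle alpha -> R) q : R :=
  kale_radius q ^+ 2 - 2 * kale_radius q * M (kale_angle q).

(** If the maximum [M t0] is positive, the minimizer is the point of radius [M t0] in direction
    [t0], otherwise the origin. The comparison [M t <= M t0 * fcos (t - t0)] makes the excess at
    least a squared distance, a strong form of minimality. *)
Lemma potential_min (M M' : circle alpha -> R) : folded_pair M M' ->
  exists b, forall q, kale_dist q b ^+ 2 <= potential M q - potential M b.
Proof.
move=> fp; have [t0 ht0] := folded_pair_argmax halpha fp.
have [M0|M0] := leP (M t0) 0.
  exists Origin => q; rewrite kale_distC// kale_dist0// /potential /=.
  have r0 := kale_radius_ge0 q.
  have := ler_wpM2l r0 (le_trans (ht0 (kale_angle q)) M0).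
  by rewrite expr0n /=; lra.
exists (kale_point (M t0) t0) => q.
rewrite kale_distC// kale_dist_point ?(ltW M0)// /potential.
rewrite kale_radius_point ?(ltW M0)// kale_angle_point// folding1.
have := folded_pair_le_max halpha fp (ltW M0) ht0 (kale_angle q).
move=> h; have := ler_wpM2l (kale_radius_ge0 q) h; lra.
Qed.

Lemma sum_fst n (F : nat -> R * R) : (\sum_(i < n) F i).1 = \sum_(i < n) (F i).1.
Proof. by elim: n => [|n IH]; rewrite ?big_ord0// !big_ord_recr /= IH. Qed.

Definition mean_sqr_dist N (x : nat -> kale alpha) q : R :=
  N%:R^-1 * \sum_(i < N) kale_dist q (x i) ^+ 2.

Definition emp_moment (s : R) N (x : nat -> kale alpha) t : R * R :=
  scale2 s (\sum_(i < N) folding t (x i)).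

Lemma mean_sqr_distE N x q : (0 < N)%N ->
  mean_sqr_dist N x q = potential (fun t => (emp_moment N%:R^-1 N x t).1) q
    + N%:R^-1 * \sum_(i < N) kale_radius (x i) ^+ 2.
Proof.
move=> N0; rewrite /mean_sqr_dist /emp_moment /potential /=.
rewrite (sum_fst N (fun i => folding (kale_angle q) (x i))).
under eq_bigr => i _ do rewrite -{1}(kale_pointK q) (kale_dist_point halpha) ?kale_radius_ge0// addrAC.
rewrite big_split /= big_split /= sumr_const card_ord sumrN -mulr_sumr.
rewrite -[_ *+ N]mulr_natl; field; rewrite pnatr_eq0; lia.
Qed.

(** [argmin] picks some minimizer. Growth around the explicit minimizer [b] forces it to distance 0
    from [b], and the triangle inequality transfers the growth. *)
Lemma barycenter_growth N x : (0 < N)%N -> forall q,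
  kale_dist q (barycenter N x) ^+ 2 <=
    mean_sqr_dist N x q - mean_sqr_dist N x (barycenter N x).
Proof.
move=> N0.
have NR : (0 : R) <= N%:R^-1 by rewrite invr_ge0.
have [b hb] := potential_min (folded_pair_sum halpha N x NR).
have {}hb q : kale_dist q b ^+ 2 <= mean_sqr_dist N x q - mean_sqr_dist N x b.
  by have := hb q; rewrite !mean_sqr_distE// /emp_moment; lra.
have E q : (2 * N%:R)^-1 * \sum_(n < N) kale_dist q (x n) ^+ 2 = mean_sqr_dist N x q / 2.
  by rewrite /mean_sqr_dist; field; rewrite pnatr_eq0; lia.
have : [set p | setT p /\ forall q, setT q ->
  (2 * N%:R)^-1 * \sum_(n < N) kale_dist p (x n) ^+ 2 <=
  (2 * N%:R)^-1 * \sum_(n < N) kale_dist q (x n) ^+ 2] b.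
  split => // q _; rewrite !E; have := hb q; have := sqr_ge0 (kale_dist q b); lra.
move=> /getI /= [_ hB] q; rewrite /barycenter /argmin; move: hB; set B := get _ => hB.
have dBb : kale_dist B b = 0.
  have := hB b Logic.I; rewrite !E; have := hb B => h1 h2.
  by apply/eqP; rewrite -sqrf_eq0 eq_le sqr_ge0 andbT; lra.
have tri := kale_dist_triangle halpha q b B.
rewrite (kale_distC halpha b B) dBb addr0 in tri.
have := hb q; have := hB b Logic.I; rewrite !E.
have : kale_dist q B ^+ 2 <= kale_dist q b ^+ 2.
  by rewrite ler_sqr ?nnegrE ?kale_dist_ge0.
lra.
Qed.

Lemma kale_radius_dilate (s : R) p : 0 <= s -> kale_radius (dilate s p) = s * kale_radius p.
Proof. by move=> s0; rewrite /dilate kale_radius_point// mulr_ge0// kale_radius_ge0. Qed.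

Lemma kale_dist_dilate (s : R) p q : 0 <= s ->
  kale_dist (dilate s p) (dilate s q) = s * kale_dist p q.
Proof.
move=> s0; have rp := kale_radius_ge0 p; have rq := kale_radius_ge0 q.
apply/eqP; rewrite -(@eqrXn2 _ 2) ?mulr_ge0 ?kale_dist_ge0//; apply/eqP.
rewrite exprMn (kale_dist_sqr halpha p q) /dilate kale_dist_point ?mulr_ge0//.
rewrite folding_point ?mulr_ge0// kale_radius_point ?mulr_ge0//=; ring.
Qed.

Lemma potential_dilate M (s : R) p : 0 < s ->
  potential (fun t => s * M t) (dilate s p) = s ^+ 2 * potential M p.
Proof.
move=> s0; rewrite /potential kale_radius_dilate ?(ltW s0)//.
have [r0|r0] := eqVneq (kale_radius p) 0; first by rewrite r0 !(mulr0, mul0r) expr0n subrr mulr0.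
have rp : 0 < kale_radius p by rewrite lt_neqAle eq_sym r0 kale_radius_ge0.
by rewrite /dilate kale_angle_point ?mulr_gt0//; ring.
Qed.

Lemma dilateK (s : R) q : 0 < s -> dilate s (dilate s^-1 q) = q.
Proof.
move=> s0; have [r0|r0] := eqVneq (kale_radius q) 0.
  by rewrite (kale_radius0 r0) /dilate /= !(mulr0, kale_point0) /= ?mulr0 ?kale_point0.
have rp : 0 < kale_radius q by rewrite lt_neqAle eq_sym r0 kale_radius_ge0.
have si : 0 < s^-1 * kale_radius q by rewrite mulr_gt0// invr_gt0.
rewrite {1}/dilate kale_radius_dilate ?invr_ge0 ?(ltW s0)//.
rewrite /dilate kale_angle_point// mulrA divff ?gt_eqF// mul1r.
exact: kale_pointK.
Qed.

(** Potentials are homogeneous of degree two under dilation, so the rescaled barycenter minimizes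
    the potential of the sums normalized by n^(-1/2). *)
Lemma scaled_barycenter_growth N x : (0 < N)%N ->
  let b := dilate (Num.sqrt N%:R) (barycenter N x) in
  let M := fun t => (emp_moment (Num.sqrt N%:R)^-1 N x t).1 in
  forall q, kale_dist q b ^+ 2 <= potential M q - potential M b.
Proof.
move=> N0 b M q; set s := Num.sqrt N%:R in b M *.
have s0 : 0 < s by rewrite sqrtr_gt0 ltr0n.
have ME : M = fun t => s * (emp_moment N%:R^-1 N x t).1.
  apply/funext => t; rewrite /M /emp_moment /= mulrA; congr (_ * _).
  have -> : N%:R = s ^+ 2 by rewrite sqr_sqrtr.
  by field; rewrite gt_eqF.
rewrite -(dilateK q s0) ME !potential_dilate// kale_dist_dilate ?(ltW s0)// exprMn -mulrBr.
rewrite ler_pM2l ?exprn_gt0//.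
by have := barycenter_growth x N0 (dilate s^-1 q); rewrite !mean_sqr_distE//; lra.
Qed.

Definition rat_point (i : nat) : kale alpha :=
  if unpickle i is Some (a, b) then kale_point (ratr a) (angle alpha (ratr b)) else Origin.

Lemma rat_point_dense p (e : R) : 0 < e -> exists i, kale_dist p (rat_point i) < e.
Proof.
move=> e0; have r0 := kale_radius_ge0 p; set r := kale_radius p in r0 *.
have [x xE] := angle_surj (kale_angle p).
(* With radius and angle both within [eta], and [eta] at most 1, the squared distance is at most
   eta^2 (1 + r (r + 1)), hence at most (eta (r + 2))^2; the 3 in place of 2 makes the inequality
   strict. *)
pose eta := Num.min 1 (e / (r + 3)).
have r3 : 0 < r + 3 by lra.
have eta0 : 0 < eta by rewrite lt_min ltr01 divr_gt0.
have eta1 : eta <= 1 by rewrite ge_min lexx.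
have etae : eta * (r + 3) <= e by rewrite -ler_pdivlMr// ge_min lexx orbT.
have lt1 : r < r + eta by rewrite ltrDl.
have lt2 : x < x + eta by rewrite ltrDl.
have [a] := rat_in_itvoo lt1; rewrite in_itv/= => /andP[a1 a2].
have [b] := rat_in_itvoo lt2; rewrite in_itv/= => /andP[b1 b2].
exists (pickle (a, b)); rewrite /rat_point pickleK.
apply: (@le_lt_trans _ _ (eta * (r + 2))); last first.
  by apply: lt_le_trans etae; rewrite ltr_pM2l//; lra.
rewrite -ler_sqr ?nnegrE ?kale_dist_ge0 ?mulr_ge0 ?(ltW eta0)//; last lra.
have a0 : 0 <= (ratr a : R) by apply: le_trans (ltW a1).
rewrite kale_distC// kale_dist_point// folding1 -/r xE -angleB.
have := fcos_angle_near halpha (x - ratr b); move: (fcos _) => c hc.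
move: (ratr a : R) (ratr b : R) a0 a1 a2 b1 b2 hc => u v u0 a1 a2 b1 b2 hc.
have h1 : (x - v) ^+ 2 <= eta ^+ 2 by rewrite -[X in X <= _]sqrrN opprB ler_sqr ?nnegrE; lra.
have h2 : (u - r) ^+ 2 <= eta ^+ 2 by rewrite ler_sqr ?nnegrE; lra.
have ur : 0 <= u * r by rewrite mulr_ge0.
have h3 : u * r * (2 - 2 * c) <= u * r * eta ^+ 2 by rewrite ler_wpM2l//; lra.
have h4 : u * r * eta ^+ 2 <= (r + 1) * r * eta ^+ 2.
  by rewrite ler_wpM2r ?sqr_ge0// ler_wpM2r//; lra.
have h5 : 0 <= eta ^+ 2 * (3 * r + 3) by rewrite mulr_ge0 ?sqr_ge0//; lra.
rewrite exprMn; nra.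
Qed.

Lemma kale_measurability d (T : measurableType d) (Z : T -> kale alpha) :
  (forall U : set (kale alpha), kale_open U -> measurable (Z @^-1` U)) ->
  measurable_fun setT Z.
Proof.
move=> h; apply: (@measurability _ _ _ _ _ _ (@open (kale alpha))) => //.
by move=> _ [U oU <-]; rewrite setTI; exact: h.
Qed.

(** By the growth, a point whose value is within eps^2 of the minimum lies within eps of the
    minimizer. So [Z w] is in [U] exactly when some rational point with an eps-ball inside [U] is
    nearly optimal among rational points, a countable condition; upper semicontinuity lets these
    points compete with [Z w]. *)
Lemma measurable_argmin d (T : measurableType d) (Phi : T -> kale alpha -> R)
  (Z : T -> kale alpha) :
  (forall q, measurable_fun setT (fun w => Phi w q)) ->
  (forall w q e, 0 < e -> exists2 del, 0 < del &
     forall q', kale_dist q q' < del -> Phi w q' < Phi w q + e) ->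
  (forall w q, kale_dist q (Z w) ^+ 2 <= Phi w q - Phi w (Z w)) ->
  measurable_fun setT Z.
Proof.
move=> mPhi usc growth; apply: kale_measurability => U oU.
pose eps n : R := n.+1%:R^-1.
have eps0 n : 0 < eps n by rewrite invr_gt0 ltr0n.
pose A i n : set T :=
  if `[< forall q, kale_dist (rat_point i) q <= eps n -> U q >]
  then \bigcap_j [set w | Phi w (rat_point i) <= Phi w (rat_point j) + eps n ^+ 2]
  else set0.
have -> : Z @^-1` U = \bigcup_i \bigcup_n A i n.
  apply/seteqP; split => [w /= /oU[e e0 eU]|w [i _ [n _]]].
    have [n n2] : exists n, 2 * eps n < e.
      have e2 : 0 < e / 2 by rewrite divr_gt0.
      have /cvgrPdist_lt/(_ _ e2)[n _ /(_ n.+1 (leqnSn n))] := @cvg_invn R.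
      rewrite sub0r normrN ger0_norm ?invr_ge0// => h; exists n.
      by rewrite /eps mulrC -ltr_pdivlMr.
    have [del del0 hdel] := usc w (Z w) _ (exprn_gt0 2 (eps0 n)).
    have m0 : 0 < Num.min del (eps n) by rewrite lt_min del0 eps0.
    have [i] := rat_point_dense (Z w) m0; rewrite lt_min => /andP[i1 i2].
    exists i => //; exists n => //; rewrite /A asboolT.
      move=> j _ /=; apply: le_trans (ltW (hdel _ i1)) _.
      rewrite lerD2r; have := growth w (rat_point j); have := sqr_ge0 (kale_dist (rat_point j) (Z w)); lra.
    move=> q hq; apply: eU; apply: le_lt_trans (kale_dist_triangle halpha _ (rat_point i) _) _.
    lra.
  rewrite /A; case: asboolP => // qU h; apply: qU.
  rewrite -ler_sqr ?nnegrE ?kale_dist_ge0 ?(ltW (eps0 n))//.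
  rewrite leNgt; apply/negP => lt1.
  have lt2 : 0 < kale_dist (rat_point i) (Z w) ^+ 2 - eps n ^+ 2 by rewrite subr_gt0.
  have [del del0 hdel] := usc w (Z w) _ lt2.
  have [j hj] := rat_point_dense (Z w) del0.
  have := h j Logic.I; have := hdel _ hj; have := growth w (rat_point i) => /=; lra.
apply: bigcupT_measurable => i; apply: bigcupT_measurable => n.
rewrite /A; case: asboolP => _; last exact: measurable0.
apply: bigcapT_measurable => j; rewrite -[X in measurable X]setTI.
have mD : measurable_fun setT (fun w => Phi w (rat_point j) + eps n ^+ 2 - Phi w (rat_point i)).
  by apply: measurable_funB => //; exact: measurable_funD.
rewrite (_ : [set w | _] = (fun w => Phi w (rat_point j) + eps n ^+ 2 - Phi w (rat_point i)) @^-1` `[0, +oo[).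
  exact: mD.
by apply/seteqP; split => w /=; rewrite in_itv/= andbT subr_ge0.
Qed.

Lemma sqr_dist_usc q (x : kale alpha) (e : R) : 0 < e -> exists2 del, 0 < del &
  forall q', kale_dist q q' < del -> kale_dist q' x ^+ 2 < kale_dist q x ^+ 2 + e.
Proof.
move=> e0; set D := kale_dist q x; have D0 : 0 <= D by exact: kale_dist_ge0.
have k0 : 0 < 2 * D + 1 by lra.
exists (Num.min 1 (e / (2 * D + 1))); first by rewrite lt_min ltr01 divr_gt0.
move=> q'; rewrite lt_min ltr_pdivlMr// => /andP[h1 h2].
have := kale_dist_triangle halpha q' q x; rewrite (kale_distC halpha q' q) -/D.
have := kale_dist_ge0 q q'; have := kale_dist_ge0 q' x.
move: (kale_dist q q') (kale_dist q' x) h1 h2 => a b h1 h2 b0 a0 h3; nra.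
Qed.

Lemma mean_sqr_dist_usc N x q (e : R) : 0 < e -> exists2 del, 0 < del &
  forall q', kale_dist q q' < del -> mean_sqr_dist N x q' < mean_sqr_dist N x q + e.
Proof.
move=> e0; have sum_usc n (e' : R) : 0 < e' -> exists2 del, 0 < del &
  forall q', kale_dist q q' < del -> \sum_(i < n) kale_dist q' (x i) ^+ 2 <
     \sum_(i < n) kale_dist q (x i) ^+ 2 + e'.
  elim: n e' => [|n IH] e' e'0; first by exists 1 => // q' _; rewrite !big_ord0 add0r.
  have e2 : 0 < e' / 2 by rewrite divr_gt0.
  have [d1 d10 h1] := IH _ e2; have [d2 d20 h2] := sqr_dist_usc q (x n) e2.
  exists (Num.min d1 d2); first by rewrite lt_min d10.
  move=> q'; rewrite lt_min => /andP[/h1 k1 /h2 k2]; rewrite !big_ord_recr /=; lra.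
case: N => [|N]; first by exists 1 => // q' _; rewrite /mean_sqr_dist !big_ord0 !mulr0 add0r.
have NR : (0 : R) < N.+1%:R by rewrite ltr0n.
have [del del0 h] := sum_usc N.+1 _ (mulr_gt0 NR e0).
exists del => // q' /h k; rewrite /mean_sqr_dist -(ltr_pM2l NR) mulrDr !mulrA divff ?gt_eqF//.
by rewrite !mul1r.
Qed.

Lemma measurable_barycenter d (T : measurableType d) N (X : nat -> T -> kale alpha) :
  (0 < N)%N -> (forall n, measurable_fun setT (X n)) ->
  measurable_fun setT (fun w => barycenter N (fun n => X n w)).
Proof.
move=> N0 mX; apply: (@measurable_argmin _ _ (fun w => mean_sqr_dist N (fun n => X n w))).
- move=> q; apply: measurable_funM => //.
  apply: (measurable_sum _ (h := fun (i : 'I_N) w => kale_dist q (X i w) ^+ 2)) => i.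
  apply: measurable_funX; apply: (measurableT_comp _ (mX i)).
  apply: (@lipschitz_measurable _ _ _ 1) => p p'; rewrite mul1r ler_norml.
  have := kale_dist_triangle halpha q p p'; have := kale_dist_triangle halpha q p' p.
  rewrite (kale_distC halpha p' p) => *; apply/andP; split; lra.
- by move=> w q e e0; exact: mean_sqr_dist_usc.
- by move=> w q; exact: barycenter_growth.
Qed.

Lemma measurable_dilate (s : R) : 0 < s -> measurable_fun setT (dilate s : kale alpha -> kale alpha).
Proof.
move=> s0; apply: kale_measurability => U oU; apply: open_kale_measurable.
rewrite (_ : open _ = kale_open (dilate s @^-1` U))//.
move=> p /= /oU[e e0 eU]; exists (e / s); first by rewrite divr_gt0.
move=> q; rewrite ltr_pdivlMr// => h; apply: eU.
by rewrite kale_dist_dilate ?(ltW s0)// mulrC.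
Qed.

End Barycenters.

(** * Projection onto a plane sector in polar form *)

Section SectorProjection.
Context {R : realType}.
Variable rho : R.
Hypothesis hrho : 0 <= rho < pi / 2.
Implicit Types (x s : R) (y : R * R).

Definition unit_dir x : R * R := (cos x, sin x).

Lemma dotp_unit_dir x : dotp (unit_dir x) (unit_dir x) = 1.
Proof. by rewrite /dotp /= -!expr2 cos2Dsin2. Qed.

(** One-sided first order condition at h = 0. Half-angle formulas turn the hypothesis into b cos (h
    / 2) <= s sin (h / 2), where h tends to 0. The factor [sin v] covers v = 0, which leaves [b]
    unconstrained. *)
Lemma sin_sign_of_max s b v : 0 <= s -> 0 <= v <= pi ->
  (forall h, 0 <= h <= v -> s * cos h + b * sin h <= s) -> b * sin v <= 0.
Proof.
move=> s0 /andP[v0 vpi] hm.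
have [->|vn0] := eqVneq v 0; first by rewrite sin0 mulr0.
have vp : 0 < v by rewrite lt_neqAle eq_sym vn0.
have sv0 : 0 <= sin v by apply: sin_ge0_pi; rewrite v0.
suff b0 : b <= 0 by rewrite mulr_le0_ge0.
have p2 := @pi_ge2 R; have c1 := @cos1_gt0 R.
suff : b * cos 1 <= 0 by rewrite pmulr_lle0.
apply: (@le_eps_lin _ _ (s * v)) => x /andP[x0 x1].
(* This keeps h below v, x and 1 at once; the last bound makes cos 1 a positive lower bound of cos
   (h / 2). *)
pose h := Num.min v 1 * x.
have m0 : 0 < Num.min v 1 by rewrite lt_min vp ltr01.
have hp : 0 < h by rewrite mulr_gt0.
have hv : h <= v * x by rewrite ler_wpM2r ?(ltW x0)// ge_min lexx.
have hx : h <= x by rewrite ler_piMl ?(ltW x0)// ge_min lexx orbT.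
have h1 : h <= 1 by lra.
have hv' : v * x <= v by rewrite ler_piMr ?(ltW vp)// ltW.
have h0v : 0 <= h <= v by apply/andP; split; lra.
have := hm h h0v; have hh : h = (h / 2) *+ 2 by rewrite mulr2n; lra.
have -> : cos h = 1 - 2 * sin (h / 2) ^+ 2.
  by rewrite {1}hh cos_mulr2n cos2sin2 [_ *+ 2]mulr2n; lra.
have -> : sin h = 2 * (sin (h / 2) * cos (h / 2)).
  by rewrite {1}hh sin_mulr2n mulr2n [cos _ * _]mulrC; lra.
have sp : 0 < sin (h / 2) by apply: sin_gt0_pi; lra.
have sl : sin (h / 2) <= h / 2.
  by have := sin_le_norm (h / 2); rewrite !ger0_norm ?(ltW sp)// ltW// divr_gt0.
have cl : cos 1 <= cos (h / 2) by apply: le_cos_pi; lra.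
have cl1 : cos (h / 2) <= 1 by exact: cos_le1.
move: (sin (h / 2)) (cos (h / 2)) (cos 1) sp sl cl cl1 c1 => S C c sp sl cl cl1 c1 hS.
have {}hS : b * C <= s * S.
  by rewrite -(ler_pM2r sp); lra.
have [b0|b0] := leP b 0.
  apply: (@le_trans _ _ 0); first by rewrite mulr_le0_ge0// ltW.
  by rewrite !mulr_ge0// ltW.
have : b * c <= b * C by rewrite ler_pM2l.
have : s * S <= s * (v * x) by rewrite ler_wpM2l//; lra.
lra.
Qed.

(* The last two conditions characterize the projection [s e(x)] of [y] onto the
   sector; they give |z - s e(x)|^2 <= |z - y|^2 - |s e(x) - y|^2 there. *)
Lemma sector_argmax y : exists s x, [/\ 0 <= s, - rho <= x <= rho,
  s * dotp y (unit_dir x) = s ^+ 2 &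
  forall v, - rho <= v <= rho -> dotp y (unit_dir v) <= s * cos (v - x)].
Proof.
have /andP[r0 rpi] := hrho.
pose f x := dotp y (unit_dir x).
have cf : continuous f.
  move=> x; rewrite /f /dotp /=; apply: cvgD; apply: cvgM; try exact: cvg_cst.
    exact: continuous_cos.
  exact: continuous_sin.
have rr : - rho <= rho by lra.
have [x] := EVT_max rr (continuous_subspaceT cf).
rewrite in_itv/= => hx hmax.
have [fx0|fx0] := leP (f x) 0.
  exists 0, x; split => //; first by rewrite mul0r expr0n.
  move=> v hv; rewrite mul0r; apply: le_trans fx0.
  by apply: hmax; rewrite in_itv/= hv.
exists (f x), x; split => //; first exact: ltW.
pose b := dotp y (- sin x, cos x).
have fE h : f (x + h) = f x * cos h + b * sin h.
  by rewrite /f /b /dotp /unit_dir /= cosD sinD; ring.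
have p2 := @pi_ge2 R.
move=> v /andP[v1 v2]; move: (hx) => /andP[x1 x2].
have -> : dotp y (unit_dir v) = f (x + (v - x)) by rewrite addrC subrK.
rewrite fE gerDl.
have [vx|vx] := leP 0 (v - x).
  apply: (@sin_sign_of_max (f x)); rewrite ?(ltW fx0)//; first by apply/andP; split; lra.
  move=> h /andP[h0 hv]; rewrite -fE; apply: hmax; rewrite in_itv/=; apply/andP; split; lra.
have -> : v - x = - (x - v) by lra.
rewrite sinN mulrN -mulNr.
apply: (@sin_sign_of_max (f x)); rewrite ?(ltW fx0)//; first by apply/andP; split; lra.
move=> h /andP[h0 hv].
have -> : f x * cos h + - b * sin h = f (x + (- h)) by rewrite fE cosN sinN; ring.
by apply: hmax; rewrite in_itv/=; apply/andP; split; lra.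
Qed.

(** Polar coordinates of the projection, the form that can be carried over to the kale. At radius 0
    the angle is an arbitrary choice in the range. *)
Definition sector_polar y : R * R :=
  get [set c : R * R | [/\ 0 <= c.1, - rho <= c.2 <= rho,
  c.1 * dotp y (unit_dir c.2) = c.1 ^+ 2 &
  forall v, - rho <= v <= rho -> dotp y (unit_dir v) <= c.1 * cos (v - c.2)]].

Lemma sector_polarP y : let c := sector_polar y in [/\ 0 <= c.1, - rho <= c.2 <= rho,
  c.1 * dotp y (unit_dir c.2) = c.1 ^+ 2 &
  forall v, - rho <= v <= rho -> dotp y (unit_dir v) <= c.1 * cos (v - c.2)].
Proof.
have [s [x h]] := sector_argmax y.
exact: (@getI _ [set c : R * R | [/\ 0 <= c.1, - rho <= c.2 <= rho,
  c.1 * dotp y (unit_dir c.2) = c.1 ^+ 2 &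
  forall v, - rho <= v <= rho -> dotp y (unit_dir v) <= c.1 * cos (v - c.2)]] (s, x) h).
Qed.

(** Squared distance to [y] grows quadratically around the explicit point, so any choice made by
    [argmin] coincides with it. *)
Lemma sector_projE y : let c := sector_polar y in
  sector_proj rho y = (c.1 * cos c.2, c.1 * sin c.2).
Proof.
have /= := sector_polarP y; move: (sector_polar y) => [s x] /= [s0 hx sx hmax].
pose z : R * R := (s * cos x, s * sin x).
have Dz : plane_sector rho z by exists s, x.
have growth q : plane_sector rho q ->
  dotp (q - z) (q - z) <= dotp (y - q) (y - q) - dotp (y - z) (y - z).
  move=> [s' [x' [s'0 hx' ->]]].
  have := ler_wpM2l s'0 (hmax x' hx'); move: sx; rewrite /dotp /z /unit_dir /= cosB.
  have := cos2Dsin2 x; have := cos2Dsin2 x'.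
  move: (cos x) (sin x) (cos x') (sin x') => a b a' b' e' e sx h.
  have E1 : (s' * a') * (s' * a') + (s' * b') * (s' * b') = s' ^+ 2.
    by transitivity (s' ^+ 2 * (a' ^+ 2 + b' ^+ 2)); [ring|rewrite e' mulr1].
  have E2 : (s * a) * (s * a) + (s * b) * (s * b) = s ^+ 2.
    by transitivity (s ^+ 2 * (a ^+ 2 + b ^+ 2)); [ring|rewrite e mulr1].
  lra.
have hz : [set p | plane_sector rho p /\
    forall q, plane_sector rho q -> plane_dist y p <= plane_dist y q] z.
  split => // q /growth h; rewrite !plane_distE -ler_sqr ?nnegrE ?enorm_ge0// !enorm_sqr.
  by have := dotp_ge0 (q - z); lra.
move/getI: (hz) => /=; rewrite /sector_proj /argmin; set w := get _ => - [Dw hw].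
have := hw z Dz; rewrite !plane_distE -ler_sqr ?nnegrE ?enorm_ge0// !enorm_sqr => h.
have d0 : dotp (w - z) (w - z) <= 0 by have := growth w Dw; lra.
have : (w - z).1 ^+ 2 <= 0 /\ (w - z).2 ^+ 2 <= 0.
  have := sqr_ge0 (w - z).1; have := sqr_ge0 (w - z).2; move: d0; rewrite /dotp -!expr2 => *.
  by split; lra.
rewrite !real_exprn_even_le0 ?num_real//= !subr_eq0 => - [/eqP e1 /eqP e2].
by rewrite [LHS]surjective_pairing e1 e2.
Qed.

End SectorProjection.

(** * Lifting the projection to the kale *)

Section SectorPoint.
Context {R : realType}.
Variables (alpha rho : R).
Hypothesis halpha : 2 * pi < alpha.
Hypothesis hrho : 0 <= rho < pi / 2.
Variable t : circle alpha.
Implicit Types y : R * R.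

(** The projection followed by the inverse of the folding on the sector of the kale; the limit
    measure is the image of [g] under this map. *)
Definition sector_point y : kale alpha :=
  kale_point (sector_polar rho y).1 (t + angle alpha (sector_polar rho y).2).

Lemma fcos_near u v : - rho <= u <= rho -> - rho <= v <= rho ->
  fcos (angle alpha (u - v)) = cos (u - v).
Proof.
move: hrho => /andP[r0 r1] /andP[u1 u2] /andP[v1 v2]; apply: fcos_angle => //.
by rewrite ler_norml; apply/andP; split; lra.
Qed.

Lemma sector_point_growth y (s v : R) : 0 <= s -> - rho <= v <= rho ->
  kale_dist (kale_point s (t + angle alpha v)) (sector_point y) ^+ 2 <=
  s ^+ 2 - 2 * s * dotp y (unit_dir v) + (sector_polar rho y).1 ^+ 2.
Proof.
move=> s0 hv; have /= := sector_polarP hrho y; rewrite /sector_point.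
move: (sector_polar rho y) => [r x] /= [r0 hx rx hmax].
rewrite kale_dist_point// kale_radius_point// folding_point//=.
rewrite opprD addrACA subrr add0r -angleB fcos_near//.
have -> : cos (x - v) = cos (v - x) by rewrite -cosN opprB.
by have := ler_wpM2l s0 (hmax v hv); lra.
Qed.

(** The usual proof that projections onto convex sets are nonexpansive: the growth inequalities of
    [y] and [y'], each evaluated at the projection of the other, are added. The sector is narrower
    than pi, so its kale and plane distances agree. *)
Lemma sector_point_lip y y' : kale_dist (sector_point y) (sector_point y') <= enorm (y - y').
Proof.
rewrite -ler_sqr ?nnegrE ?kale_dist_ge0 ?enorm_ge0// enorm_sqr.
have /= [r0 hx rx _] := sector_polarP hrho y.
have /= [r0' hx' rx' _] := sector_polarP hrho y'.
have := sector_point_growth y' r0 hx; have := sector_point_growth y r0' hx'.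
rewrite -/(sector_point y) -/(sector_point y').
rewrite (kale_distC halpha (sector_point y')).
have : kale_dist (sector_point y) (sector_point y') ^+ 2 =
  (sector_polar rho y).1 ^+ 2 + (sector_polar rho y').1 ^+ 2 -
  2 * (sector_polar rho y).1 * (sector_polar rho y').1 *
  cos ((sector_polar rho y').2 - (sector_polar rho y).2).
  rewrite /sector_point kale_dist_point// kale_radius_point// folding_point//=.
  by rewrite opprD addrACA subrr add0r -angleB fcos_near//; ring.
move: (sector_polar rho y) (sector_polar rho y') rx rx' => [r x] [r' x'] /=.
rewrite /dotp /unit_dir /= cosB; move: (kale_dist _ _ ^+ 2) => D.
have := cos2Dsin2 x; have := cos2Dsin2 x'.
move: y.1 y.2 y'.1 y'.2 => y1 y2 z1 z2 /=.
move: (cos x) (sin x) (cos x') (sin x') => a b a' b' e' e rx rx' DE h1 h2.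
(* The sum bounds the squared distance of the projections by their inner product with y - y'; these
   squares then replace the inner product by |y - y'|^2. *)
have := sqr_ge0 ((y1 - z1) - (r * a - r' * a')); have := sqr_ge0 ((y2 - z2) - (r * b - r' * b')).
have E1 : (r' * a') ^+ 2 + (r' * b') ^+ 2 = r' ^+ 2.
  by transitivity (r' ^+ 2 * (a' ^+ 2 + b' ^+ 2)); [ring|rewrite e' mulr1].
have E2 : (r * a) ^+ 2 + (r * b) ^+ 2 = r ^+ 2.
  by transitivity (r ^+ 2 * (a ^+ 2 + b ^+ 2)); [ring|rewrite e mulr1].
lra.
Qed.

Lemma sector_point_near (y z : R * R) (r : R) :
  `|z.1 - y.1| < r -> `|z.2 - y.2| < r -> kale_dist (sector_point y) (sector_point z) < 2 * r.
Proof.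
move=> h1 h2; apply: le_lt_trans (sector_point_lip y z) _.
apply: le_lt_trans (enorm_le_norm1 _) _.
by rewrite /norm1 /= (distrC y.1) (distrC y.2); lra.
Qed.

Lemma sector_point_preimage_open (V : set (kale alpha)) : kale_open V -> plane_open (sector_point @^-1` V).
Proof.
move=> oV y /oV[e e0 eV]; exists (e / 2); first by rewrite divr_gt0.
move=> z h1 h2; apply: eV; have := sector_point_near h1 h2.
by rewrite mulrC divfK.
Qed.

Lemma measurable_sector_point : measurable_fun setT sector_point.
Proof.
by apply: kale_measurability => V /sector_point_preimage_open; exact: plane_open_measurable.
Qed.

(** Positivity of [cos x] excludes the half-line onto which far angles are folded and leaves angles
    below pi / 2, where the sine is injective. *)
Lemma folding_sector_inj (p : kale alpha) (s x : R) : 0 <= s -> - rho <= x <= rho ->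
  folding t p = (s * cos x, s * sin x) -> p = kale_point s (t + angle alpha x).
Proof.
move=> s0 hx e; have rp : kale_radius p = s.
  apply/eqP; rewrite -(@eqrXn2 _ 2) ?kale_radius_ge0//; apply/eqP.
  rewrite -(dotp_folding t) e /dotp /=.
  by transitivity (s ^+ 2 * (cos x ^+ 2 + sin x ^+ 2)); [ring|rewrite cos2Dsin2 mulr1].
have [s00|sn0] := eqVneq s 0.
  by rewrite s00 kale_point0; apply: kale_radius0; rewrite rp.
rewrite -[LHS]kale_pointK rp; congr kale_point.
have := congr1 fst e; have := congr1 snd e; rewrite folding1 folding2 rp /=.
move=> /(mulfI sn0) es /(mulfI sn0) ec.
have /andP[r0 r1] := hrho; have /andP[x1 x2] := hx.
have cx0 : 0 < cos x by apply: cos_gt0_pihalf; apply/andP; split; lra.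
have [h|h] := leP pi (angle_norm (kale_angle p - t)).
  by have := fcos_far halpha h; rewrite ec => cx; rewrite cx ltr0N1 in cx0.
have [u hu ue] := angle_rep_half halpha (kale_angle p - t).
move: h; rewrite ue (angle_norm_half halpha hu) => h.
rewrite ue (fcos_angle halpha (ltW h)) in ec; rewrite ue (fsin_angle halpha (ltW h)) in es.
have hu2 : `|u| < pi / 2.
  rewrite ltNge; apply/negP => h2; move: cx0; rewrite -ec.
  have -> : cos u = cos `|u| by case: (ler0P u); rewrite ?cosN.
  have p2 := @pi_ge2 R.
  have := @le_cos_pi R (pi / 2) `|u|; rewrite cos_pihalf => hc.
  have pih : 0 <= (pi : R) / 2 by lra.
  by move=> c0; have := lt_le_trans c0 (hc pih h2 (ltW h)); rewrite ltxx.
suff -> : x = u by rewrite -ue addrC subrK.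
apply: sin_inj; rewrite ?in_itv//=; first by apply/andP; split; lra.
by move: hu2; rewrite ltr_norml => /andP[? ?]; apply/andP; split; lra.
Qed.

Lemma limit_measureE (g : set (R * R) -> \bar R) :
  limit_measure g t rho = pushforward g sector_point.
Proof.
apply/funext => V; rewrite /limit_measure /pushforward; congr g.
apply/seteqP; split => y /=; rewrite sector_projE//=.
  have /= := sector_polarP hrho y; rewrite /sector_point.
  move: (sector_polar rho y) => [s x] /= [s0 hx _ _] [p Vp].
  by move=> /(folding_sector_inj s0 hx) <-.
move=> h; exists (sector_point y) => //; move: h => _.
have /= := sector_polarP hrho y; rewrite /sector_point.
move: (sector_polar rho y) => [s x] /= [s0 hx _ _].
rewrite folding_point// addrAC subrr add0r.
have /andP[r0 r1] := hrho; have /andP[x1 x2] := hx; have p2 := @pi_ge2 R.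
by rewrite fcos_angle ?fsin_angle// ler_norml; apply/andP; split; lra.
Qed.

Lemma enorm_lin y x : dotp y (unit_dir x) <= enorm y.
Proof.
apply: le_trans (dotp_le _ _) _.
by rewrite {2}/enorm dotp_unit_dir sqrtr1 mulr1.
Qed.

Lemma dotp_unit_dir_lip y u v : dotp y (unit_dir u) - dotp y (unit_dir v) <= enorm y * `|u - v|.
Proof.
have -> : dotp y (unit_dir u) - dotp y (unit_dir v) = dotp y (unit_dir u - unit_dir v).
  by rewrite /dotp /=; ring.
apply: le_trans (dotp_le _ _) _; rewrite ler_wpM2l ?enorm_ge0//.
rewrite -ler_sqr ?nnegrE ?enorm_ge0// enorm_sqr real_normK ?num_real//.
apply: le_trans (one_sub_cos (u - v)); rewrite cosB /dotp /=.
by have := cos2Dsin2 u; have := cos2Dsin2 v; lra.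
Qed.

(** Deterministic core. With b of radius r and s the radius of the projection, growth at
    [sector_point y] gives D <= - s^2 - r^2 + 2 r M(b). The direction of b leaves the sector by at
    most [delta], so M(b) <= s + delta |y|, and r <= |y| yields D <= - (s - r)^2 + 2 delta |y|^2. *)
Lemma barycenter_near_sector N (x : nat -> kale alpha) (delta : R) :
  (0 < N)%N -> 0 <= delta -> rho + delta <= pi ->
  let y := emp_moment (Num.sqrt N%:R)^-1 N x t in
  let M := fun t' => (emp_moment (Num.sqrt N%:R)^-1 N x t').1 in
  (forall v, - rho <= v <= rho -> M (t + angle alpha v) = dotp y (unit_dir v)) ->
  (forall t', 0 < M t' -> exists2 v, - (rho + delta) <= v <= rho + delta &
                            t' = t + angle alpha v) ->
  kale_dist (sector_point y) (dilate (Num.sqrt N%:R) (barycenter N x)) ^+ 2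
    <= 2 * delta * enorm y ^+ 2.
Proof.
move=> N0 d0 rd y M hM hpos; set b := dilate _ _.
have growth q : kale_dist q b ^+ 2 <= potential M q - potential M b.
  exact: scaled_barycenter_growth.
have s0 : 0 <= (Num.sqrt N%:R)^-1 :> R by rewrite invr_ge0 sqrtr_ge0.
have [K _] := folded_pair_sum halpha N x s0.
have := growth (sector_point y); have := growth Origin.
have /= := sector_polarP hrho y; rewrite /sector_point.
move: (sector_polar rho y) => [s u] /= [sp hu su hmax].
set q := kale_point _ _.
have pq : potential M q = - s ^+ 2.
  have [s00|sn0] := eqVneq s 0.
    by rewrite /q s00 kale_point0 /potential /= mulr0 mul0r subr0 expr0n oppr0.
  have sp' : 0 < s by rewrite lt_neqAle eq_sym sn0.
  rewrite /potential /q kale_radius_point// kale_angle_point// hM//; lra.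
rewrite pq kale_dist0// /potential /= mulr0 mul0r expr0n subr0 sub0r.
have r0 := kale_radius_ge0 b; set r := kale_radius b in r0 *.
have ds : 0 <= 2 * delta * enorm y ^+ 2 by rewrite !mulr_ge0 ?enorm_ge0.
set D := kale_dist q b ^+ 2.
have [Mb|Mb] := leP (M (kale_angle b)) 0.
  move=> _ h; have := sqr_ge0 s; have := ler_wpM2l r0 Mb; have := sqr_ge0 r; lra.
have [v hv vE] := hpos _ Mb.
have p2 := @pi_ge2 R; have /andP[rho0 rho1] := hrho.
have vpi : `|v| <= pi by rewrite ler_norml; apply/andP; split; lra.
have Mv : M (kale_angle b) <= dotp y (unit_dir v).
  have := K t (angle alpha v); rewrite -vE (fcos_angle halpha vpi) (fsin_angle halpha vpi).
  by rewrite /dotp /unit_dir; rewrite [y.1 * _]mulrC [y.2 * _]mulrC.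
(* The angle of the sector nearest to [v]. *)
pose w := Num.max (- rho) (Num.min v rho).
have hw : - rho <= w <= rho.
  by rewrite le_max lexx /= ge_max ge_min lexx orbT andbT; lra.
have vw : `|v - w| <= delta.
  rewrite ler_norml /w; case: (leP v rho) => h1;
    [case: (leP (- rho) v) => h2|case: (leP (- rho) rho) => h2]; by apply/andP; split; lra.
have := dotp_unit_dir_lip y v w; have := hmax w hw.
have := enorm_lin y v; have := enorm_ge0 y; set E := enorm y.
move=> E0 hE hw1 hw2 h1 h2.
(* Growth at the origin reads r^2 <= 2 r M(b) - r^2, so r is at most M(b), which is bounded by the
   norm of y. *)
have Mr : r <= E.
  have [->//|rn0] := eqVneq r 0.
  have rp : 0 < r by rewrite lt_neqAle eq_sym rn0.
  have : r * r <= r * M (kale_angle b) by lra.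
  rewrite ler_pM2l//; lra.
have hc : dotp y (unit_dir v) <= s + E * delta.
  have : E * `|v - w| <= E * delta by rewrite ler_wpM2l.
  have : s * cos (w - u) <= s by rewrite ler_piMr// cos_le1.
  lra.
have : r * M (kale_angle b) <= r * (s + E * delta) by rewrite ler_wpM2l//; lra.
have : r * (E * delta) <= E * (E * delta) by rewrite ler_wpM2r// mulr_ge0.
have := sqr_ge0 (s - r); rewrite sqrrB mulr2n; lra.
Qed.

End SectorPoint.

(** * Folded moments of a partly sticky measure *)

Section FoldedMoments.
Context {R : realType}.
Variable alpha : R.
Hypothesis halpha : 2 * pi < alpha.
Variable mu : probability (kale alpha) R.
Hypothesis hsq : square_integrable mu.
Implicit Types (t b : circle alpha) (x : R).

Lemma integrable_sqr_radius :
  mu.-integrable setT (fun q => (kale_radius q ^+ 2)%:E).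
Proof.
apply/integrableP; split.
  by apply/measurable_EFinP/measurable_funX; exact: measurable_kale_radius.
apply: le_lt_trans hsq; apply: ge0_le_integral => //.
- apply/measurable_EFinP; apply: measurableT_comp => //.
  by apply: measurable_funX; exact: measurable_kale_radius.
- apply/measurable_EFinP; apply: measurable_funX.
  rewrite (_ : kale_dist Origin = @kale_radius R alpha); first exact: measurable_kale_radius.
  by apply/funext => q; exact: kale_dist0.
- by move=> q _; rewrite lee_fin kale_dist0// ger0_norm// sqr_ge0.
Qed.

Lemma integrable_folding t :
  mu.-integrable setT (fun q => (norm1 (folding t q) ^+ 2)%:E).
Proof.
have i2 := integrableZl measurableT 2 integrable_sqr_radius.
apply: le_integrable i2 => //.
  by apply/measurable_EFinP/measurable_funX/measurable_norm1; exact: measurable_folding.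
move=> q _; rewrite /= lee_fin ger0_norm ?sqr_ge0// ger0_norm ?mulr_ge0 ?exprn_ge0 ?kale_radius_ge0//.
rewrite -(dotp_folding t) /norm1 /dotp -!expr2.
rewrite -(real_normK (num_real (folding t q).1)) -(real_normK (num_real (folding t q).2)).
have := sqr_ge0 (`|(folding t q).1| - `|(folding t q).2|); rewrite sqrrB sqrrD !mulr2n; lra.
Qed.

Lemma integrable_radius : mu.-integrable setT (fun q => (kale_radius q)%:E).
Proof.
apply: (@integrable_le_norm1 _ _ _ mu (folding 0) (integrable_folding 0)).
  exact: measurable_kale_radius.
move=> q; apply: le_trans (enorm_le_norm1 _).
by rewrite /enorm dotp_folding sqrtr_sqr.
Qed.

Definition mean_radius : R := \int[mu]_q kale_radius q.

Lemma mean_radius_ge0 : 0 <= mean_radius.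
Proof. by apply: Rintegral_ge0 => q _; exact: kale_radius_ge0. Qed.

Lemma moment_lip (f h : kale alpha -> R) (k : R) :
  mu.-integrable setT (EFin \o f) -> mu.-integrable setT (EFin \o h) ->
  (forall q, `|f q - h q| <= kale_radius q * k) ->
  `|\int[mu]_q f q - \int[mu]_q h q| <= mean_radius * k.
Proof.
move=> jf jh fh; rewrite -RintegralB//.
have jB : mu.-integrable setT (EFin \o (fun q => f q - h q)).
  by rewrite (_ : _ \o _ = (EFin \o f) \- (EFin \o h))%E//; exact: integrableB.
apply: le_trans (le_normr_Rintegral _ jB) _ => //.
rewrite /mean_radius mulrC -RintegralZl//; last exact: integrable_radius.
apply: le_Rintegral => //; first exact: integrable_norm jB.
  by have := integrableZl measurableT k integrable_radius.
by move=> q _; rewrite mulrC.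
Qed.

Lemma integrable_folding_comb t (a b : R) :
  mu.-integrable setT (EFin \o (fun q => a * (folding t q).1 + b * (folding t q).2)).
Proof.
have i1 := integrable_Y1 (measurable_folding halpha t) (integrable_folding t).
have i2 := integrable_Y2 (measurable_folding halpha t) (integrable_folding t).
exact: (integrableD measurableT (integrableZl measurableT a i1) (integrableZl measurableT b i2)).
Qed.

Lemma moment_comb t (a b : R) :
  \int[mu]_q (a * (folding t q).1 + b * (folding t q).2) =
  a * (folded_moment mu t).1 + b * (folded_moment mu t).2.
Proof.
have i1 := integrable_Y1 (measurable_folding halpha t) (integrable_folding t).
have i2 := integrable_Y2 (measurable_folding halpha t) (integrable_folding t).
have j1 := integrableZl measurableT a i1; have j2 := integrableZl measurableT b i2.
rewrite (@RintegralD _ _ _ mu setT (fun q => a * (folding t q).1)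
  (fun q => b * (folding t q).2))//.
by rewrite !RintegralZl.
Qed.

Lemma moment_pair : folded_pair (fun t => (folded_moment mu t).1)
                                (fun t => (folded_moment mu t).2).
Proof.
have i1 t := integrable_Y1 (measurable_folding halpha t) (integrable_folding t).
have i2 t := integrable_Y2 (measurable_folding halpha t) (integrable_folding t).
split.
  move=> t b; rewrite -moment_comb; apply: le_Rintegral => //.
  - exact: i1.
  - exact: integrable_folding_comb.
  - by move=> q _; exact: folding_subcos.
exists mean_radius => t x; split.
  by apply: moment_lip => [||q]; [exact: i1|exact: i1|exact: folding_rotate1].
by apply: moment_lip => [||q]; [exact: i2|exact: i2|exact: folding_rotate2].
Qed.

Lemma moment2_le t : `|(folded_moment mu t).2| <= mean_radius.
Proof.
have i0 : mu.-integrable setT (EFin \o (fun _ : kale alpha => 0 : R)).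
  exact: finite_measure_integrable_cst.
have := moment_lip (integrable_Y2 (measurable_folding halpha t) (integrable_folding t)) i0 (k := 1).
rewrite Rintegral_cst1 subr0 mulr1; apply => q; rewrite subr0 mulr1.
apply: le_trans (enorm_ge2 _) _.
by rewrite /enorm dotp_folding sqrtr_sqr ger0_norm// kale_radius_ge0.
Qed.

Section PartlySticky.
Variables (theta : circle alpha) (rho : R).
Hypothesis hrho : 0 <= rho < pi / 2.
Hypothesis hps : partly_sticky mu.
Hypothesis hK : nonneg_directions mu = angle_interval theta rho.

Lemma moment_in_interval x : - rho <= x <= rho ->
  (folded_moment mu (theta + angle alpha x)).1 = 0.
Proof.
move=> hx; apply: hps.2; rewrite hK; by exists x => //=.
Qed.

Lemma moment1_le0 t : (folded_moment mu t).1 <= 0.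
Proof.
have [//|h] := leP (folded_moment mu t).1 0.
by move: (h); rewrite (hps.2 t (ltW h)) ltxx.
Qed.

(** This centers the sample for the central limit theorem: [theta] maximizes the first moment with
    value 0, so the second, its derivative, vanishes. *)
Lemma moment_center : folded_moment mu theta = (0, 0).
Proof.
have /andP[r0 _] := hrho.
have m1 : (folded_moment mu theta).1 = 0.
  have := @moment_in_interval 0; rewrite angle0 addr0; apply.
  by rewrite oppr_le0 r0.
rewrite [LHS]surjective_pairing m1; congr (_, _).
apply: (folded_pair_max0 halpha moment_pair) => [|t']; first by rewrite m1.
by rewrite m1 moment1_le0.
Qed.

(** The defect of [folding_subcos] is nonnegative, and its integral is 0 because the moments
    involved vanish. *)
Lemma moment_equality x : - rho <= x <= rho -> \forall q \ae mu,
  (folding (theta + angle alpha x) q).1 =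
  cos x * (folding theta q).1 + sin x * (folding theta q).2.
Proof.
move=> hx; have /andP[r0 r1] := hrho; have p2 := @pi_ge2 R.
have xpi : `|x| <= pi by rewrite ler_norml; move: hx => /andP[? ?]; apply/andP; split; lra.
have i1 t := integrable_Y1 (measurable_folding halpha t) (integrable_folding t).
pose u q := cos x * (folding theta q).1 + sin x * (folding theta q).2.
have iu : mu.-integrable setT (EFin \o u) by exact: integrable_folding_comb.
pose f q := u q - (folding (theta + angle alpha x) q).1.
have f0 q : 0 <= f q.
  rewrite subr_ge0 /u; have := folding_subcos halpha q theta (angle alpha x).
  by rewrite (fcos_angle halpha xpi) (fsin_angle halpha xpi).
have jf : mu.-integrable setT (EFin \o f).
  by have := integrableB measurableT iu (i1 (theta + angle alpha x)).
have If : \int[mu]_q f q = 0.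
  have Iu : \int[mu]_q u q = 0 by rewrite /u moment_comb moment_center !mulr0 addr0.
  rewrite RintegralB//; last exact: i1.
  rewrite Iu.
  by have := moment_in_interval hx; rewrite /folded_moment /= => ->; rewrite subr0.
have : (\int[mu]_q `|(EFin \o f) q| = 0)%E.
  have jn := integrable_norm jf.
  under eq_integral => q _ do rewrite /= ger0_norm//.
  by rewrite -[LHS]fineK ?(integrable_fin_num measurableT jf)//; congr EFin.
move/(ae_eq_integral_abs mu measurableT (measurable_int _ jf)).1.
apply: filterS => q /(_ Logic.I) /= [] /eqP; rewrite /f subr_eq0 => /eqP.
by [].
Qed.

(** Off K the first moment is negative; it attains its maximum on each of the two compact arcs left
    over. *)
Lemma moment_outside (delta : R) : 0 < delta -> exists2 c : R, 0 < c &
  forall x, rho + delta <= `|x| <= alpha / 2 ->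
    (folded_moment mu (theta + angle alpha x)).1 <= - c.
Proof.
move=> d0; have /andP[r0 r1] := hrho.
pose m x := (folded_moment mu (theta + angle alpha x)).1.
have cm : continuous m := folded_pair_continuous moment_pair.
have neg x : rho + delta <= `|x| <= alpha / 2 -> m x < 0.
  move=> /andP[x1 x2]; rewrite ltNge; apply/negP => mx.
  have : nonneg_directions mu (theta + angle alpha x) by [].
  rewrite hK => -[y /=]; rewrite in_itv/= => hy /addrI e.
  have yr : `|y| <= rho by rewrite ler_norml.
  have := angle_norm_le alpha y; rewrite e (angle_norm_half halpha x2); lra.
have [h|h] := leP (rho + delta) (alpha / 2); last first.
  by exists 1 => // x /andP[x1 x2]; lra.
have [x1] := EVT_max h (continuous_subspaceT cm).
rewrite in_itv/= => /andP[a1 b1] hx1.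
have h' : - (alpha / 2) <= - (rho + delta) by lra.
have [x2] := EVT_max h' (continuous_subspaceT cm).
rewrite in_itv/= => /andP[a2 b2] hx2.
have n1 : m x1 < 0 by apply: neg; rewrite ger0_norm ?a1//; lra.
have n2 : m x2 < 0 by apply: neg; rewrite ler0_norm; [apply/andP; split|]; lra.
exists (Num.min (- m x1) (- m x2)); first by rewrite lt_min !oppr_gt0 n1.
move=> x /andP[l1 l2]; rewrite -/(m x) lerNr ge_min !lerN2.
case: (ler0P x) => x0 in l1 l2.
  by rewrite (hx2 x) ?orbT// in_itv/=; apply/andP; split; lra.
by rewrite (hx1 x)// in_itv/=; apply/andP; split; lra.
Qed.

End PartlySticky.
End FoldedMoments.

(** * Events of probability tending to one *)

Section AsymptoticallySure.
Context {R : realType}.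

Lemma prob_setI_ge d (T : measurableType d) (m : probability T R) (A B : set T) :
  measurable A -> measurable B -> fine (m A) + fine (m B) - 1 <= fine (m (A `&` B)).
Proof.
move=> mA mB.
have e : fine (m A) = fine (m (A `\` B)) + fine (m (A `&` B)).
  rewrite -fineD ?fin_num_measure//; [|exact: measurableD|exact: measurableI].
  by rewrite -measureDI.
have : fine (m (A `\` B)) <= fine (m (~` B)).
  rewrite fine_le ?fin_num_measure//; [exact: measurableD|exact: measurableC|].
  apply: le_measure; rewrite ?inE; [exact: measurableD|exact: measurableC|].
  by move=> x [].
rewrite (probability_setC m mB) fineB ?fin_num_measure//=; lra.
Qed.

Lemma prob_increasing d (T : measurableType d) (m : probability T R) (F : nat -> set T) (e : R) :
  (forall k, measurable (F k)) -> (forall k, F k `<=` F k.+1) -> 0 < e ->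
  exists k, fine (m (\bigcup_k F k)) - e <= fine (m (F k)).
Proof.
move=> mF incF e0; have mU : measurable (\bigcup_k F k) by exact: bigcupT_measurable.
have ndF : nondecreasing_seq F by apply/nondecreasing_seqP => k; exact/subsetPset.
have : m (F n) @[n --> \oo] --> (fine (m (\bigcup_k F k)))%:E.
  by rewrite fineK ?fin_num_measure//; exact: nondecreasing_cvg_mu.
move=> /fine_cvgP[_] /cvgrPdist_le /(_ _ e0)[k _ /(_ k (leqnn k))] /=.
by rewrite ler_norml => /andP[_ h]; exists k; lra.
Qed.

Context d (Omega : measurableType d) (P : probability Omega R).

(* The events need not be measurable, hence the inner approximation. *)
Definition aas (A : nat -> set Omega) : Prop := forall e : R, 0 < e ->
  \forall n \near \oo, exists B, [/\ measurable B, B `<=` A n & 1 - e <= fine (P B)].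

Lemma aasS (A B : nat -> set Omega) :
  (\forall n \near \oo, A n `<=` B n) -> aas A -> aas B.
Proof.
move=> AB hA e e0; near=> n.
have [C [mC CA PC]] : exists C, [/\ measurable C, C `<=` A n & 1 - e <= fine (P C)].
  by near: n; exact: hA.
exists C; split => //; apply: subset_trans CA _; by near: n.
Unshelve. all: by end_near. Qed.

Lemma aasT : aas (fun _ => setT).
Proof.
move=> e e0; near=> n; exists setT; split => //.
by rewrite prob_setT1; lra.
Unshelve. all: by end_near. Qed.

Lemma aasI (A B : nat -> set Omega) : aas A -> aas B -> aas (fun n => A n `&` B n).
Proof.
move=> hA hB e e0; have e2 : 0 < e / 2 by rewrite divr_gt0.
near=> n.
have [C [mC CA PC]] : exists C, [/\ measurable C, C `<=` A n & 1 - e / 2 <= fine (P C)].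
  by near: n; exact: hA.
have [D [mD DB PD]] : exists D, [/\ measurable D, D `<=` B n & 1 - e / 2 <= fine (P D)].
  by near: n; exact: hB.
exists (C `&` D); split; [exact: measurableI| exact: setISS|].
have := prob_setI_ge P mC mD; lra.
Unshelve. all: by end_near. Qed.

Lemma aas_forall (A : nat -> nat -> set Omega) J : (forall j, aas (A j)) ->
  aas (fun n => [set w | forall j, (j < J)%N -> A j n w]).
Proof.
move=> hA; elim: J => [|J IH]; first by apply: aasS aasT; near=> n.
apply: aasS (aasI IH (hA J)); near=> n.
by move=> w [h1 h2] j; rewrite ltnS leq_eqVlt => /predU1P[->//|]; exact: h1.
Unshelve. all: by end_near. Qed.

Lemma aas_ae (Q : Omega -> Prop) : {ae P, forall w, Q w} -> aas (fun _ => [set w | Q w]).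
Proof.
move=> [B [mB PB QB]] e e0; near=> n; exists (~` B); split; first exact: measurableC.
  by move=> w Bw; apply: contrapT => nQ; apply: Bw; exact: QB.
by rewrite (probability_setC P mB) PB sube0 /=; lra.
Unshelve. all: by end_near. Qed.

Definition test_cvg d2 (T2 : measurableType d2) (m2 : probability T2 R)
  (Z : nat -> Omega -> R * R) (Y2 : T2 -> R * R) : Prop :=
  forall f, taylor_fun f -> \int[P]_w f (Z n w) @[n --> \oo] --> \int[m2]_t f (Y2 t).

Lemma aas_open d2 (T2 : measurableType d2) (m2 : probability T2 R)
  (Z : nat -> Omega -> R * R) (Y2 : T2 -> R * R) U :
  (forall n, measurable_fun setT (Z n)) -> measurable_fun setT Y2 ->
  test_cvg m2 Z Y2 -> plane_open U -> (forall t, U (Y2 t)) ->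
  aas (fun n => Z n @^-1` U).
Proof.
move=> mZ mY tc oU UY e e0.
have UT : Y2 @^-1` U = setT by apply/seteqP; split => t // _; exact: UY.
near=> n; exists (Z n @^-1` U); split => //.
  by apply: preimage_measurable => //; exact: plane_open_measurable.
have : fine (m2 (Y2 @^-1` U)) - e <= fine (P (Z n @^-1` U)) by near: n; exact: open_liminf.
by rewrite UT prob_setT1.
Unshelve. all: by end_near. Qed.

(** Balls exhaust the limit law, so one of them has limit mass at least 1 - e / 2; being open, it
    keeps nearly this mass for large n. *)
Lemma tight d2 (T2 : measurableType d2) (m2 : probability T2 R)
  (Z : nat -> Omega -> R * R) (Y2 : T2 -> R * R) (e : R) :
  (forall n, measurable_fun setT (Z n)) -> measurable_fun setT Y2 ->
  test_cvg m2 Z Y2 -> 0 < e ->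
  exists2 C : R, 0 < C & \forall n \near \oo, exists B, [/\ measurable B,
    B `<=` [set w | norm1 (Z n w) < C] & 1 - e <= fine (P B)].
Proof.
move=> mZ mY tc e0; have e2 : 0 < e / 2 by rewrite divr_gt0.
pose U k : set (R * R) := [set z | norm1 z < k%:R].
have oU k : plane_open (U k).
  move=> x; rewrite /U /= /norm1 => xk.
  exists ((k%:R - (`|x.1| + `|x.2|)) / 2) => [|y h1 h2]; first by rewrite divr_gt0// subr_gt0.
  have a1 : `|y.1| <= `|x.1| + `|y.1 - x.1|.
    by apply: le_trans (ler_normD _ _); rewrite addrC subrK.
  have a2 : `|y.2| <= `|x.2| + `|y.2 - x.2|.
    by apply: le_trans (ler_normD _ _); rewrite addrC subrK.
  lra.
have mU k := plane_open_measurable (oU k).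
have incU k : Y2 @^-1` U k `<=` Y2 @^-1` U k.+1.
  by move=> t /= h; apply: lt_trans h _; rewrite ltr_nat.
have [k] := prob_increasing m2 (fun k => preimage_measurable mY (mU k)) incU e2.
have -> : \bigcup_k (Y2 @^-1` U k) = setT.
  apply/seteqP; split => t // _.
  have n0 := norm1_ge0 (Y2 t); have /andP[_ h] := truncn_itv n0.
  by exists (Num.trunc (norm1 (Y2 t))).+1.
rewrite prob_setT1 => hk.
(* The index [k] may be 0, while the radius has to be positive. *)
exists k.+1%:R; first by rewrite ltr0n.
near=> n; exists (Z n @^-1` U k); split; first exact: preimage_measurable.
  by move=> w /= h; apply: lt_trans h _; rewrite ltr_nat.
have : fine (m2 (Y2 @^-1` U k)) - e / 2 <= fine (P (Z n @^-1` U k)) by near: n; exact: open_liminf.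
lra.
Unshelve. all: by end_near. Qed.

End AsymptoticallySure.

(** * Limit theorem *)

Section Limit.
Context {R : realType}.
Variable alpha : R.
Hypothesis halpha : 2 * pi < alpha.
Variable mu : probability (kale alpha) R.
Hypothesis hsq : square_integrable mu.
Variables (theta : circle alpha) (rho : R).
Hypothesis hrho : 0 <= rho < pi / 2.
Hypothesis hps : partly_sticky mu.
Hypothesis hK : nonneg_directions mu = angle_interval theta rho.
Context d (Omega : measurableType d) (P : probability Omega R).
Variable X : nat -> Omega -> kale alpha.
Hypotheses (mX : forall n, measurable_fun setT (X n)) (indX : mutually_independent P X).
Hypothesis lawX : forall n A, measurable A -> P (X n @^-1` A) = mu A.

Lemma measurable_emp_moment (s : R) n t :
  measurable_fun setT (fun w => emp_moment s n (X^~ w) t).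
Proof.
apply: (measurable_scale2 _ s).
apply: (@measurable_sum_plane _ _ _ n (fun i w => folding t (X i w))) => i _.
exact: measurableT_comp (measurable_folding halpha t) (mX i).
Qed.

Lemma moment_law_of_large_numbers t U : plane_open U -> U (folded_moment mu t) ->
  aas P (fun n => [set w | U (emp_moment n%:R^-1 n (X^~ w) t)]).
Proof.
move=> oU Um; apply: (aas_open (m2 := mu) (Y2 := cst (folded_moment mu t))
  (Z := fun n w => emp_moment n%:R^-1 n (X^~ w) t)) => //.
  by move=> n; exact: measurable_emp_moment.
move=> f tf; have -> : \int[mu]_q f (cst (folded_moment mu t) q) = f (folded_moment mu t).
  exact: (Rintegral_cst1 mu (f (folded_moment mu t))).
exact: (weak_law_test mX indX lawX (measurable_folding halpha t) (integrable_folding halpha hsq t)).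
Qed.

(** The first bound is the negativity wanted at a mesh angle; the second controls the slope when
    moving to nearby angles. *)
Definition strip (a b : R) : set (R * R) := [set z | z.1 < a /\ `|z.2| < b].

Lemma strip_open a b : plane_open (strip a b).
Proof.
move=> x [x1 x2]; exists (Num.min (a - x.1) (b - `|x.2|)).
  by rewrite lt_min !subr_gt0 x1.
move=> y; rewrite !lt_min => /andP[h1 _] /andP[_ h2]; split.
  by have := ler_norm (y.1 - x.1); lra.
have : `|y.2| <= `|x.2| + `|y.2 - x.2|.
  by apply: le_trans (ler_normD _ _); rewrite addrC subrK.
lra.
Qed.

Lemma emp_moment_outside (delta : R) : 0 < delta ->
  aas P (fun n => [set w | forall x, rho + delta <= `|x| <= alpha / 2 ->
    (emp_moment n%:R^-1 n (X^~ w) (theta + angle alpha x)).1 < 0]).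
Proof.
move=> d0; have d2 : 0 < delta / 2 by rewrite divr_gt0.
have a0 := alpha_gt0 halpha.
have [c c0 hc] := moment_outside halpha hsq hrho hK d2.
pose rb := mean_radius mu + 1.
have rb1 : 1 <= rb by rewrite lerDr mean_radius_ge0.
have rb0 : 0 < rb by lra.
(* Mesh width: [delta / 2] keeps the relevant mesh points off K, 1 / 2 makes the cosine at least 1 /
   2, and [c / (8 * rb)] limits the slope term to c / 8, against a main term of at most - c / 4. *)
pose eps := Num.min (Num.min (delta / 2) 2^-1) (c / (8 * rb)).
have eps0 : 0 < eps by rewrite !lt_min d2 invr_gt0 ltr0n /= divr_gt0// mulr_gt0.
have eps1 : eps <= delta / 2 by rewrite !ge_min lexx.
have eps2 : eps <= 2^-1 by rewrite !ge_min lexx orbT.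
have eps3 : eps * (8 * rb) <= c by rewrite -ler_pdivlMr ?mulr_gt0// ge_min lexx orbT.
pose x_ j : R := - (alpha / 2) + j%:R * eps.
pose A j n : set Omega := [set w | rho + delta / 2 <= `|x_ j| <= alpha / 2 ->
  strip (- (c / 2)) rb (emp_moment n%:R^-1 n (X^~ w) (theta + angle alpha (x_ j)))].
have hA j : aas P (A j).
  have [h|h] := boolP (rho + delta / 2 <= `|x_ j| <= alpha / 2); last first.
    by apply: aasS (aasT P); near=> n; move=> w _ h'; rewrite h' in h.
  have := moment_law_of_large_numbers (t := theta + angle alpha (x_ j)) (@strip_open (- (c / 2)) rb).
  move=> lln; apply: aasS (lln _); first by near=> n; move=> w /= + _.
  split; first by have := hc _ h; lra.
  apply: le_lt_trans (moment2_le halpha hsq _) _; rewrite /rb ltrDl; exact: ltr01.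
have := @aas_forall _ _ _ P A (Num.trunc (alpha / eps)).+1 hA.
apply: aasS; near=> n; move=> w hw x /andP[x1 x2].
(* The integer part of [z] is the index of the mesh point just to the left of [x], from which
   negativity is carried by the folded-pair inequality. *)
pose z := (x + alpha / 2) / eps.
have /andP[x3 x4] : - (alpha / 2) <= x <= alpha / 2 by rewrite -ler_norml.
have z0 : 0 <= z by rewrite divr_ge0 ?(ltW eps0)//; lra.
have /andP[j1 j2] := truncn_itv z0.
have jJ : (Num.trunc z < (Num.trunc (alpha / eps)).+1)%N.
  by rewrite ltnS; apply: le_truncn; rewrite ler_pM2r ?invr_gt0//; lra.
have := hw _ jJ; rewrite /A /=.
set j := Num.trunc z in j1 j2 jJ *.
rewrite ler_pdivlMr// in j1.
have {}j2 : x + alpha / 2 < j%:R * eps + eps.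
  by move: j2; rewrite ltr_pdivrMr// -[j.+1%:R]natr1 mulrDl mul1r.
have u0 : 0 <= x - x_ j by rewrite /x_; lra.
have u1 : x - x_ j < eps by rewrite /x_; lra.
have xj1 : - (alpha / 2) <= x_ j by rewrite /x_ lerDl mulr_ge0 ?(ltW eps0).
have xj : rho + delta / 2 <= `|x_ j| <= alpha / 2.
  rewrite ler_norml xj1 /=; apply/andP; split; last lra.
  have : `|x| <= `|x_ j| + `|x - x_ j| by apply: le_trans (ler_normD _ _); rewrite addrC subrK.
  rewrite (ger0_norm u0); lra.
move=> /(_ xj) [h1 h2].
have p2 := @pi_ge2 R.
have upi : `|x - x_ j| <= pi by rewrite (ger0_norm u0); lra.
have n0 : 0 <= n%:R^-1 :> R by rewrite invr_ge0.
have [K _] := folded_pair_sum halpha n (X^~ w) n0.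
have := K (theta + angle alpha (x_ j)) (angle alpha (x - x_ j)).
rewrite -addrA -angleD [x_ j + _]addrC subrK (fcos_angle halpha upi) (fsin_angle halpha upi).
move=> k; apply: le_lt_trans k _.
move: h1 h2; rewrite /emp_moment; set u := scale2 _ _ => h1 h2.
have c1 : 2^-1 <= cos (x - x_ j).
  have := one_sub_cos (x - x_ j).
  have : (x - x_ j) ^+ 2 <= 2^-1 ^+ 2 by rewrite ler_sqr ?nnegrE//; lra.
  by rewrite expr2; lra.
have s1 : `|sin (x - x_ j)| <= eps.
  by apply: le_trans (sin_le_norm _) _; rewrite (ger0_norm u0) ltW.
have : cos (x - x_ j) * u.1 <= 2^-1 * u.1 by rewrite ler_wnM2r//; lra.
have : sin (x - x_ j) * u.2 <= eps * rb.
  apply: le_trans (ler_norm _) _; rewrite normrM; apply: ler_pM => //; exact: ltW.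
lra.
Unshelve. all: by end_near. Qed.

(** Only the two endpoints are treated, which leaves countably many null sets; [emp_moment_sector]
    recovers the angles in between through [folded_pair_between]. *)
Lemma emp_moment_equality : {ae P, forall w, forall i x, x = rho \/ x = - rho ->
  (folding (theta + angle alpha x) (X i w)).1 =
  cos x * (folding theta (X i w)).1 + sin x * (folding theta (X i w)).2}.
Proof.
have /andP[r0 _] := hrho.
have ae1 i x : - rho <= x <= rho -> {ae P, forall w,
  (folding (theta + angle alpha x) (X i w)).1 =
  cos x * (folding theta (X i w)).1 + sin x * (folding theta (X i w)).2}.
  move=> /(moment_equality halpha hsq hrho hps hK)[B [mB B0 hB]].
  exists (X i @^-1` B); split; first exact: preimage_measurable.
    by rewrite lawX.
  by move=> w /= h; apply: hB.
have h1 : {ae P, forall w, forall i,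
  (folding (theta + angle alpha rho) (X i w)).1 =
  cos rho * (folding theta (X i w)).1 + sin rho * (folding theta (X i w)).2}.
  apply/ae_foralln => i; apply: ae1; apply/andP; split; lra.
have h2 : {ae P, forall w, forall i,
  (folding (theta + angle alpha (- rho)) (X i w)).1 =
  cos (- rho) * (folding theta (X i w)).1 + sin (- rho) * (folding theta (X i w)).2}.
  apply/ae_foralln => i; apply: ae1; apply/andP; split; lra.
by apply: filterS2 h1 h2 => w k1 k2 i x [->|->].
Qed.

Lemma emp_moment_sector (s : R) n (x : nat -> kale alpha) : 0 <= s ->
  (forall i v, v = rho \/ v = - rho -> (folding (theta + angle alpha v) (x i)).1 =
    cos v * (folding theta (x i)).1 + sin v * (folding theta (x i)).2) ->
  forall v, - rho <= v <= rho -> (emp_moment s n x (theta + angle alpha v)).1 =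
    dotp (emp_moment s n x theta) (unit_dir v).
Proof.
move=> s0 hx v hv.
have lin u : u = rho \/ u = - rho -> (emp_moment s n x (theta + angle alpha u)).1 =
  cos u * (emp_moment s n x theta).1 + sin u * (emp_moment s n x theta).2.
  move=> hu; rewrite /emp_moment; elim: n => [|n IH].
    by rewrite !big_ord0 /= !mulr0 addr0.
  rewrite !big_ord_recr; move: IH; rewrite /scale2 /= !mulrDr => ->.
  by have /= -> := hx n u hu; ring.
rewrite (folded_pair_between halpha (folded_pair_sum halpha n x s0) hrho _ _ hv).
- by rewrite /dotp /= mulrC [sin _ * _]mulrC.
- by have := lin rho (or_introl erefl).
- by have := lin (- rho) (or_intror erefl); rewrite cosN sinN mulNr.
Qed.

Definition scaled_moment n w := emp_moment (Num.sqrt n%:R)^-1 n (X^~ w) theta.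
Definition scaled_barycenter n w := dilate (Num.sqrt n%:R) (barycenter n (X^~ w)).

Lemma measurable_scaled_moment n : measurable_fun setT (scaled_moment n).
Proof. exact: measurable_emp_moment. Qed.

Local Notation N2 := (normal_prob 0 1 \x normal_prob 0 1)%E.

Section SecondMoment.
Variable A : 'M[R]_2.
Hypothesis hA : A *m A^T = second_moment (pushforward mu (folding theta)).

Lemma second_momentE i j :
  \int[mu]_q (plane_coord (folding theta q) i * plane_coord (folding theta q) j) =
  (A *m A^T) i j.
Proof.
have mY := measurable_folding halpha theta; have iY := integrable_folding halpha hsq theta.
rewrite hA mxE /Rintegral; congr fine; apply/esym.
have mc k : measurable_fun setT (fun y : R * R => plane_coord y k).
  by rewrite /plane_coord; case: (k == 0); [exact: measurable_fst|exact: measurable_snd].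
rewrite integral_pushforward//.
- by apply/measurable_EFinP; apply: measurable_funM.
rewrite preimage_setT; apply: (@integrable_dom _ _ _ mu (folding theta) iY
  (fun q => plane_coord (folding theta q) i * plane_coord (folding theta q) j) 1).
  by apply: measurable_funM; exact: (measurableT_comp (mc _) mY).
move=> q; rewrite mul1r normrM.
have cl k : `|plane_coord (folding theta q) k| <= norm1 (folding theta q).
  by rewrite /plane_coord /norm1; case: (k == 0); rewrite ?lerDl ?lerDr.
apply: le_trans (ler_pM _ _ (cl i) (cl j)) _ => //; rewrite -expr2 lerDr; exact: ler01.
Qed.

Lemma clt_scaled_moment : test_cvg P N2 scaled_moment (plane_lin A).
Proof.
have mA i j : (A *m A^T) i j = A i 0 * A j 0 + A i 1 * A j 1.
  by rewrite mxE !big_ord_recl big_ord0 addr0 !mxE; congr (_ + A i _ * A j _); exact: val_inj.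
have quadA i j : \int[N2]_z ((A i 0 * z.1 + A i 1 * z.2) * (A j 0 * z.1 + A j 1 * z.2)) =
    (A *m A^T) i j.
  rewrite mA -(Rint_plane_quad _ (A i 0 * A j 1 + A i 1 * A j 0)).
  by apply: eq_Rintegral => z _; ring.
have [m1 m2] : \int[mu]_q (folding theta q).1 = 0 /\ \int[mu]_q (folding theta q).2 = 0.
  by have := moment_center halpha hsq hrho hps hK; rewrite /folded_moment => -[-> ->].
move=> f tf; apply: (clt_test mX indX lawX (measurable_folding halpha theta)
  (integrable_folding halpha hsq theta)) => //.
- exact: measurable_plane_lin.
- exact: integrable_plane_lin.
- by rewrite m1 [RHS]Rint_plane_lin1.
- by rewrite m2 [RHS]Rint_plane_lin1.
- exact: (etrans (second_momentE 0 0) (esym (quadA 0 0))).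
- exact: (etrans (second_momentE 0 1) (esym (quadA 0 1))).
- exact: (etrans (second_momentE 1 1) (esym (quadA 1 1))).
- by move=> n n0; apply: plane_lin_stable => //; exact: taylor_bddmeas.
Qed.

Lemma aas_near_sector (eta : R) : 0 < eta -> aas P (fun n => [set w |
  kale_dist (sector_point rho theta (scaled_moment n w)) (scaled_barycenter n w) < eta]).
Proof.
move=> eta0 e e0; have e2 : 0 < e / 2 by rewrite divr_gt0.
have /andP[r0 r1] := hrho; have p2 := @pi_ge2 R; have a0 := alpha_gt0 halpha.
have [C C0 tC] := @tight _ _ _ P _ _ N2 scaled_moment (plane_lin A) (e / 2)
  (fun n => @measurable_scaled_moment n) (@measurable_plane_lin R A) clt_scaled_moment e2.
(* On the event where the moment is below [C], the bound 2 delta C^2 is at most half of eta^2; the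
   cap pi / 2 ensures [rho + delta <= pi]. *)
pose delta := Num.min (pi / 2) (eta ^+ 2 / (4 * C ^+ 2)).
have CC : 0 < 4 * C ^+ 2 by rewrite mulr_gt0// exprn_gt0.
have d0 : 0 < delta by rewrite lt_min !divr_gt0 ?exprn_gt0//; lra.
have d1 : rho + delta <= pi.
  have : delta <= pi / 2 by rewrite ge_min lexx.
  lra.
have d2 : delta * (4 * C ^+ 2) <= eta ^+ 2 by rewrite -ler_pdivlMr// ge_min lexx orbT.
have h1 := aas_ae emp_moment_equality.
have h2 := emp_moment_outside d0.
have := aasI h1 h2; set G := (G in aas P G) => h12.
near=> n.
have n0 : (0 < n)%N by near: n; exact: nbhs_infty_gt.
have [B [mB BC PB]] : exists B, [/\ measurable B,
    B `<=` [set w | norm1 (scaled_moment n w) < C] & 1 - e / 2 <= fine (P B)].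
  by near: n.
have [D [mD DC PD]] : exists D, [/\ measurable D, D `<=` G n & 1 - e / 2 <= fine (P D)].
  by near: n; exact: h12.
exists (B `&` D); split; first exact: measurableI; last first.
  by have := prob_setI_ge P mB mD; lra.
move=> w [/BC /= wC /DC [/= w1 w2]].
have nR : 0 < (n%:R : R) by rewrite ltr0n.
have s0 : 0 < Num.sqrt n%:R :> R by rewrite sqrtr_gt0.
have si : 0 <= (Num.sqrt n%:R)^-1 :> R by rewrite invr_ge0 ltW.
have := barycenter_near_sector halpha hrho (t := theta) (x := X^~ w) n0 (ltW d0) d1.
rewrite /= -/(scaled_moment n w) -/(scaled_barycenter n w) => /(_ _ _).
set D2 := kale_dist _ _; move=> near2.
have D20 : 0 <= D2 by exact: kale_dist_ge0.
have {}near2 : D2 ^+ 2 <= 2 * delta * enorm (scaled_moment n w) ^+ 2.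
  apply: near2; first by move=> v hv; exact: (emp_moment_sector n si w1 hv).
  move=> t' t0; have [x hx xE] := angle_rep_half halpha (t' - theta).
  have tE : t' = theta + angle alpha x by rewrite -xE addrC subrK.
  exists x => //; rewrite -ler_norml leNgt; apply/negP => hx'.
  have := w2 x; rewrite hx (ltW hx') -tE => /(_ isT).
  (* The factors n^(-1/2) and n^(-1) are both positive, so the sign known from the law of large
     numbers contradicts positivity at the other scale. *)
  move: t0; rewrite /emp_moment /=; set S := (\sum_(i < n) _).1.
  rewrite pmulr_rgt0 ?invr_gt0// pmulr_rlt0 ?invr_gt0// => l1 l2.
  by have := lt_trans l1 l2; rewrite ltxx.
rewrite -(ltr_pXn2r (n := 2)) ?nnegrE ?(ltW eta0)//.
apply: le_lt_trans near2 _.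
have hE : enorm (scaled_moment n w) ^+ 2 <= C ^+ 2.
  rewrite ler_sqr ?nnegrE ?enorm_ge0 ?(ltW C0)//; apply: le_trans (enorm_le_norm1 _) _; exact: ltW.
have : delta * enorm (scaled_moment n w) ^+ 2 <= delta * C ^+ 2 by rewrite ler_pM2l.
have : 0 < eta ^+ 2 by rewrite exprn_gt0.
lra.
Unshelve. all: by end_near. Qed.

End SecondMoment.
Variable g : probability (R * R)%type R.
Hypothesis hg : centered_normal (second_moment (pushforward mu (folding theta))) g.
Local Notation psi := (sector_point rho theta).
Local Notation b := scaled_barycenter.

Lemma measurable_scaled_barycenter n : measurable_fun setT (b n).
Proof.
(* For n = 0 the dilation factor is 0, and every chosen minimizer is sent to the origin. *)
case: n => [|n].
  rewrite (_ : b 0 = cst Origin); first exact: measurable_cst.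
  by apply/funext => w; rewrite /scaled_barycenter sqrtr0 /dilate mul0r kale_point0.
apply: measurableT_comp; last exact: measurable_barycenter.
by apply: measurable_dilate => //; rewrite sqrtr_gt0 ltr0n.
Qed.

(** A Slutsky argument for open sets: the preimage of [V] is exhausted by plane sets [U k] whose
    points keep a margin [eta k] inside [V], and this margin absorbs the distance from the
    barycenter to the lifted projection. *)
Lemma scaled_barycenter_liminf (V : set (kale alpha)) (e : R) : kale_open V -> 0 < e ->
  \forall n \near \oo, fine (g (psi @^-1` V)) - e <= fine (P (b n @^-1` V)).
Proof.
move=> oV e0; have e3 : 0 < e / 3 by rewrite divr_gt0.
have [A hA gA] := hg.
pose eta k : R := k.+1%:R^-1.
have eta0 k : 0 < eta k by rewrite invr_gt0 ltr0n.
(* Asking for a radius strictly above [eta k] makes [U k] open, as the liminf bound for the scaled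
   moments requires. *)
pose U k : set (R * R) := [set y | exists2 r, eta k < r &
  forall q, kale_dist (psi y) q < r -> V q].
have oU k : plane_open (U k).
  move=> y [r hr hV]; exists ((r - eta k) / 4); first by rewrite divr_gt0// subr_gt0.
  move=> z h1 h2; have yz := sector_point_near halpha hrho theta h1 h2.
  exists ((r + eta k) / 2); first lra.
  move=> q hq; apply: hV; apply: le_lt_trans (kale_dist_triangle halpha _ (psi z) _) _; lra.
have mU k := plane_open_measurable (oU k).
have UE : \bigcup_k U k = psi @^-1` V.
  apply/seteqP; split => y /= => [[k _ [r hr hV]]|/oV[r r0 hV]].
    by apply: hV; rewrite (kale_dist_self halpha); exact: lt_trans hr.
  have r1 : 0 <= r^-1 by rewrite invr_ge0 ltW.
  exists (Num.trunc r^-1) => //; exists r => //.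
  have /andP[_ h] := truncn_itv r1.
  by rewrite /eta invf_plt ?posrE ?ltr0n.
have incU k : U k `<=` U k.+1.
  move=> y [r hr hV]; exists r => //; apply: le_lt_trans hr.
  by rewrite /eta lef_pV2 ?posrE ?ltr0n// ler_nat.
have [k] := prob_increasing g mU incU e3; rewrite UE => hk.
have tc := clt_scaled_moment hA.
have mY n : measurable_fun setT (scaled_moment n) by exact: measurable_scaled_moment.
have near := aas_near_sector hA (eta0 k) e3.
near=> n.
have [B [mB BV PB]] : exists B, [/\ measurable B, B `<=` [set w |
  kale_dist (psi (scaled_moment n w)) (b n w) < eta k] & 1 - e / 3 <= fine (P B)].
  by near: n; exact: near.
have : fine (N2 (plane_lin A @^-1` U k)) - e / 3 <= fine (P (scaled_moment n @^-1` U k)).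
  by near: n; apply: open_liminf => //; exact: measurable_plane_lin.
rewrite -gA// => h.
have mW : measurable (scaled_moment n @^-1` U k) by exact: preimage_measurable.
have mV : measurable (b n @^-1` V).
  by apply: preimage_measurable; [exact: measurable_scaled_barycenter|exact: open_kale_measurable].
have : fine (P (scaled_moment n @^-1` U k `&` B)) <= fine (P (b n @^-1` V)).
  apply: fine_le; rewrite ?fin_num_measure//; first exact: measurableI.
  apply: le_measure; rewrite ?inE//; first exact: measurableI.
  move=> w [[r hr hV] /BV /= hB]; apply: hV; exact: lt_trans hr.
have := prob_setI_ge P mW mB; lra.
Unshelve. all: by end_near. Qed.

Lemma scaled_barycenter_cvg (phi : kale alpha -> R) : continuous phi ->
  (exists M : R, forall q, `|phi q| <= M) ->
  \int[P]_w phi (b n w) @[n --> \oo] --> \int[g]_y phi (psi y).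
Proof.
move=> cphi [M hM].
have ophi (D : set R) : open D -> kale_open (phi @^-1` D).
  by move=> oD; apply: (@open_comp _ _ phi D) => // q _; exact: cphi.
apply: (@portmanteau _ _ _ _ _ _ _ _ _ M).
- move=> n; apply: (measurableT_comp (measurable_continuous cphi)).
  exact: measurable_scaled_barycenter.
- exact: (measurableT_comp (measurable_continuous cphi) (measurable_sector_point halpha hrho theta)).
- by move=> n w; exact: hM.
- by move=> y; exact: hM.
- move=> s e e0; exact: (@scaled_barycenter_liminf (phi @^-1` [set x | s < x]) e (ophi _ (@open_gt _ s)) e0).
- move=> s e e0; exact: (@scaled_barycenter_liminf (phi @^-1` [set x | x < s]) e (ophi _ (@open_lt _ s)) e0).
Qed.

End Limit.

Theorem theorem1p14 (R : realType) (alpha : R) (halpha : 2 * pi < alpha)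
  (mu : probability (kale alpha) R)
  (hnd : nondegenerate_kale mu) (hps : partly_sticky mu) (hsq : square_integrable mu)
  (theta : circle alpha) (rho : R) (hrho : 0 <= rho < pi / 2)
  (hK : nonneg_directions mu = angle_interval theta rho)
  (g : probability (R * R)%type R)
  (hg : centered_normal (second_moment (pushforward mu (folding theta))) g)
  (d : measure_display) (Omega : measurableType d) (P : probability Omega R)
  (p : nat -> {RV P >-> kale alpha})
  (hind : mutually_independent P (fun n => p n : Omega -> kale alpha))
  (hdist : forall (n : nat) (U : set (kale alpha)),
     measurable U -> distribution P (p n) U = mu U)
  (phi : kale alpha -> R) (hphi : continuous phi)
  (hbd : exists M : R, forall q : kale alpha, `|phi q| <= M) :
  ((fun N => \int[scaled_barycenter_law P (fun n => p n : Omega -> kale alpha) N]_q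
               (phi q)%:E) @ \oo -->
     \int[limit_measure g theta rho]_q (phi q)%:E)%E.
Proof.
pose X n : Omega -> kale alpha := p n.
have mX n : measurable_fun setT (X n) by exact: measurable_funPT.
have cvg := scaled_barycenter_cvg halpha hsq hrho hps hK mX hind hdist hg hphi hbd.
have [M hM] := hbd.
have mphi := measurable_continuous hphi.
have law d1 (T : measurableType d1) (m : probability T R) (Z : T -> kale alpha) :
    measurable_fun setT Z ->
    (\int[pushforward m Z]_q (phi q)%:E = (\int[m]_t phi (Z t))%:E)%E.
  move=> mZ; have bZ : bddmeas (fun t => phi (Z t)).
    by split; [exact: (measurableT_comp mphi mZ)|exists M].
  have iZ := bddmeas_integrable m bZ.
  rewrite integral_pushforward//; last exact/measurable_EFinP.
  by rewrite preimage_setT /Rintegral fineK//; exact: integrable_fin_num iZ.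
(* Both sides are integrals against image measures, under the rescaled barycenter and under
   [sector_point], and [law] pulls them back. *)
rewrite limit_measureE// law; last exact: measurable_sector_point.
rewrite (_ : (fun N => _) = EFin \o (fun N => \int[P]_w phi (scaled_barycenter X N w))).
  exact: cvg_comp cvg _.
by apply/funext => N; rewrite /= -law//; exact: measurable_scaled_barycenter.
Qed.
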